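(* Let $k\ge 2$ be an integer, $\gamma>\frac32$, $m\ge 1$, $0<T<t_c$, and $\sigma_0>0$ (which may be arbitrarily small). For $\varepsilon\in(0,1]$ let $u$ be the real-valued solution of $$\partial_t u+\varepsilon^2\partial_x^3u+\tfrac1k\partial_x(u^k)=0,\quad x\in\mathbb T,\ t>0,\qquad u(\cdot,0)=u_0 .$$ Suppose that $u\in L^\infty(0,T;H^{\gamma+m}(\mathbb T))$, $\partial_t^2u\in L^\infty(0,T;H^{\gamma+3}(\mathbb T))$, $\partial_t^3u\in L^\infty(0,T;H^{\gamma}(\mathbb T))$, and that there is a constant $M>1$ independent of $\varepsilon$ such that $$\max_{0\le t\le T}\bigl\{\|u\|_{H^{\gamma+m}},\ \|\partial_t^2u\|_{H^{\gamma+3}},\ \|\partial_t^3u\|_{H^\gamma}\bigr\}\le M-1 .$$ Assume the step-size condition $\tau\lesssim\min\{\varepsilon^{1+\sigma_0},\,N^{-(1+\sigma_0)}\}$. Let $u_N^n\in Y_N$ be the numerical solution computed by the Crank–Nicolson Fourier scheme $$\frac1\tau\bigl(u_N^{n+1}-u_N^n\bigr)+\varepsilon^2\partial_x^3u_N^{n+\frac12}+\frac1kP_N\partial_x\Bigl(\bigl(u_N^{n+\frac12}\bigr)^k\Bigr)=0,\qquad u_N^{n+\frac12}=\tfrac12(u_N^{n+1}+u_N^n),$$ with $u_N^0=P_NI_{2N}u_0$. Then there exist $N_1>0$ and $\tau_1>0$ such that, if $N\ge N_1$ and $0<\tau\le\tau_1$, $$\|u(\cdot,t_n)-u_N^n\|_{H^\gamma}\le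 C\bigl(\tau^2+N^{-m+1}\bigr),\qquad 0\le n\le T/\tau,$$ where $N_1,\tau_1,C>0$ depend on $M$ and $T$, but are independent of $\varepsilon$, $N$ and $\tau$.
   Context: $\mathbb T=(-\pi,\pi)$ with periodic boundary conditions; $\tau>0$ is the time step, $t_n=n\tau$; $N$ is an even positive integer. $u_0$ is a given real-valued periodic initial datum (independent of $\varepsilon$). $t_c>0$ denotes the critical time, independent of $\varepsilon$ but depending on $u_0$, such that the solution $u$ remains smooth for all $t<t_c$ (before the gradient catastrophe / dispersive shock formation in the limit $\varepsilon\to0$). Fourier coefficients: $\widehat u(\xi)=\frac1{2\pi}\int_{\mathbb T}u(x)e^{-\mathrm i\xi(x+\pi)}\,dx$. Norm: $\|u\|_{H^\gamma}=\bigl(\sum_{\xi\in\mathbb Z}(1+\xi^2)^\gamma|\widehat u(\xi)|^2\bigr)^{1/2}$. $Y_N=\operatorname{span}\{e^{\mathrm i\xi(x+\pi)}:\xi=-\frac N2,\dots,\frac N2\}$ and $P_N:L^2(\mathbb T)\to Y_N$ is the orthogonal projection $P_Nu=\sum_{\xi=-N/2}^{N/2}\widehat u(\xi)e^{\mathrm i\xi(x+\pi)}$. For even $L$, $I_L$ is trigonometric interpolation at $x_j=-\pi+2\pi j/L$, $j=0,\dots,L-1$: $(I_Lu)(x)=\sum_{\xi=-L/2}^{L/2-1}\widetilde u(\xi)e^{\mathrm i\xi(x+\pi)}$, $\widetilde u(\xi)=\frac1L\sum_{j=0}^{L-1}u(x_j)e^{-\mathrm i\xi(x_j+\pi)}$;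 $I_{2N}$ is the case $L=2N$. $A\lesssim B$ means $|A|\le C_0B$ for some constant $C_0>0$ independent of $\varepsilon,\tau,N$. The quantities $k,\gamma,m,\sigma_0$ and the constant implied in the step-size condition are regarded as fixed. The scheme is implicit; given $u_N^n$, the numerical solution $u_N^{n+1}$ is the one obtained as the limit of the fixed-point iteration $u_{N,(0)}^{n+1}=u_N^n$, $u_{N,(i+1)}^{n+1}=\psi_{u_N^n}(u_{N,(i)}^{n+1})$, where, with $\mathcal A^\pm=I\pm\frac12\varepsilon^2\tau\partial_x^3$, $\psi_w(\phi)=(\mathcal A^+)^{-1}\mathcal A^-w-\frac\tau k(\mathcal A^+)^{-1}\partial_xP_N\bigl((\tfrac{w+\phi}2)^k\bigr)$. *)

(* Defs.v *)
From Stdlib Require Export Reals ZArith.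
From Coquelicot Require Export Coquelicot.
Open Scope R_scope.

(** Functions on the torus are represented by 2*PI-periodic functions on the
    whole real line. *)
Definition periodic {A : Type} (f : R -> A) : Prop :=
  forall x, f (x + 2 * PI) = f x.

(** exp (i theta) *)
Definition cis (theta : R) : C := (cos theta, sin theta).

(** exp (i xi (x + PI)) *)
Definition mode (xi : Z) (x : R) : C := cis (IZR xi * (x + PI)).

Definition fourier (f : R -> C) (xi : Z) : C :=
  (RtoC (/ (2 * PI)) *
   RInt (V := C_R_CompleteNormedModule)
     (fun x => f x * cis (- (IZR xi * (x + PI))))%C (- PI) PI)%C.

(** Absolutely convergent two-sided series over Z, only used for nonnegative
    terms.  [Series] is 0 when the series diverges, so [sum_Z] is meaningful
    only together with [ex_sum_Z]. *)
Definition ex_sum_Z (a : Z -> R) : Prop :=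
  ex_series (fun n => a (Z.of_nat n)) /\
  ex_series (fun n => a (- Z.of_nat (S n))%Z).

Definition sum_Z (a : Z -> R) : R :=
  Series (fun n => a (Z.of_nat n)) + Series (fun n => a (- Z.of_nat (S n))%Z).

Definition sobolev_term (s : R) (f : R -> C) (xi : Z) : R :=
  Rpower (1 + IZR xi ^ 2) s * Cmod (fourier f xi) ^ 2.

Definition Hnorm (s : R) (f : R -> C) : R := sqrt (sum_Z (sobolev_term s f)).

(** Membership in H^s of the torus.  All the exponents in use are > 1/2, so
    elements of H^s are identified with their continuous representatives. *)
Definition in_H (s : R) (f : R -> C) : Prop :=
  periodic f /\ (forall x, continuous f x) /\ ex_sum_Z (sobolev_term s f).

(** ||f||_{H^s} <= B, the norm being +oo outside H^s. *)
Definition Hnorm_le (s : R) (f : R -> C) (B : R) : Prop :=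
  in_H s f /\ Hnorm s f <= B.

(** Sum of c xi * exp (i xi (x + PI)) over a <= xi <= b (for a <= b). *)
Definition trig_sum (a b : Z) (c : Z -> C) (x : R) : C :=
  sum_n (fun j => c (a + Z.of_nat j)%Z * mode (a + Z.of_nat j) x)%C
        (Z.to_nat (b - a)).

Definition in_Y (N : nat) (f : R -> C) : Prop :=
  exists c : Z -> C,
    forall x, f x = trig_sum (- (Z.of_nat N / 2)) (Z.of_nat N / 2) c x.

Definition proj (N : nat) (f : R -> C) : R -> C :=
  trig_sum (- (Z.of_nat N / 2)) (Z.of_nat N / 2) (fourier f).

Definition grid (L j : nat) : R := - PI + 2 * PI * INR j / INR L.

Definition dft (L : nat) (f : R -> C) (xi : Z) : C :=
  (RtoC (/ INR L) *
   sum_n (fun j => f (grid L j) * cis (- (IZR xi * (grid L j + PI))))%C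
         (L - 1))%C.

Definition interp (L : nat) (f : R -> C) : R -> C :=
  trig_sum (- (Z.of_nat L / 2)) (Z.of_nat L / 2 - 1) (dft L f).

Definition Dx (n : nat) (f : R -> C) (x : R) : C :=
  (Derive_n (fun y => Re (f y)) n x, Derive_n (fun y => Im (f y)) n x).

Definition A_plus (eps tau : R) (f : R -> C) (x : R) : C :=
  (f x + RtoC (/ 2 * eps ^ 2 * tau) * Dx 3 f x)%C.

Definition A_minus (eps tau : R) (f : R -> C) (x : R) : C :=
  (f x - RtoC (/ 2 * eps ^ 2 * tau) * Dx 3 f x)%C.

(** g = (A_plus)^{-1} f.  On Y_N the operator [A_plus] is diagonal with nonzero
    eigenvalues 1 - i eps^2 tau xi^3 / 2, hence invertible. *)
Definition is_A_plus_inv (N : nat) (eps tau : R) (f g : R -> C) : Prop :=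
  in_Y N g /\ forall x, A_plus eps tau g x = f x.

Definition half_sum (v w : R -> C) (x : R) : C := ((v x + w x) / RtoC 2)%C.

(** g = psi_w (phi), where psi_w (phi) =
    A_plus^{-1} A_minus w - (tau / k) A_plus^{-1} d_x P_N (((w + phi) / 2)^k) *)
Definition is_psi (k N : nat) (eps tau : R) (w phi g : R -> C) : Prop :=
  exists a b : R -> C,
    is_A_plus_inv N eps tau (A_minus eps tau w) a /\
    is_A_plus_inv N eps tau
      (Dx 1 (proj N (fun x => (half_sum w phi x ^ k)%C))) b /\
    forall x, g x = (a x - RtoC (tau / INR k) * b x)%C.

(** v is the limit of the fixed-point iteration of psi_w started at w.  All the
    iterates lie in the finite-dimensional space Y_N, so that the choice of the
    norm is immaterial. *)
Definition is_fixed_point_limit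
    (k N : nat) (s eps tau : R) (w v : R -> C) : Prop :=
  exists phi : nat -> R -> C,
    (forall x, phi 0%nat x = w x) /\
    (forall i, is_psi k N eps tau w (phi i) (phi (S i))) /\
    is_lim_seq (fun i => Hnorm s (fun x => phi i x - v x)%C) 0.

Definition CN_step (k N : nat) (eps tau : R) (w v : R -> C) : Prop :=
  forall x,
    ((v x - w x) / RtoC tau
     + RtoC (eps ^ 2) * Dx 3 (half_sum v w) x
     + RtoC (/ INR k) * proj N (Dx 1 (fun y => (half_sum v w y ^ k)%C)) x
     = RtoC 0)%C.

(** U n is the numerical solution at time n * tau, as long as n * tau <= T. *)
Record numerical_solution (k N : nat) (s T eps tau : R) (u0 : R -> R)
    (U : nat -> R -> C) : Prop := {
  num_init : forall x,
    U 0%nat x = proj N (interp (2 * N) (fun y => RtoC (u0 y))) x;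
  num_space : forall n, INR n <= T / tau -> in_Y N (U n);
  num_scheme : forall n, INR (S n) <= T / tau ->
    CN_step k N eps tau (U n) (U (S n));
  num_limit : forall n, INR (S n) <= T / tau ->
    is_fixed_point_limit k N s eps tau (U n) (U (S n))
}.

(** u is a classical solution, on the time interval [0, tc), of
    u_t + eps^2 u_xxx + (1/k) (u^k)_x = 0 with initial datum u0. *)
Record classical_solution (k : nat) (eps tc : R) (u0 : R -> R)
    (u : R -> R -> R) : Prop := {
  sol_periodic : forall t, 0 <= t < tc -> periodic (u t);
  sol_init : forall x, u 0 x = u0 x;
  sol_continuous : forall t x, 0 <= t < tc ->
    filterlim (fun p : R * R => u (fst p) (snd p))
      (within (fun p : R * R => 0 <= fst p) (locally (t, x)))
      (locally (u t x));
  sol_derivable_t : forall t x, 0 < t < tc -> ex_derive (fun s => u s x) t;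
  sol_derivable_x : forall t x j, 0 < t < tc -> (j <= 3)%nat ->
    ex_derive_n (u t) j x;
  sol_equation : forall t x, 0 < t < tc ->
    Derive (fun s => u s x) t + eps ^ 2 * Derive_n (u t) 3 x
    + / INR k * Derive (fun y => u t y ^ k) x = 0
}.

Definition dt (j : nat) (u : R -> R -> R) (t x : R) : R :=
  Derive_n (fun s => u s x) j t.

(** The time derivatives are taken on the open interval (0, T), where they are
    two-sided.  For a solution with these bounds, a time derivative of order 3
    in the weak sense is automatically a pointwise one: weak continuity in
    H^{gamma+3} makes dt 2 u, and through the equation dt 3 u, continuous. *)
Record regularity_bound (gamma m T B : R) (u : R -> R -> R) : Prop := {
  reg_u : forall t, 0 <= t <= T ->
    Hnorm_le (gamma + m) (fun x => RtoC (u t x)) B;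
  reg_derivable : forall t x j, 0 < t < T -> (j <= 3)%nat ->
    ex_derive_n (fun s => u s x) j t;
  reg_dt2 : forall t, 0 < t < T ->
    Hnorm_le (gamma + 3) (fun x => RtoC (dt 2 u t x)) B;
  reg_dt3 : forall t, 0 < t < T ->
    Hnorm_le gamma (fun x => RtoC (dt 3 u t x)) B
}.

(* Main.v *)
Require Import Defs.
From Stdlib Require Import Lra Lia Psatz List FinFun Permutation Classical.
Import ListNotations.

(** Consistency and stability give convergence. Everything is expressed through
    Fourier coefficients; Sobolev bounds are bounds on finite weighted sums of
    squares ([hb]), which pass to limits without further argument.

    Consistency ([consistency]). In Fourier variables the equation is an ordinary
    differential equation for each coefficient ([equation_fourier]), and the scheme
    is the trapezoidal rule for it, except that the mean of the powers is replaced
    by the power of the mean. The trapezoidal error needs three time derivatives of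
    the coefficients. The third one is read off the equation, from u_tt in
    H^(gamma+3) and (u^k)_tt in H^(gamma+1), so that its bound is uniform in eps.
    The other error is quadratic in the increment of u ([Hs_pow_mean]). One step
    therefore leaves a defect of order tau^3.

    Stability ([energy_step]). Let e be the mean of the errors of the Fourier
    projection at both ends of a step, and test the error equation with e in H^s.
    The dispersive term is skew-adjoint and vanishes, so no constant depends on
    eps. Truncating the exact solution to the available frequencies inside the flux
    costs N^(-m+1) when s = gamma. The remaining flux difference is a transport
    term U^(k-1) e_x plus a term without derivatives of e. Antisymmetrising the
    transport term in the two frequencies leaves a commutator whose symbol
    ([commutator_symbol]) puts the derivative on U^(k-1), or else on a factor that
    is absolutely summable because s > 3/2 ([transport_energy]). Hence the H^s error
    obeys a discrete Gronwall inequality, with constants governed by the H^s norms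
    of the numerical solution ([error_bound]).

    A priori bound. For m = 1 the error bound in H^gamma is not small and cannot by
    itself keep the numerical solution bounded. In H^(gamma-d), with d > 0 small
    enough that gamma - d > 3/2, the same argument gains a factor N^(-d), so there
    the error is at most 1 once tau and 1/N are small. This keeps the numerical
    solution in a fixed ball, where tau N << 1 makes the fixed-point iteration a
    contraction: the step exists, and the limit selected by the iteration stays in
    a slightly larger ball ([a_priori_bound], [partial_solution_exists]). An inverse
    inequality turns the H^(gamma-d) error into a bound in H^gamma, as tau N is
    bounded and d <= 1, and the energy estimate is then run a second time in
    H^gamma ([strong_norm_error]). *)

(** * Finite sums *)

Fixpoint rsum {A : Type} (f : A -> R) (l : list A) : R :=
  match l with [] => 0 | x :: l' => f x + rsum f l' end.

Fixpoint csum {A : Type} (f : A -> C) (l : list A) : C :=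
  match l with [] => RtoC 0 | x :: l' => (f x + csum f l')%C end.

Lemma rsum_ext {A} (f g : A -> R) l :
  (forall x, In x l -> f x = g x) -> rsum f l = rsum g l.
Proof.
  induction l as [|a l IH]; simpl; intros H; [reflexivity|].
  rewrite (H a), IH; auto.
Qed.

Lemma rsum_le {A} (f g : A -> R) l :
  (forall x, In x l -> f x <= g x) -> rsum f l <= rsum g l.
Proof.
  induction l as [|a l IH]; simpl; intros H; [lra|].
  apply Rplus_le_compat; auto.
Qed.

Lemma rsum_ge0 {A} (f : A -> R) l : (forall x, In x l -> 0 <= f x) -> 0 <= rsum f l.
Proof.
  induction l as [|a l IH]; simpl; intros H; [lra|].
  apply Rplus_le_le_0_compat; auto.
Qed.

Lemma rsum_plus {A} (f g : A -> R) l :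
  rsum (fun x => f x + g x) l = rsum f l + rsum g l.
Proof. induction l as [|a l IH]; simpl; [ring|rewrite IH; ring]. Qed.

Lemma rsum_scal {A} (c : R) (f : A -> R) l : rsum (fun x => c * f x) l = c * rsum f l.
Proof. induction l as [|a l IH]; simpl; [ring|rewrite IH; ring]. Qed.

Lemma rsum_const {A} (c : R) (l : list A) : rsum (fun _ => c) l = INR (length l) * c.
Proof.
  induction l as [|a l IH]; [simpl; ring|].
  cbn [rsum length]. rewrite IH, S_INR. ring.
Qed.

Lemma rsum_swap {A B} (f : A -> B -> R) l l' :
  rsum (fun x => rsum (f x) l') l = rsum (fun y => rsum (fun x => f x y) l) l'.
Proof.
  induction l as [|a l IH]; simpl.
  - induction l' as [|b l' IH']; simpl; [ring|rewrite <- IH'; ring].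
  - rewrite IH, <- rsum_plus. reflexivity.
Qed.

Lemma rsum_map {A B} (h : A -> B) (f : B -> R) l :
  rsum f (map h l) = rsum (fun x => f (h x)) l.
Proof. induction l as [|a l IH]; simpl; [reflexivity|rewrite IH; reflexivity]. Qed.

Lemma rsum_app {A} (f : A -> R) l l' : rsum f (l ++ l') = rsum f l + rsum f l'.
Proof. induction l as [|a l IH]; simpl; [ring|rewrite IH; ring]. Qed.

Lemma rsum_Rabs {A} (f : A -> R) l : Rabs (rsum f l) <= rsum (fun x => Rabs (f x)) l.
Proof.
  induction l as [|a l IH]; simpl; [rewrite Rabs_R0; lra|].
  eapply Rle_trans; [apply Rabs_triang|lra].
Qed.

(** The sums compared below run over unrelated finite sets of frequencies; for
    nonnegative terms all that matters is inclusion. *)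
Lemma rsum_incl {A} (f : A -> R) l l' :
  NoDup l -> incl l l' -> (forall x, 0 <= f x) -> rsum f l <= rsum f l'.
Proof.
  revert l'. induction l as [|a l IH]; simpl; intros l' Hnd Hi H0.
  - apply rsum_ge0; auto.
  - destruct (in_split a l') as [l1 [l2 E]]; [apply Hi; left; auto|]. subst l'.
    inversion Hnd; subst.
    assert (rsum f l <= rsum f (l1 ++ l2)).
    { apply IH; auto. intros y Hy.
      assert (Hy' : In y (l1 ++ a :: l2)) by (apply Hi; right; auto).
      apply in_app_or in Hy'. apply in_or_app.
      destruct Hy' as [?|[?|?]]; auto. subst; tauto. }
    rewrite rsum_app in *. simpl. lra.
Qed.

Lemma rsum_filter {A} (p : A -> bool) (f : A -> R) l :
  rsum f l = rsum f (filter p l) + rsum f (filter (fun x => negb (p x)) l).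
Proof.
  induction l as [|a l IH]; simpl; [ring|].
  destruct (p a); simpl; rewrite IH; ring.
Qed.

Lemma csum_ext {A} (f g : A -> C) l :
  (forall x, In x l -> f x = g x) -> csum f l = csum g l.
Proof.
  induction l as [|a l IH]; simpl; intros H; [reflexivity|].
  rewrite (H a), IH; auto.
Qed.

Lemma csum_plus {A} (f g : A -> C) l :
  csum (fun x => f x + g x)%C l = (csum f l + csum g l)%C.
Proof. induction l as [|a l IH]; simpl; [ring|rewrite IH; ring]. Qed.

Lemma csum_scal {A} (c : C) (f : A -> C) l :
  csum (fun x => c * f x)%C l = (c * csum f l)%C.
Proof. induction l as [|a l IH]; simpl; [ring|rewrite IH; ring]. Qed.

Lemma csum_zero {A} (f : A -> C) l :
  (forall x, In x l -> f x = RtoC 0) -> csum f l = RtoC 0.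
Proof.
  induction l as [|a l IH]; simpl; intros H; [reflexivity|].
  rewrite (H a), IH; auto. ring.
Qed.

Lemma csum_swap {A B} (f : A -> B -> C) l l' :
  csum (fun x => csum (f x) l') l = csum (fun y => csum (fun x => f x y) l) l'.
Proof.
  induction l as [|a l IH]; simpl.
  - symmetry. apply csum_zero; auto.
  - rewrite IH, <- csum_plus. reflexivity.
Qed.

Lemma csum_app {A} (f : A -> C) l l' : csum f (l ++ l') = (csum f l + csum f l')%C.
Proof. induction l as [|a l IH]; simpl; [ring|rewrite IH; ring]. Qed.

Lemma csum_map {A B} (h : A -> B) (f : B -> C) l :
  csum f (map h l) = csum (fun x => f (h x)) l.
Proof. induction l as [|a l IH]; simpl; [reflexivity|rewrite IH; reflexivity]. Qed.

Lemma csum_Cmod {A} (f : A -> C) l : Cmod (csum f l) <= rsum (fun x => Cmod (f x)) l.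
Proof.
  induction l as [|a l IH]; simpl; [rewrite Cmod_0; lra|].
  eapply Rle_trans; [apply Cmod_triangle|lra].
Qed.

Lemma csum_Re {A} (f : A -> C) l : Re (csum f l) = rsum (fun x => Re (f x)) l.
Proof. induction l as [|a l IH]; simpl; [reflexivity|rewrite <- IH; reflexivity]. Qed.

Lemma csum_single {A} (f : A -> C) l a :
  NoDup l -> In a l -> (forall x, In x l -> x <> a -> f x = RtoC 0) -> csum f l = f a.
Proof.
  induction l as [|b l IH]; simpl; intros Hnd Ha H; [tauto|].
  inversion Hnd; subst. destruct Ha as [->|Ha].
  - rewrite csum_zero; [ring|]. intros x Hx. apply H; auto. intros ->; tauto.
  - rewrite (H b), IH; auto; [ring|]. intros ->; tauto.
Qed.

Lemma rsum_CS_sq {A} (x y : A -> R) l :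
  rsum (fun i => x i * y i) l ^ 2 <= rsum (fun i => x i ^ 2) l * rsum (fun i => y i ^ 2) l.
Proof.
  induction l as [|a l IH]; cbn [rsum]; [nra|].
  set (S := rsum (fun i => x i * y i) l) in *.
  set (X := rsum (fun i => x i ^ 2) l) in *. set (Y := rsum (fun i => y i ^ 2) l) in *.
  assert (HX : 0 <= X) by (apply rsum_ge0; intros; apply pow2_ge_0).
  assert (HY : 0 <= Y) by (apply rsum_ge0; intros; apply pow2_ge_0).
  assert (K : 2 * S * (x a * y a) <= X * y a ^ 2 + Y * x a ^ 2).
  { assert (P : 0 <= X * y a ^ 2 + Y * x a ^ 2).
    { apply Rplus_le_le_0_compat; apply Rmult_le_pos; auto; apply pow2_ge_0. }
    apply Rle_trans with (Rabs (2 * S * (x a * y a))); [apply Rle_abs|].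
    rewrite <- (Rabs_pos_eq _ P). apply Rsqr_le_abs_0. unfold Rsqr.
    assert (Q : S ^ 2 * (x a * y a) ^ 2 <= X * Y * (x a * y a) ^ 2)
      by (apply Rmult_le_compat_r; auto; apply pow2_ge_0).
    assert (0 <= (X * y a ^ 2 - Y * x a ^ 2) ^ 2) by apply pow2_ge_0. nra. }
  nra.
Qed.

Lemma rsum_CS {A} (x y : A -> R) l X Y :
  0 <= X -> 0 <= Y -> rsum (fun i => x i ^ 2) l <= X ^ 2 ->
  rsum (fun i => y i ^ 2) l <= Y ^ 2 -> rsum (fun i => x i * y i) l <= X * Y.
Proof.
  intros HX HY H1 H2. apply Rle_trans with (Rabs (rsum (fun i => x i * y i) l)); [apply Rle_abs|].
  rewrite <- (Rabs_pos_eq (X * Y)) by nra. apply Rsqr_le_abs_0. unfold Rsqr.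
  pose proof (rsum_CS_sq x y l).
  assert (0 <= rsum (fun i => x i ^ 2) l) by (apply rsum_ge0; intros; apply pow2_ge_0).
  assert (0 <= rsum (fun i => y i ^ 2) l) by (apply rsum_ge0; intros; apply pow2_ge_0).
  assert (rsum (fun i => x i ^ 2) l * rsum (fun i => y i ^ 2) l <= X ^ 2 * Y ^ 2)
    by (apply Rmult_le_compat; auto).
  nra.
Qed.

Lemma rsum_Minkowski {A} (x y : A -> R) l X Y :
  0 <= X -> 0 <= Y -> rsum (fun i => x i ^ 2) l <= X ^ 2 ->
  rsum (fun i => y i ^ 2) l <= Y ^ 2 -> rsum (fun i => (x i + y i) ^ 2) l <= (X + Y) ^ 2.
Proof.
  intros HX HY H1 H2. pose proof (rsum_CS x y l X Y HX HY H1 H2).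
  replace (rsum (fun i => (x i + y i) ^ 2) l) with
    (rsum (fun i => x i ^ 2) l + rsum (fun i => y i ^ 2) l + 2 * rsum (fun i => x i * y i) l).
  - nra.
  - rewrite <- rsum_scal, <- !rsum_plus. apply rsum_ext. intros; ring.
Qed.

(** Symmetric ranges exhaust the integers, and the frequencies of the degree [K]
    trigonometric polynomials form such a range. *)
Definition zr (K : nat) : list Z :=
  map (fun j => (- Z.of_nat K + Z.of_nat j)%Z) (seq 0 (2 * K + 1)).

Lemma in_zr K xi : In xi (zr K) <-> (- Z.of_nat K <= xi <= Z.of_nat K)%Z.
Proof.
  unfold zr. rewrite in_map_iff. split.
  - intros [j [<- Hj]]. apply in_seq in Hj. lia.
  - intros H. exists (Z.to_nat (xi + Z.of_nat K)). split; [lia|]. apply in_seq. lia.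
Qed.

Lemma NoDup_zr K : NoDup (zr K).
Proof. apply Injective_map_NoDup; [intros i j; lia|apply seq_NoDup]. Qed.

Lemma incl_zr l : exists K, incl l (zr K).
Proof.
  induction l as [|a l [K HK]]; [exists 0%nat; intros x []|].
  exists (K + Z.to_nat (Z.abs a))%nat. intros x [<-|Hx]; rewrite in_zr; [lia|].
  apply HK in Hx. rewrite in_zr in Hx. lia.
Qed.

(** The constant may be 0, as happens when it is a norm. *)
Lemma le_of_eps (x y c : R) : 0 <= c -> (forall e, 0 < e -> x <= y + e * c) -> x <= y.
Proof.
  intros Hc H. destruct (Rle_or_lt x y) as [|Hlt]; auto.
  assert (Hp : 0 < (x - y) / (2 * (c + 1))) by (apply Rdiv_lt_0_compat; lra).
  specialize (H _ Hp).
  assert ((x - y) / (2 * (c + 1)) * c <= (x - y) / 2).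
  { replace ((x - y) / (2 * (c + 1)) * c) with ((x - y) / 2 * (c / (c + 1))) by (field; lra).
    rewrite <- (Rmult_1_r ((x - y) / 2)) at 2. apply Rmult_le_compat_l; [lra|].
    apply Rmult_le_reg_r with (c + 1); [lra|]. field_simplify; lra. }
  lra.
Qed.

(** * Sobolev weights *)

(** The exponent is halved because the Sobolev norm is the plain l^2 norm of the
    coefficients multiplied by this weight. *)
Definition wt (s : R) (xi : Z) : R := Rpower (1 + IZR xi ^ 2) (s / 2).

Lemma jb_ge1 xi : 1 <= 1 + IZR xi ^ 2.
Proof. pose proof (pow2_ge_0 (IZR xi)). lra. Qed.

Lemma Rpower_pos x y : 0 < Rpower x y.
Proof. apply exp_pos. Qed.

Lemma Rpower_ge1 x y : 1 <= x -> 0 <= y -> 1 <= Rpower x y.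
Proof. intros. rewrite <- (Rpower_O x) by lra. apply Rle_Rpower; lra. Qed.

Lemma Rpower_le1 x y : 1 <= x -> y <= 0 -> Rpower x y <= 1.
Proof.
  intros. apply Rle_trans with (Rpower x 0); [apply Rle_Rpower; lra|]. rewrite Rpower_O; lra.
Qed.

Lemma wt_pos s xi : 0 < wt s xi.
Proof. apply Rpower_pos. Qed.

Lemma wt_ge1 s xi : 0 <= s -> 1 <= wt s xi.
Proof. intros. apply Rpower_ge1; [apply jb_ge1|lra]. Qed.

Lemma wt_le s t xi : s <= t -> wt s xi <= wt t xi.
Proof. intros. apply Rle_Rpower; [apply jb_ge1|lra]. Qed.

Lemma wt_plus s t xi : wt (s + t) xi = wt s xi * wt t xi.
Proof. unfold wt. rewrite <- Rpower_plus. f_equal. lra. Qed.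

Lemma wt_sq s xi : wt s xi ^ 2 = Rpower (1 + IZR xi ^ 2) s.
Proof.
  replace (wt s xi ^ 2) with (wt s xi * wt s xi) by ring.
  unfold wt. rewrite <- Rpower_plus. f_equal. lra.
Qed.

Lemma wt_1 xi : wt 1 xi = sqrt (1 + IZR xi ^ 2).
Proof.
  unfold wt. replace (1 / 2) with (/ 2) by lra. apply Rpower_sqrt.
  pose proof (jb_ge1 xi). lra.
Qed.

Lemma wt_Rpower s xi : wt s xi = Rpower (wt 1 xi) s.
Proof. unfold wt. rewrite Rpower_mult. f_equal. lra. Qed.

Lemma abs_le_wt1 xi : Rabs (IZR xi) <= wt 1 xi.
Proof.
  rewrite wt_1, <- sqrt_Rsqr_abs. apply sqrt_le_1_alt. unfold Rsqr. nra.
Qed.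

Lemma wt1_le xi : wt 1 xi <= 1 + Rabs (IZR xi).
Proof.
  rewrite wt_1. apply Rsqr_incr_0_var; [|pose proof (Rabs_pos (IZR xi)); lra].
  rewrite Rsqr_sqrt by (pose proof (jb_ge1 xi); lra). unfold Rsqr.
  rewrite <- (pow2_abs (IZR xi)). pose proof (Rabs_pos (IZR xi)). nra.
Qed.

(** Triangle inequality in the plane for the vectors (1, z) and (0, x - z). *)
Lemma wt1_lip x z : wt 1 x <= wt 1 z + Rabs (IZR (x - z)).
Proof.
  rewrite minus_IZR, (wt_1 x). pose proof (abs_le_wt1 z) as Hz.
  assert (E : wt 1 z ^ 2 = 1 + IZR z ^ 2).
  { rewrite wt_sq. apply Rpower_1. pose proof (jb_ge1 z). lra. }
  pose proof (wt_pos 1 z). set (q := wt 1 z) in *. set (d := IZR x - IZR z).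
  pose proof (Rabs_pos d). apply Rsqr_incr_0_var; [|lra].
  rewrite Rsqr_sqrt by (pose proof (jb_ge1 x); lra). unfold Rsqr.
  replace (IZR x) with (IZR z + d) by (unfold d; ring).
  assert (IZR z * d <= q * Rabs d).
  { eapply Rle_trans; [apply Rle_abs|]. rewrite Rabs_mult.
    apply Rmult_le_compat_r; auto. }
  pose proof (pow2_abs d). nra.
Qed.

Lemma wt_tail s t K xi :
  s <= t -> 1 <= K -> K <= Rabs (IZR xi) -> wt s xi <= Rpower K (- (t - s)) * wt t xi.
Proof.
  intros Hst HK Hx. replace t with (s + (t - s)) at 2 by ring.
  rewrite wt_plus, (wt_Rpower (t - s)), Rpower_Ropp.
  assert (Rpower K (t - s) <= Rpower (wt 1 xi) (t - s)).
  { apply Rle_Rpower_l; [lra|]. pose proof (abs_le_wt1 xi). lra. }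
  pose proof (Rpower_pos K (t - s)). pose proof (wt_pos s xi).
  replace (/ Rpower K (t - s) * (wt s xi * Rpower (wt 1 xi) (t - s)))
    with (wt s xi * (Rpower (wt 1 xi) (t - s) / Rpower K (t - s))) by (field; lra).
  rewrite <- (Rmult_1_r (wt s xi)) at 1. apply Rmult_le_compat_l; [lra|].
  apply Rmult_le_reg_r with (Rpower K (t - s)); auto. field_simplify; lra.
Qed.

Lemma wt_upper s K xi : 0 <= s -> Rabs (IZR xi) <= K -> wt s xi <= Rpower (1 + K) s.
Proof.
  intros Hs Hx. rewrite wt_Rpower. pose proof (wt1_le xi). pose proof (wt_ge1 1 xi).
  apply Rle_Rpower_l; lra.
Qed.

Lemma Rpower_subadd p q r s :
  0 < p -> 1 <= q -> 1 <= r -> 0 <= s -> p <= q + r ->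
  Rpower p s <= Rpower 2 s * (Rpower q s + Rpower r s).
Proof.
  intros Hp Hq Hr Hs H. pose proof (Rpower_pos q s). pose proof (Rpower_pos r s).
  pose proof (Rpower_pos 2 s).
  destruct (Rle_or_lt q r).
  - apply Rle_trans with (Rpower (2 * r) s); [apply Rle_Rpower_l; lra|].
    rewrite <- Rpower_mult_distr by lra. nra.
  - apply Rle_trans with (Rpower (2 * q) s); [apply Rle_Rpower_l; lra|].
    rewrite <- Rpower_mult_distr by lra; nra.
Qed.

Lemma wt_subadd s x z : 0 <= s -> wt s x <= Rpower 2 s * (wt s (x - z) + wt s z).
Proof.
  intros Hs. rewrite (wt_Rpower s x), (wt_Rpower s z), (wt_Rpower s (x - z)).
  apply Rpower_subadd; auto; try apply wt_pos; try (apply wt_ge1; lra).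
  pose proof (wt1_lip x z). pose proof (abs_le_wt1 (x - z)). lra.
Qed.

Lemma Rpower_diff p q a :
  0 < q -> q <= p -> 1 <= a -> Rpower p a - Rpower q a <= a * Rpower p (a - 1) * (p - q).
Proof.
  intros Hq Hqp Ha.
  destruct (MVT_gen (fun x => Rpower x a) q p (fun x => a * Rpower x (a - 1))) as [c [Hc E]].
  - intros x. rewrite Rmin_left, Rmax_right by lra. intros Hx.
    apply is_derive_Reals. apply derivable_pt_lim_power. lra.
  - intros x. rewrite Rmin_left, Rmax_right by lra. intros Hx.
    apply derivable_continuous_pt. exists (a * Rpower x (a - 1)).
    apply derivable_pt_lim_power. lra.
  - rewrite Rmin_left, Rmax_right in Hc by lra. rewrite E.
    apply Rmult_le_compat_r; [lra|]. apply Rmult_le_compat_l; [lra|].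
    apply Rle_Rpower_l; lra.
Qed.

(** The symbol left over when the top-order part of the commutator is
    antisymmetrised: one derivative always falls on the difference of the
    frequencies, or on the lowest of the two. *)
Lemma commutator_symbol_half s p q r x z :
  1 / 2 <= s -> 1 <= q -> q <= p -> 1 <= r -> p - q <= r -> Rabs x <= p -> Rabs z <= q ->
  Rabs (x - z) <= r ->
  Rabs (Rpower p (2 * s) * z - Rpower q (2 * s) * x) <=
  (2 + 2 * s) * Rpower 2 s * (Rpower p s * Rpower q s * r + Rpower p s * Rpower r s * q).
Proof.
  intros Hs Hq Hqp Hr Hd Hx Hz Hxz.
  pose proof (Rpower_pos p s) as Pp. pose proof (Rpower_pos q s) as Pq.
  pose proof (Rpower_pos r s) as Pr. pose proof (Rpower_ge1 2 s ltac:(lra) ltac:(lra)) as P2.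
  assert (Ep : Rpower p (2 * s) = Rpower p s * Rpower p s)
    by (rewrite <- Rpower_plus; f_equal; ring).
  assert (Q0 : 0 <= Rpower p s * Rpower q s * r) by (apply Rmult_le_pos; nra).
  assert (Q1 : 0 <= Rpower p s * Rpower r s * q) by (apply Rmult_le_pos; nra).
  destruct (Rle_or_lt p (2 * q)) as [H2|H2].
  - assert (A : Rabs (Rpower p (2 * s) * z - Rpower q (2 * s) * x)
                <= (1 + 2 * s) * (Rpower p (2 * s) * r)).
    { replace (Rpower p (2 * s) * z - Rpower q (2 * s) * x) with
        (Rpower p (2 * s) * - (x - z) + x * (Rpower p (2 * s) - Rpower q (2 * s))) by ring.
      eapply Rle_trans; [apply Rabs_triang|]. rewrite !Rabs_mult, Rabs_Ropp.
      rewrite (Rabs_pos_eq (Rpower p (2 * s))) by (left; apply Rpower_pos).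
      assert (B : 0 <= Rpower p (2 * s) - Rpower q (2 * s)).
      { assert (Rpower q (2 * s) <= Rpower p (2 * s)) by (apply Rle_Rpower_l; lra). lra. }
      rewrite (Rabs_pos_eq _ B).
      assert (D : Rpower p (2 * s) - Rpower q (2 * s) <= 2 * s * Rpower p (2 * s - 1) * r).
      { eapply Rle_trans; [apply Rpower_diff; lra|].
        apply Rmult_le_compat_l; auto. apply Rmult_le_pos; [lra|left; apply Rpower_pos]. }
      assert (E : p * Rpower p (2 * s - 1) = Rpower p (2 * s)).
      { rewrite <- (Rpower_1 p) at 1 by lra. rewrite <- Rpower_plus. f_equal. ring. }
      assert (Rabs x * (Rpower p (2 * s) - Rpower q (2 * s))
              <= p * (2 * s * Rpower p (2 * s - 1) * r)).
      { apply Rmult_le_compat; auto; apply Rabs_pos. }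
      assert (Rpower p (2 * s) * Rabs (x - z) <= Rpower p (2 * s) * r)
        by (apply Rmult_le_compat_l; [left; apply Rpower_pos|auto]).
      replace (p * (2 * s * Rpower p (2 * s - 1) * r)) with
        (2 * s * (p * Rpower p (2 * s - 1)) * r) in H by ring. rewrite E in H. lra. }
    assert (B : Rpower p (2 * s) <= Rpower 2 s * (Rpower p s * Rpower q s)).
    { rewrite Ep. assert (Rpower p s <= Rpower 2 s * Rpower q s).
      { rewrite Rpower_mult_distr by lra. apply Rle_Rpower_l; lra. }
      nra. }
    eapply Rle_trans; [exact A|].
    assert (C : Rpower p (2 * s) * r <= Rpower 2 s * (Rpower p s * Rpower q s * r)).
    { rewrite <- !Rmult_assoc. rewrite <- !Rmult_assoc in B. apply Rmult_le_compat_r; lra. }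
    set (X := Rpower p s * Rpower q s * r) in *. set (Y := Rpower p s * Rpower r s * q) in *.
    assert (0 <= Rpower 2 s * Y) by nra. assert (0 <= Rpower 2 s * X) by nra. nra.
  - assert (A : Rabs (Rpower p (2 * s) * z - Rpower q (2 * s) * x)
                <= 2 * (Rpower p (2 * s) * q)).
    { eapply Rle_trans; [apply Rabs_triang|]. rewrite Rabs_Ropp, !Rabs_mult.
      rewrite !(Rabs_pos_eq (Rpower _ _)) by (left; apply Rpower_pos).
      assert (Rpower p (2 * s) * Rabs z <= Rpower p (2 * s) * q)
        by (apply Rmult_le_compat_l; [left; apply Rpower_pos|auto]).
      assert (Rpower q (2 * s) * Rabs x <= Rpower q (2 * s) * p)
        by (apply Rmult_le_compat_l; [left; apply Rpower_pos|auto]).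
      assert (E : forall y, 0 < y -> Rpower y (2 * s) = Rpower y (2 * s - 1) * y).
      { intros y Hy. rewrite <- (Rpower_1 y) at 3 by lra. rewrite <- Rpower_plus. f_equal. ring. }
      assert (Rpower q (2 * s) * p <= Rpower p (2 * s) * q).
      { rewrite (E q), (E p) by lra.
        assert (Rpower q (2 * s - 1) <= Rpower p (2 * s - 1)) by (apply Rle_Rpower_l; lra).
        pose proof (Rpower_pos q (2 * s - 1)).
        replace (Rpower q (2 * s - 1) * q * p) with (Rpower q (2 * s - 1) * (p * q)) by ring.
        replace (Rpower p (2 * s - 1) * p * q) with (Rpower p (2 * s - 1) * (p * q)) by ring.
        apply Rmult_le_compat_r; nra. }
      lra. }
    eapply Rle_trans; [exact A|].
    assert (B : Rpower p s <= Rpower 2 s * Rpower r s).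
    { rewrite Rpower_mult_distr by lra. apply Rle_Rpower_l; lra. }
    assert (C : Rpower p (2 * s) * q <= Rpower 2 s * (Rpower p s * Rpower r s * q)).
    { rewrite Ep. replace (Rpower 2 s * (Rpower p s * Rpower r s * q)) with
        (Rpower p s * (Rpower 2 s * Rpower r s) * q) by ring.
      apply Rmult_le_compat_r; [lra|]. apply Rmult_le_compat_l; lra. }
    set (X := Rpower p s * Rpower q s * r) in *. set (Y := Rpower p s * Rpower r s * q) in *.
    assert (0 <= Rpower 2 s * Y) by nra. assert (0 <= Rpower 2 s * X) by nra. nra.
Qed.

Lemma commutator_symbol s x z :
  1 / 2 <= s ->
  Rabs (wt s x ^ 2 * IZR z - wt s z ^ 2 * IZR x) <=
  (2 + 2 * s) * Rpower 2 s *
  (wt s x * wt s z * wt 1 (x - z) + wt s x * wt s (x - z) * wt 1 z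
   + wt s z * wt s (x - z) * wt 1 x).
Proof.
  intros Hs.
  assert (E : forall y, wt s y ^ 2 = Rpower (wt 1 y) (2 * s)).
  { intros y. rewrite (wt_Rpower s y). replace (2 * s) with (s + s) by ring.
    rewrite Rpower_plus. ring. }
  rewrite !E, (wt_Rpower s x), (wt_Rpower s z), (wt_Rpower s (x - z)).
  pose proof (wt_ge1 1 x ltac:(lra)). pose proof (wt_ge1 1 z ltac:(lra)).
  pose proof (wt_ge1 1 (x - z) ltac:(lra)).
  pose proof (wt1_lip x z). pose proof (wt1_lip z x).
  pose proof (abs_le_wt1 x). pose proof (abs_le_wt1 z). pose proof (abs_le_wt1 (x - z)).
  assert (E' : Rabs (IZR (z - x)) = Rabs (IZR (x - z))).
  { rewrite <- Rabs_Ropp, <- opp_IZR. f_equal. f_equal. lia. }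
  assert (E2 : IZR (x - z) = IZR x - IZR z) by apply minus_IZR.
  rewrite E' in *.
  set (p := wt 1 x) in *. set (q := wt 1 z) in *. set (r := wt 1 (x - z)) in *.
  assert (P : forall u v, 0 < Rpower u s * Rpower v s)
    by (intros; apply Rmult_lt_0_compat; apply Rpower_pos).
  assert (K0 : 0 <= (2 + 2 * s) * Rpower 2 s)
    by (apply Rmult_le_pos; [lra|left; apply Rpower_pos]).
  pose proof (P q r). pose proof (P p r).
  destruct (Rle_or_lt q p).
  - eapply Rle_trans; [apply (commutator_symbol_half s p q r); try lra|].
    { rewrite <- E2; auto. }
    apply Rmult_le_compat_l; auto. assert (0 <= Rpower q s * Rpower r s * p) by nra. lra.
  - rewrite <- Rabs_Ropp.
    replace (- (Rpower p (2 * s) * IZR z - Rpower q (2 * s) * IZR x)) with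
      (Rpower q (2 * s) * IZR x - Rpower p (2 * s) * IZR z) by ring.
    eapply Rle_trans; [apply (commutator_symbol_half s q p r); try lra|].
    { rewrite <- Rabs_Ropp. replace (- (IZR z - IZR x)) with (IZR (x - z)) by (rewrite E2; ring).
      auto. }
    apply Rmult_le_compat_l; auto. assert (0 <= Rpower p s * Rpower r s * q) by nra.
    replace (Rpower q s * Rpower p s * r) with (Rpower p s * Rpower q s * r) by ring. lra.
Qed.

(** * Weighted square-summable families of Fourier coefficients *)

(** The weighted l^2 norm of [a] is at most [B].  Quantifying over all finite
    duplicate-free lists of frequencies makes the bound stable under
    translation and reflection of the index, and turns closedness under
    coefficientwise limits into a statement about finite sums. *)
Definition hb (s : R) (a : Z -> C) (B : R) : Prop :=
  0 <= B /\ forall l, NoDup l -> rsum (fun xi => (wt s xi * Cmod (a xi)) ^ 2) l <= B ^ 2.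

Lemma hb_pos s a B : hb s a B -> 0 <= B.
Proof. intros [H _]; auto. Qed.

(** All multiplier estimates are instances of pointwise domination. *)
Lemma hb_dom s t a b B c :
  0 <= c -> (forall xi, wt t xi * Cmod (b xi) <= c * (wt s xi * Cmod (a xi))) ->
  hb s a B -> hb t b (c * B).
Proof.
  intros Hc H [HB Ha]. split; [nra|]. intros l Hl.
  apply Rle_trans with (rsum (fun xi => c ^ 2 * (wt s xi * Cmod (a xi)) ^ 2) l).
  - apply rsum_le. intros xi _. rewrite <- Rpow_mult_distr. apply pow_incr. split; auto.
    apply Rmult_le_pos; [left; apply wt_pos|apply Cmod_ge_0].
  - rewrite rsum_scal, Rpow_mult_distr. apply Rmult_le_compat_l; auto. apply pow2_ge_0.
Qed.

Lemma hb_le s a B B' : B <= B' -> hb s a B -> hb s a B'.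
Proof.
  intros HB [H0 H]. split; [lra|]. intros l Hl. eapply Rle_trans; [apply H; auto|].
  apply pow_incr; lra.
Qed.

Lemma hb_dom1 s t a b B :
  (forall xi, wt t xi * Cmod (b xi) <= wt s xi * Cmod (a xi)) -> hb s a B -> hb t b B.
Proof. intros H Ha. rewrite <- (Rmult_1_l B). apply hb_dom with s a; auto; [lra|intros; rewrite Rmult_1_l; auto]. Qed.

Lemma hb_ext s a b B : (forall xi, a xi = b xi) -> hb s a B -> hb s b B.
Proof. intros H. apply hb_dom1. intros xi. rewrite H. lra. Qed.

Lemma hb_mono s t a B : t <= s -> hb s a B -> hb t a B.
Proof.
  intros H. apply hb_dom1. intros xi. apply Rmult_le_compat_r; [apply Cmod_ge_0|].
  apply wt_le; auto.
Qed.

Lemma hb_opp s a B : hb s a B -> hb s (fun xi => (- a xi)%C) B.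
Proof. apply hb_dom1. intros xi. rewrite Cmod_opp. lra. Qed.

Lemma hb_scal s c a B : hb s a B -> hb s (fun xi => (c * a xi)%C) (Cmod c * B).
Proof.
  apply hb_dom; [apply Cmod_ge_0|]. intros xi. rewrite Cmod_mult. lra.
Qed.

Lemma hb_plus s a b A B : hb s a A -> hb s b B -> hb s (fun xi => (a xi + b xi)%C) (A + B).
Proof.
  intros [HA Ha] [HB Hb]. split; [lra|]. intros l Hl.
  eapply Rle_trans; [|apply (rsum_Minkowski (fun xi => wt s xi * Cmod (a xi))
    (fun xi => wt s xi * Cmod (b xi)) l A B); auto].
  apply rsum_le. intros xi _. apply pow_incr. pose proof (wt_pos s xi).
  pose proof (Cmod_ge_0 (a xi + b xi)%C). pose proof (Cmod_triangle (a xi) (b xi)).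
  split; nra.
Qed.

(** A form of Fatou's lemma. The approximation may degrade arbitrarily with the
    frequency, through [g], because each test involves finitely many of them. *)
Lemma hb_approx s a B (g : Z -> R) :
  0 <= B ->
  (forall e, 0 < e -> exists b, hb s b B /\ forall xi, Cmod (a xi - b xi)%C <= e * g xi) ->
  hb s a B.
Proof.
  intros HB H. split; auto. intros l Hl.
  set (G := sqrt (rsum (fun xi => (wt s xi * g xi) ^ 2) l)).
  assert (HG0 : 0 <= rsum (fun xi => (wt s xi * g xi) ^ 2) l)
    by (apply rsum_ge0; intros; apply pow2_ge_0).
  assert (HG : 0 <= G) by apply sqrt_pos.
  set (S := sqrt (rsum (fun xi => (wt s xi * Cmod (a xi)) ^ 2) l)).
  assert (HS0 : 0 <= rsum (fun xi => (wt s xi * Cmod (a xi)) ^ 2) l)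
    by (apply rsum_ge0; intros; apply pow2_ge_0).
  assert (E : S <= B).
  { apply le_of_eps with G; auto. intros e He. destruct (H e He) as [b [[_ Hb] Hab]].
    apply Rsqr_incr_0_var; [|nra]. unfold S. rewrite Rsqr_sqrt by auto. unfold Rsqr.
    replace ((B + e * G) * (B + e * G)) with ((B + e * G) ^ 2) by ring.
    eapply Rle_trans; [|apply (rsum_Minkowski (fun xi => wt s xi * Cmod (b xi))
      (fun xi => wt s xi * (e * g xi)) l B (e * G)); auto].
    - apply rsum_le. intros xi _. pose proof (wt_pos s xi). apply pow_incr. split.
      { apply Rmult_le_pos; [lra|apply Cmod_ge_0]. }
      rewrite <- Rmult_plus_distr_l. apply Rmult_le_compat_l; [lra|].
      replace (a xi) with (b xi + (a xi - b xi))%C by ring.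
      eapply Rle_trans; [apply Cmod_triangle|]. specialize (Hab xi). lra.
    - nra.
    - right. rewrite Rpow_mult_distr. unfold G. rewrite pow2_sqrt by auto.
      rewrite <- rsum_scal. apply rsum_ext. intros; ring. }
  rewrite <- (pow2_sqrt _ HS0). apply pow_incr. split; [apply sqrt_pos|exact E].
Qed.

Lemma hb_coef s a B xi : hb s a B -> wt s xi * Cmod (a xi) <= B.
Proof.
  intros [HB H]. specialize (H [xi] ltac:(constructor; [intros []|constructor])).
  cbn [rsum] in H. apply Rsqr_incr_0_var; auto. unfold Rsqr. nra.
Qed.

Lemma hb_coef0 s a B xi : 0 <= s -> hb s a B -> Cmod (a xi) <= B.
Proof.
  intros Hs H. pose proof (hb_coef s a B xi H). pose proof (wt_ge1 s xi Hs).
  pose proof (Cmod_ge_0 (a xi)). nra.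
Qed.

(** The weights of the two factors cancel, so H^s and its dual with respect to the
    unweighted pairing are handled by one Cauchy-Schwarz inequality. *)
Lemma hb_pair s a B v V l :
  NoDup l -> hb s a B -> 0 <= V -> rsum (fun xi => (Cmod (v xi) / wt s xi) ^ 2) l <= V ^ 2 ->
  rsum (fun xi => Cmod (a xi) * Cmod (v xi)) l <= B * V.
Proof.
  intros Hl [HB Ha] HV Hv.
  rewrite (rsum_ext _ (fun xi => (wt s xi * Cmod (a xi)) * (Cmod (v xi) / wt s xi))).
  - apply rsum_CS; auto.
  - intros xi _. pose proof (wt_pos s xi). field. lra.
Qed.

(** Tests the family with its own conjugate, doubly weighted. This turns scalar
    estimates, for instance of a function of time, into estimates of norms. *)
Lemma hb_dual s a B :
  0 <= B ->
  (forall l v V, NoDup l -> 0 <= V -> rsum (fun xi => (Cmod (v xi) / wt s xi) ^ 2) l <= V ^ 2 ->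
     rsum (fun xi => Re (a xi * v xi)%C) l <= B * V) ->
  hb s a B.
Proof.
  intros HB H. split; auto. intros l Hl.
  set (S := rsum (fun xi => (wt s xi * Cmod (a xi)) ^ 2) l).
  assert (HS : 0 <= S) by (apply rsum_ge0; intros; apply pow2_ge_0).
  specialize (H l (fun xi => RtoC (wt s xi ^ 2) * Cconj (a xi))%C (sqrt S) Hl (sqrt_pos _)).
  assert (E : S <= B * sqrt S).
  { eapply Rle_trans; [|apply H].
    - right. apply rsum_ext. intros xi _.
      replace (a xi * (RtoC (wt s xi ^ 2) * Cconj (a xi)))%C with
        (RtoC (wt s xi ^ 2) * (a xi * Cconj (a xi)))%C by ring.
      rewrite <- Cmod2_conj, <- RtoC_mult, re_RtoC. ring.
    - rewrite pow2_sqrt by auto. right. apply rsum_ext. intros xi _.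
      rewrite Cmod_mult, Cmod_conj, Cmod_R, Rabs_pos_eq by apply pow2_ge_0.
      pose proof (wt_pos s xi). f_equal. field. lra. }
  destruct (Req_dec S 0) as [->|Hn]; [apply pow2_ge_0|].
  assert (Hp : 0 < sqrt S) by (apply sqrt_lt_R0; lra).
  pose proof (sqrt_sqrt S HS). assert (sqrt S <= B) by nra. nra.
Qed.

(** Comparison with the integral of x^(-p): by the mean value theorem each term is
    bounded by an increment of the primitive, and the increments telescope. *)
Lemma rsum_telescope p K n :
  1 < p -> (1 <= K)%nat ->
  rsum (fun j => Rpower (INR j) (- p)) (seq (K + 1) n) <= / (p - 1) * Rpower (INR K) (- (p - 1)).
Proof.
  intros Hp. revert K. induction n as [|n IH]; intros K HK; cbn [rsum seq].
  - apply Rmult_le_pos; [left; apply Rinv_0_lt_compat; lra|left; apply Rpower_pos].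
  - replace (S (K + 1)) with ((K + 1) + 1)%nat by lia.
    specialize (IH (K + 1)%nat ltac:(lia)).
    assert (H1 : 1 <= INR K) by (apply (le_INR 1); auto).
    rewrite plus_INR in *. change (INR 1) with 1 in *. set (x := INR K) in *.
    destruct (MVT_gen (fun y => Rpower y (- (p - 1))) x (x + 1)
      (fun y => - (p - 1) * Rpower y (- (p - 1) - 1))) as [c [Hc E]].
    { intros y. rewrite Rmin_left, Rmax_right by lra. intros Hy.
      apply is_derive_Reals. apply derivable_pt_lim_power. lra. }
    { intros y. rewrite Rmin_left, Rmax_right by lra. intros Hy.
      apply derivable_continuous_pt. eexists. apply derivable_pt_lim_power. lra. }
    rewrite Rmin_left, Rmax_right in Hc by lra.
    replace (- (p - 1) - 1) with (- p) in E by ring.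
    assert (D : Rpower (x + 1) (- p) <= Rpower c (- p)).
    { rewrite !Rpower_Ropp. apply Rinv_le_contravar; [apply Rpower_pos|].
      apply Rle_Rpower_l; lra. }
    assert (F : Rpower (x + 1) (- p) <=
      / (p - 1) * Rpower x (- (p - 1)) - / (p - 1) * Rpower (x + 1) (- (p - 1))).
    { replace (/ (p - 1) * Rpower x (- (p - 1)) - / (p - 1) * Rpower (x + 1) (- (p - 1)))
        with (Rpower c (- p)); auto.
      apply Rmult_eq_reg_l with (p - 1); [|lra].
      replace ((p - 1) * (/ (p - 1) * Rpower x (- (p - 1)) - / (p - 1) * Rpower (x + 1) (- (p - 1))))
        with (- (Rpower (x + 1) (- (p - 1)) - Rpower x (- (p - 1)))) by (field; lra).
      rewrite E. ring. }
    lra.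
Qed.

Lemma rsum_tail_weights p K l :
  1 < p -> (1 <= K)%nat -> NoDup l -> (forall xi, In xi l -> (Z.of_nat K < Z.abs xi)%Z) ->
  rsum (fun xi => Rpower (Rabs (IZR xi)) (- p)) l <= 2 / (p - 1) * Rpower (INR K) (- (p - 1)).
Proof.
  intros Hp HK Hl Hin. destruct (incl_zr l) as [L HL].
  apply Rle_trans with (rsum (fun xi => Rpower (Rabs (IZR xi)) (- p))
    (map Z.of_nat (seq (K + 1) L) ++ map (fun j => (- Z.of_nat j)%Z) (seq (K + 1) L))).
  - apply rsum_incl; auto; [|intros; left; apply Rpower_pos].
    intros x Hx. specialize (Hin x Hx). apply HL in Hx. rewrite in_zr in Hx.
    apply in_or_app. destruct (Z_le_gt_dec 0 x).
    + left. apply in_map_iff. exists (Z.to_nat x). split; [lia|]. apply in_seq. lia.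
    + right. apply in_map_iff. exists (Z.to_nat (- x)). split; [lia|]. apply in_seq. lia.
  - rewrite rsum_app, !rsum_map.
    assert (E : forall j : nat, Rpower (Rabs (IZR (- Z.of_nat j))) (- p) = Rpower (INR j) (- p)).
    { intros j. rewrite opp_IZR, Rabs_Ropp, <- INR_IZR_INZ, Rabs_pos_eq; auto. apply pos_INR. }
    assert (E' : forall j : nat, Rpower (Rabs (IZR (Z.of_nat j))) (- p) = Rpower (INR j) (- p)).
    { intros j. rewrite <- INR_IZR_INZ, Rabs_pos_eq; auto. apply pos_INR. }
    rewrite (rsum_ext _ (fun j => Rpower (INR j) (- p))) by auto.
    rewrite (rsum_ext (fun x => Rpower (Rabs (IZR (- Z.of_nat x))) (- p))
      (fun j => Rpower (INR j) (- p))) by auto.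
    pose proof (rsum_telescope p K L Hp HK). lra.
Qed.

(** The power of [K] is sharp; the interpolation error relies on it, with nothing
    to spare. *)
Lemma l1_tail s :
  1 / 2 < s ->
  exists C0, 0 < C0 /\ forall K a A l, (1 <= K)%nat -> hb s a A -> NoDup l ->
    (forall xi, In xi l -> (Z.of_nat K < Z.abs xi)%Z) ->
    rsum (fun xi => Cmod (a xi)) l <= C0 * Rpower (INR K) (- (s - 1 / 2)) * A.
Proof.
  intros Hs. exists (sqrt (2 / (2 * s - 1))).
  assert (H0 : 0 < 2 / (2 * s - 1)) by (apply Rdiv_lt_0_compat; lra).
  split; [apply sqrt_lt_R0; auto|]. intros K a A l HK [HA Ha] Hl Hin.
  rewrite (rsum_ext _ (fun xi => / wt s xi * (wt s xi * Cmod (a xi)))).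
  2:{ intros xi _. pose proof (wt_pos s xi). field. lra. }
  apply rsum_CS; auto.
  { apply Rmult_le_pos; [apply sqrt_pos|left; apply Rpower_pos]. }
  rewrite Rpow_mult_distr, pow2_sqrt by lra.
  replace (Rpower (INR K) (- (s - 1 / 2)) ^ 2) with (Rpower (INR K) (- (2 * s - 1))).
  2:{ simpl. rewrite Rmult_1_r, <- Rpower_plus. f_equal. lra. }
  eapply Rle_trans; [|apply (rsum_tail_weights (2 * s) K l); auto; lra].
  apply rsum_le. intros xi Hxi. specialize (Hin xi Hxi).
  assert (Hx : 1 <= Rabs (IZR xi)). { rewrite <- abs_IZR. apply (IZR_le 1). lia. }
  rewrite pow_inv, Rpower_Ropp.
  apply Rinv_le_contravar; [apply Rpower_pos|].
  replace (2 * s) with (s + s) by ring. rewrite Rpower_plus.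
  replace (wt s xi ^ 2) with (wt s xi * wt s xi) by ring.
  assert (Rpower (Rabs (IZR xi)) s <= wt s xi).
  { rewrite wt_Rpower. apply Rle_Rpower_l; [lra|]. split; [lra|]. apply abs_le_wt1. }
  pose proof (Rpower_pos (Rabs (IZR xi)) s). nra.
Qed.

(** The inverse weights are square summable exactly when s > 1/2, and
    Cauchy-Schwarz does the rest. *)
Lemma l1_embed s :
  1 / 2 < s ->
  exists C0, 1 <= C0 /\ forall a A l, hb s a A -> NoDup l ->
    rsum (fun xi => Cmod (a xi)) l <= C0 * A.
Proof.
  intros Hs. destruct (l1_tail s Hs) as [C1 [H1 HC]]. exists (3 + C1). split; [lra|].
  intros a A l Ha Hl. rewrite (rsum_filter (fun xi => (1 <? Z.abs xi)%Z)).
  assert (T1 : rsum (fun xi => Cmod (a xi)) (filter (fun xi => (1 <? Z.abs xi)%Z) l) <= C1 * A).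
  { eapply Rle_trans; [apply (HC 1%nat a A); auto|].
    - apply NoDup_filter; auto.
    - intros xi Hxi. apply filter_In in Hxi. destruct Hxi as [_ Hxi]. apply Z.ltb_lt in Hxi. lia.
    - simpl. unfold Rpower. rewrite ln_1, Rmult_0_r, exp_0. lra. }
  assert (T2 : rsum (fun xi => Cmod (a xi)) (filter (fun xi => negb (1 <? Z.abs xi)%Z) l) <= 3 * A).
  { apply Rle_trans with (rsum (fun xi => Cmod (a xi)) [-1; 0; 1]%Z).
    - apply rsum_incl; [apply NoDup_filter; auto| |intros; apply Cmod_ge_0].
      intros xi Hxi. apply filter_In in Hxi. destruct Hxi as [_ Hxi].
      apply Bool.negb_true_iff, Z.ltb_ge in Hxi. simpl. lia.
    - cbn [rsum]. pose proof (hb_coef0 s a A (-1) ltac:(lra) Ha).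
      pose proof (hb_coef0 s a A 0 ltac:(lra) Ha). pose proof (hb_coef0 s a A 1 ltac:(lra) Ha). lra. }
  lra.
Qed.

Lemma NoDup_shift z l : NoDup l -> NoDup (map (fun x => (x - z)%Z) l).
Proof. intros H. apply Injective_map_NoDup; auto. intros x y; lia. Qed.

Lemma NoDup_reflect x l : NoDup l -> NoDup (map (fun z => (x - z)%Z) l).
Proof. intros H. apply Injective_map_NoDup; auto. intros y z; lia. Qed.

(** Schur's test: Cauchy-Schwarz with respect to the weight [a (x - z)]. *)
Lemma young_l1_l2 (a b : Z -> R) A B l l' :
  NoDup l -> NoDup l' -> (forall x, 0 <= a x) -> 0 <= A -> 0 <= B ->
  (forall l, NoDup l -> rsum a l <= A) -> rsum (fun z => b z ^ 2) l' <= B ^ 2 ->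
  rsum (fun x => rsum (fun z => a (x - z)%Z * b z) l' ^ 2) l <= (A * B) ^ 2.
Proof.
  intros Hl Hl' Ha HA HB H1 H2.
  apply Rle_trans with (rsum (fun x => A * rsum (fun z => a (x - z)%Z * b z ^ 2) l') l).
  - apply rsum_le. intros x _.
    rewrite (rsum_ext _ (fun z => sqrt (a (x - z)%Z) * (sqrt (a (x - z)%Z) * b z))).
    2:{ intros z _. rewrite <- Rmult_assoc, sqrt_sqrt; auto. }
    eapply Rle_trans; [apply rsum_CS_sq|].
    rewrite (rsum_ext _ (fun z => a (x - z)%Z)) by (intros; apply pow2_sqrt; auto).
    rewrite (rsum_ext (fun i => (sqrt (a (x - i)%Z) * b i) ^ 2) (fun z => a (x - z)%Z * b z ^ 2)).
    2:{ intros z _. rewrite Rpow_mult_distr, pow2_sqrt; auto. }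
    apply Rmult_le_compat_r.
    + apply rsum_ge0. intros. apply Rmult_le_pos; auto. apply pow2_ge_0.
    + rewrite <- (rsum_map (fun z => (x - z)%Z) a). apply H1. apply NoDup_reflect; auto.
  - rewrite rsum_scal, rsum_swap.
    replace ((A * B) ^ 2) with (A * (A * B ^ 2)) by ring. apply Rmult_le_compat_l; auto.
    apply Rle_trans with (rsum (fun z => A * b z ^ 2) l').
    + apply rsum_le. intros z _.
      rewrite (rsum_ext _ (fun x => b z ^ 2 * a (x - z)%Z)) by (intros; ring).
      rewrite rsum_scal, Rmult_comm. apply Rmult_le_compat_r; [apply pow2_ge_0|].
      rewrite <- (rsum_map (fun x => (x - z)%Z) a). apply H1. apply NoDup_shift; auto.
    + rewrite rsum_scal. apply Rmult_le_compat_l; auto.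
Qed.

(** In a convolution tested against a third family, any one of the three factors
    may be taken in l^1 and the two others in l^2. Here it is the factor that
    depends on the difference of the frequencies; the next two lemmas treat the
    other cases. *)
Lemma trilinear_l1_diff (a b c : Z -> R) A B D l l' :
  NoDup l -> NoDup l' -> (forall x, 0 <= a x) -> 0 <= A -> 0 <= B -> 0 <= D ->
  (forall l, NoDup l -> rsum a l <= A) -> rsum (fun z => b z ^ 2) l' <= B ^ 2 ->
  rsum (fun x => c x ^ 2) l <= D ^ 2 ->
  rsum (fun x => rsum (fun z => a (x - z)%Z * b z * c x) l') l <= A * B * D.
Proof.
  intros Hl Hl' Ha HA HB HD H1 H2 H3.
  rewrite (rsum_ext _ (fun x => rsum (fun z => a (x - z)%Z * b z) l' * c x)).
  - apply rsum_CS; auto; [nra|]. apply young_l1_l2; auto.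
  - intros x _. rewrite Rmult_comm, <- rsum_scal. apply rsum_ext. intros; ring.
Qed.

Lemma trilinear_l1_right (a b c : Z -> R) A B D l l' :
  NoDup l -> NoDup l' -> (forall x, 0 <= b x) -> 0 <= A -> 0 <= B -> 0 <= D ->
  (forall l, NoDup l -> rsum (fun x => a x ^ 2) l <= A ^ 2) -> rsum b l' <= B ->
  rsum (fun x => c x ^ 2) l <= D ^ 2 ->
  rsum (fun x => rsum (fun z => a (x - z)%Z * b z * c x) l') l <= A * B * D.
Proof.
  intros Hl Hl' Hb HA HB HD H1 H2 H3. rewrite rsum_swap.
  apply Rle_trans with (rsum (fun z => A * D * b z) l').
  - apply rsum_le. intros z _.
    rewrite (rsum_ext _ (fun x => b z * (a (x - z)%Z * c x))) by (intros; ring).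
    rewrite rsum_scal, (Rmult_comm _ (b z)). apply Rmult_le_compat_l; auto.
    apply rsum_CS; auto. rewrite <- (rsum_map (fun x => (x - z)%Z) (fun x => a x ^ 2)).
    apply H1. apply NoDup_shift; auto.
  - rewrite rsum_scal. assert (0 <= A * D) by nra. nra.
Qed.

Lemma trilinear_l1_left (a b c : Z -> R) A B D l l' :
  NoDup l -> NoDup l' -> (forall x, 0 <= c x) -> 0 <= A -> 0 <= B -> 0 <= D ->
  (forall l, NoDup l -> rsum (fun x => a x ^ 2) l <= A ^ 2) ->
  rsum (fun z => b z ^ 2) l' <= B ^ 2 -> rsum c l <= D ->
  rsum (fun x => rsum (fun z => a (x - z)%Z * b z * c x) l') l <= A * B * D.
Proof.
  intros Hl Hl' Hc HA HB HD H1 H2 H3.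
  apply Rle_trans with (rsum (fun x => A * B * c x) l).
  - apply rsum_le. intros x _.
    rewrite (rsum_ext _ (fun z => c x * (a (x - z)%Z * b z))) by (intros; ring).
    rewrite rsum_scal, (Rmult_comm _ (c x)). apply Rmult_le_compat_l; auto.
    apply rsum_CS; auto. rewrite <- (rsum_map (fun z => (x - z)%Z) (fun x => a x ^ 2)).
    apply H1. apply NoDup_reflect; auto.
  - rewrite rsum_scal. assert (0 <= A * B) by nra. nra.
Qed.

(** * Continuous periodic functions and their Fourier coefficients *)

Definition cts (f : R -> C) : Prop := forall x, continuous f x.

Lemma cts_Re f : cts f -> forall x, continuous (fun y => Re (f y)) x.
Proof. intros H x. apply (continuous_comp f fst); [apply H|]. destruct (f x). apply continuous_fst. Qed.

Lemma cts_Im f : cts f -> forall x, continuous (fun y => Im (f y)) x.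
Proof. intros H x. apply (continuous_comp f snd); [apply H|]. destruct (f x). apply continuous_snd. Qed.

Lemma cts_pair f :
  (forall x, continuous (fun y => Re (f y)) x) ->
  (forall x, continuous (fun y => Im (f y)) x) -> cts f.
Proof.
  intros H1 H2 x P HP. unfold filtermap.
  destruct HP as [e He].
  specialize (H1 x (fun y => ball (Re (f x)) e y) ltac:(exists e; auto)).
  specialize (H2 x (fun y => ball (Im (f x)) e y) ltac:(exists e; auto)).
  unfold filtermap in *. generalize (filter_and _ _ H1 H2). apply filter_imp.
  intros y [A B]. apply He. split; auto.
Qed.

Lemma cts_ext f g : (forall x, f x = g x) -> cts f -> cts g.
Proof. intros H Hf x. apply (continuous_ext f); auto. Qed.

Lemma cts_const c : cts (fun _ => c).
Proof. intros x. apply continuous_const. Qed.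

Lemma cts_plus f g : cts f -> cts g -> cts (fun x => f x + g x)%C.
Proof.
  intros Hf Hg. apply cts_pair; intros x; simpl;
    apply (continuous_plus (V := R_NormedModule));
    try apply (cts_Re f Hf); try apply (cts_Re g Hg);
    try apply (cts_Im f Hf); try apply (cts_Im g Hg).
Qed.

Lemma cts_mult f g : cts f -> cts g -> cts (fun x => f x * g x)%C.
Proof.
  intros Hf Hg. apply cts_pair; intros x; simpl.
  - apply (continuous_minus (V := R_NormedModule));
      apply (continuous_mult (K := R_AbsRing));
      try apply (cts_Re f Hf); try apply (cts_Re g Hg);
      try apply (cts_Im f Hf); try apply (cts_Im g Hg).
  - apply (continuous_plus (V := R_NormedModule));
      apply (continuous_mult (K := R_AbsRing));
      try apply (cts_Re f Hf); try apply (cts_Re g Hg);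
      try apply (cts_Im f Hf); try apply (cts_Im g Hg).
Qed.

Lemma Copp_scal (z : C) : (- z = RtoC (-1) * z)%C.
Proof. unfold Copp, Cmult, RtoC. simpl. f_equal; ring. Qed.

Lemma cts_opp f : cts f -> cts (fun x => - f x)%C.
Proof.
  intros H. apply cts_ext with (fun x => RtoC (-1) * f x)%C.
  - intros x. rewrite Copp_scal. reflexivity.
  - apply cts_mult; auto. apply cts_const.
Qed.

Lemma cts_RtoC (u : R -> R) : (forall x, continuous u x) -> cts (fun x => RtoC (u x)).
Proof. intros H. apply cts_pair; simpl; auto. intros x. apply continuous_const. Qed.

Lemma cts_cis (h : R -> R) : (forall x, continuous h x) -> cts (fun x => cis (h x)).
Proof.
  intros H. apply cts_pair; intros x; simpl.
  - apply continuous_comp; auto. apply continuous_cos.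
  - apply continuous_comp; auto. apply continuous_sin.
Qed.

Lemma continuous_affine a b x : continuous (fun y => a * (y + b)) x.
Proof.
  apply (continuous_mult (K := R_AbsRing)); [apply continuous_const|].
  apply (continuous_plus (V := R_NormedModule)); [apply continuous_id|apply continuous_const].
Qed.

Lemma cts_mode xi : cts (mode xi).
Proof. apply cts_cis. intros x. apply continuous_affine. Qed.

Lemma cts_Cmod f : cts f -> forall x, continuous (fun y => Cmod (f y)) x.
Proof.
  intros H x. unfold Cmod. apply (continuous_comp (fun y => fst (f y) ^ 2 + snd (f y) ^ 2) sqrt).
  - simpl. apply (continuous_plus (V := R_NormedModule)); apply (continuous_mult (K := R_AbsRing));
      try apply (cts_Re f H); try apply (cts_Im f H);
      apply (continuous_mult (K := R_AbsRing));
      try apply (cts_Re f H); try apply (cts_Im f H); apply continuous_const.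
  - apply continuous_sqrt.
Qed.

Lemma cis_plus a b : cis (a + b) = (cis a * cis b)%C.
Proof. unfold cis, Cmult. simpl. rewrite cos_plus, sin_plus. f_equal; ring. Qed.

Lemma cis_0 : cis 0 = RtoC 1.
Proof. unfold cis. rewrite cos_0, sin_0. reflexivity. Qed.

Lemma Cmod_cis a : Cmod (cis a) = 1.
Proof.
  unfold Cmod, cis. simpl fst; simpl snd. pose proof (sin2_cos2 a) as H. unfold Rsqr in H.
  replace (cos a ^ 2 + sin a ^ 2) with 1 by (rewrite <- H; ring). apply sqrt_1.
Qed.

Lemma cis_conj a : Cconj (cis a) = cis (- a).
Proof. unfold cis, Cconj. simpl. rewrite cos_neg, sin_neg. reflexivity. Qed.


Lemma cis_2PI_nat n : cis (2 * INR n * PI) = RtoC 1.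
Proof.
  unfold cis. rewrite <- (Rplus_0_l (2 * INR n * PI)), cos_period, sin_period, cos_0, sin_0.
  reflexivity.
Qed.

Lemma cis_2PI n : cis (2 * IZR n * PI) = RtoC 1.
Proof.
  destruct (Z_le_gt_dec 0 n).
  - rewrite <- (Z2Nat.id n), <- INR_IZR_INZ by auto. apply cis_2PI_nat.
  - rewrite <- (Cconj_conj (cis _)), cis_conj.
    replace (- (2 * IZR n * PI)) with (2 * INR (Z.to_nat (- n)) * PI).
    + rewrite cis_2PI_nat. unfold Cconj. simpl. unfold RtoC. f_equal. ring.
    + rewrite INR_IZR_INZ, Z2Nat.id, opp_IZR by lia. ring.
Qed.

Lemma mode_periodic xi : periodic (mode xi).
Proof.
  intros x. unfold mode.
  replace (IZR xi * (x + 2 * PI + PI)) with (IZR xi * (x + PI) + 2 * IZR xi * PI) by ring.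
  rewrite cis_plus, cis_2PI. ring.
Qed.

Lemma Cmod_mode xi x : Cmod (mode xi x) = 1.
Proof. apply Cmod_cis. Qed.

Lemma mode_0 x : mode 0 x = RtoC 1.
Proof. unfold mode. rewrite Rmult_0_l. apply cis_0. Qed.

Definition pc (f : R -> C) : Prop := periodic f /\ cts f.

Lemma pc_cts f : pc f -> cts f.
Proof. intros [_ H]; auto. Qed.

Lemma pc_ext f g : (forall x, f x = g x) -> pc f -> pc g.
Proof.
  intros H [Hp Hc]. split; [|apply cts_ext with f; auto].
  intros x. rewrite <- !H. apply Hp.
Qed.

Lemma pc_const c : pc (fun _ => c).
Proof. split; [intros x; reflexivity|apply cts_const]. Qed.

Lemma pc_plus f g : pc f -> pc g -> pc (fun x => f x + g x)%C.
Proof. intros [P1 C1] [P2 C2]. split; [intros x; rewrite P1, P2; auto|apply cts_plus; auto]. Qed.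

Lemma pc_mult f g : pc f -> pc g -> pc (fun x => f x * g x)%C.
Proof. intros [P1 C1] [P2 C2]. split; [intros x; rewrite P1, P2; auto|apply cts_mult; auto]. Qed.

Lemma pc_opp f : pc f -> pc (fun x => - f x)%C.
Proof. intros [P1 C1]. split; [intros x; rewrite P1; auto|apply cts_opp; auto]. Qed.

Lemma pc_minus f g : pc f -> pc g -> pc (fun x => f x - g x)%C.
Proof. intros Hf Hg. apply pc_plus; auto. apply pc_opp; auto. Qed.

Lemma pc_scal c f : pc f -> pc (fun x => c * f x)%C.
Proof. intros. apply pc_mult; auto. apply pc_const. Qed.

Lemma pc_pow f n : pc f -> pc (fun x => f x ^ n)%C.
Proof.
  intros H. induction n as [|n IH]; simpl; [apply pc_const|]. apply pc_mult; auto.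
Qed.

Lemma pc_mode xi : pc (mode xi).
Proof. split; [apply mode_periodic|apply cts_mode]. Qed.

Lemma pc_csum {A} (F : A -> R -> C) l :
  (forall a, In a l -> pc (F a)) -> pc (fun x => csum (fun a => F a x) l).
Proof.
  induction l as [|a l IH]; simpl; intros H; [apply pc_const|].
  apply pc_plus; auto.
Qed.

Lemma pc_RtoC u : periodic u -> (forall x, continuous u x) -> pc (fun x => RtoC (u x)).
Proof. intros Hp Hc. split; [intros x; rewrite Hp; auto|apply cts_RtoC; auto]. Qed.

Lemma ex_RInt_cts (f : R -> R) a b : (forall x, continuous f x) -> ex_RInt f a b.
Proof. intros H. apply (ex_RInt_continuous (V := R_CompleteNormedModule)). auto. Qed.

Lemma RInt_pair f a b :
  cts f -> RInt (V := C_R_CompleteNormedModule) f a b =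
    (RInt (fun x => Re (f x)) a b, RInt (fun x => Im (f x)) a b).
Proof.
  intros H. apply is_RInt_unique.
  apply (is_RInt_fct_extend_pair (U := R_NormedModule) (V := R_NormedModule));
    apply (RInt_correct (V := R_CompleteNormedModule)); apply ex_RInt_cts;
    [apply cts_Re|apply cts_Im]; auto.
Qed.

(** Integrals of complex functions are treated through their components, where
    linearity over the complex numbers can be checked by hand. *)
Lemma fourier_unfold f xi :
  cts f -> fourier f xi =
   (RtoC (/ (2 * PI)) *
     (RInt (fun x => Re (f x * cis (- (IZR xi * (x + PI))))%C) (- PI) PI,
      RInt (fun x => Im (f x * cis (- (IZR xi * (x + PI))))%C) (- PI) PI))%C.
Proof.
  intros H. unfold fourier. rewrite RInt_pair; auto.
  apply cts_mult; auto. apply cts_cis. intros x.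
  apply (continuous_opp (V := R_NormedModule)). apply continuous_affine.
Qed.

Lemma cts_kernel xi : cts (fun x => cis (- (IZR xi * (x + PI)))).
Proof.
  apply cts_cis. intros x. apply (continuous_opp (V := R_NormedModule)), continuous_affine.
Qed.

Lemma fourier_ext f g xi : (forall x, f x = g x) -> fourier f xi = fourier g xi.
Proof.
  intros H. unfold fourier. f_equal. apply RInt_ext. intros x _. rewrite H. reflexivity.
Qed.

Lemma RInt_plus_cts (f g : R -> R) a b :
  (forall x, continuous f x) -> (forall x, continuous g x) ->
  RInt (fun x => f x + g x) a b = RInt f a b + RInt g a b.
Proof. intros Hf Hg. apply (RInt_plus (V := R_CompleteNormedModule) f g); apply ex_RInt_cts; auto. Qed.

Lemma RInt_scal_cts c (f : R -> R) a b :
  (forall x, continuous f x) -> RInt (fun x => c * f x) a b = c * RInt f a b.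
Proof. intros Hf. apply (RInt_scal (V := R_CompleteNormedModule) f); apply ex_RInt_cts; auto. Qed.

Lemma Cplus_pair a b c d : ((a, b) + (c, d))%C = (a + c, b + d).
Proof. reflexivity. Qed.

Lemma Cmult_pair a b c d : ((a, b) * (c, d))%C = (a * c - b * d, a * d + b * c).
Proof. reflexivity. Qed.

Lemma Cconj_pair a b : Cconj (a, b) = (a, - b).
Proof. reflexivity. Qed.

Lemma fourier_plus f g xi :
  cts f -> cts g -> fourier (fun x => f x + g x)%C xi = (fourier f xi + fourier g xi)%C.
Proof.
  intros Hf Hg. rewrite !fourier_unfold by (auto; apply cts_plus; auto).
  rewrite <- Cmult_plus_distr_l. f_equal.
  pose proof (cts_mult _ _ Hf (cts_kernel xi)) as Kf.
  pose proof (cts_mult _ _ Hg (cts_kernel xi)) as Kg.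
  rewrite Cplus_pair. f_equal.
  - rewrite <- RInt_plus_cts by (apply cts_Re; auto).
    apply RInt_ext. intros x _. simpl. ring.
  - rewrite <- RInt_plus_cts by (apply cts_Im; auto).
    apply RInt_ext. intros x _. simpl. ring.
Qed.

Lemma fourier_scal c f xi : cts f -> fourier (fun x => c * f x)%C xi = (c * fourier f xi)%C.
Proof.
  intros Hf. rewrite !fourier_unfold by (auto; apply cts_mult; auto; apply cts_const).
  pose proof (cts_mult _ _ Hf (cts_kernel xi)) as Kf.
  pose proof (cts_Re _ Kf) as KR. pose proof (cts_Im _ Kf) as KI.
  rewrite Cmult_assoc, (Cmult_comm c), <- Cmult_assoc. f_equal.
  destruct c as [c1 c2]. rewrite Cmult_pair. f_equal.
  - unfold Rminus. rewrite Ropp_mult_distr_l, <- !RInt_scal_cts by auto.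
    rewrite <- RInt_plus_cts.
    + apply RInt_ext. intros x _. simpl. ring.
    + intros x. apply (continuous_mult (K := R_AbsRing)); auto. apply continuous_const.
    + intros x. apply (continuous_mult (K := R_AbsRing)); auto. apply continuous_const.
  - rewrite <- !RInt_scal_cts by auto. rewrite <- RInt_plus_cts.
    + apply RInt_ext. intros x _. simpl. ring.
    + intros x. apply (continuous_mult (K := R_AbsRing)); auto. apply continuous_const.
    + intros x. apply (continuous_mult (K := R_AbsRing)); auto. apply continuous_const.
Qed.

Lemma fourier_opp f xi : cts f -> fourier (fun x => - f x)%C xi = (- fourier f xi)%C.
Proof.
  intros Hf. rewrite (fourier_ext _ (fun x => RtoC (-1) * f x)%C).
  - rewrite fourier_scal, <- Copp_scal; auto.
  - intros x. apply Copp_scal.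
Qed.

Lemma fourier_minus f g xi :
  cts f -> cts g -> fourier (fun x => f x - g x)%C xi = (fourier f xi - fourier g xi)%C.
Proof. intros Hf Hg. unfold Cminus. rewrite fourier_plus, fourier_opp; auto. apply cts_opp; auto. Qed.

Lemma fourier_zero xi : fourier (fun _ => RtoC 0) xi = RtoC 0.
Proof.
  rewrite (fourier_ext _ (fun x => RtoC 0 * RtoC 0)%C) by (intros; ring).
  rewrite fourier_scal by apply cts_const. ring.
Qed.

Lemma cts_csum {A} (F : A -> R -> C) l :
  (forall a, In a l -> cts (F a)) -> cts (fun x => csum (fun a => F a x) l).
Proof.
  induction l as [|a l IH]; simpl; intros H; [apply cts_const|].
  apply cts_plus; auto.
Qed.

Lemma fourier_csum {A} (F : A -> R -> C) l xi :
  (forall a, In a l -> cts (F a)) ->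
  fourier (fun x => csum (fun a => F a x) l) xi = csum (fun a => fourier (F a) xi) l.
Proof.
  induction l as [|a l IH]; simpl; intros H; [apply fourier_zero|].
  rewrite fourier_plus, IH; auto. apply cts_csum; auto.
Qed.

Lemma Cmod_norm_le (z : C) : Cmod z <= norm (z : C_R_NormedModule).
Proof.
  unfold norm. simpl. unfold prod_norm. simpl. unfold Cmod.
  right. f_equal. unfold norm; simpl. unfold abs; simpl. rewrite !Rmult_1_r.
  rewrite <- !Rabs_mult, !Rabs_pos_eq by apply Rle_0_sqr. reflexivity.
Qed.

Lemma fourier_bound f xi B : cts f -> (forall x, Cmod (f x) <= B) -> Cmod (fourier f xi) <= B.
Proof.
  intros Hf HB. unfold fourier. rewrite Cmod_mult, Cmod_R.
  pose proof PI_RGT_0 as Hpi.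
  assert (Hp : 0 < / (2 * PI)) by (apply Rinv_0_lt_compat; lra).
  rewrite Rabs_pos_eq by lra.
  apply Rmult_le_reg_l with (2 * PI); [lra|]. rewrite <- Rmult_assoc, Rinv_r, Rmult_1_l by lra.
  replace (2 * PI * B) with ((PI - - PI) * B) by ring.
  eapply Rle_trans; [apply Cmod_norm_le|].
  eapply (norm_RInt_le_const (V := C_R_NormedModule)); [lra| |].
  2:{ apply (RInt_correct (V := C_R_CompleteNormedModule)).
      apply (ex_RInt_fct_extend_pair (U := R_NormedModule) (V := R_NormedModule));
      apply ex_RInt_cts; [apply (cts_Re (fun x => f x * _)%C)|apply (cts_Im (fun x => f x * _)%C)];
      apply cts_mult; auto; apply cts_kernel. }
  intros x _. simpl. 
  match goal with |- ?n <= _ => replace n with (Cmod (f x * cis (- (IZR xi * (x + PI))))%C) end.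
  - rewrite Cmod_mult, Cmod_cis. specialize (HB x). lra.
  - unfold norm. simpl. unfold prod_norm. simpl. unfold Cmod. f_equal.
    unfold norm; simpl. unfold abs; simpl. rewrite !Rmult_1_r.
    rewrite <- !Rabs_mult, !Rabs_pos_eq by apply Rle_0_sqr. reflexivity.
Qed.

Lemma fourier_mode_shift f z xi :
  fourier (fun x => f x * mode z x)%C xi = fourier f (xi - z).
Proof.
  unfold fourier. f_equal. apply RInt_ext. intros x _. rewrite <- Cmult_assoc. f_equal.
  unfold mode. rewrite <- cis_plus, minus_IZR. f_equal. ring.
Qed.

Lemma is_RInt_cos_Z n : n <> 0%Z -> RInt (fun x => cos (IZR n * (x + PI))) (- PI) PI = 0.
Proof.
  intros Hn. assert (Hz : IZR n <> 0) by (apply eq_IZR_contrapositive; auto).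
  apply is_RInt_unique.
  replace 0 with (minus (sin (IZR n * (PI + PI)) / IZR n) (sin (IZR n * (- PI + PI)) / IZR n)).
  - apply (is_RInt_derive (fun x => sin (IZR n * (x + PI)) / IZR n) (fun x => cos (IZR n * (x + PI)))).
    + intros x _. auto_derive; auto. field. auto.
    + intros x _. apply (continuous_comp (fun x => IZR n * (x + PI)) cos);
        [apply continuous_affine|apply continuous_cos].
  - replace (IZR n * (PI + PI)) with (2 * IZR n * PI) by ring.
    replace (IZR n * (- PI + PI)) with 0 by ring.
    pose proof (cis_2PI n) as E. unfold cis, RtoC in E. injection E as _ E2. rewrite E2, sin_0.
    unfold minus, plus, opp; simpl. field; auto.
Qed.

Lemma is_RInt_sin_Z n : RInt (fun x => sin (IZR n * (x + PI))) (- PI) PI = 0.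
Proof.
  destruct (Z.eq_dec n 0) as [->|Hn].
  - rewrite (RInt_ext _ (fun _ => 0)); [rewrite RInt_const; unfold scal; simpl; unfold mult; simpl; ring|].
    intros x _. rewrite Rmult_0_l. apply sin_0.
  - assert (Hz : IZR n <> 0) by (apply eq_IZR_contrapositive; auto).
    apply is_RInt_unique.
    replace 0 with (minus (- cos (IZR n * (PI + PI)) / IZR n) (- cos (IZR n * (- PI + PI)) / IZR n)).
    + apply (is_RInt_derive (fun x => - cos (IZR n * (x + PI)) / IZR n) (fun x => sin (IZR n * (x + PI)))).
      * intros x _. auto_derive; auto. field. auto.
      * intros x _. apply (continuous_comp (fun x => IZR n * (x + PI)) sin);
          [apply continuous_affine|apply continuous_sin].
    + replace (IZR n * (PI + PI)) with (2 * IZR n * PI) by ring.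
      replace (IZR n * (- PI + PI)) with 0 by ring.
      pose proof (cis_2PI n) as E. unfold cis, RtoC in E. injection E as E1 _. rewrite E1, cos_0.
      unfold minus, plus, opp; simpl. field; auto.
Qed.

Lemma fourier_mode z xi : fourier (mode z) xi = RtoC (if Z.eq_dec xi z then 1 else 0).
Proof.
  rewrite (fourier_ext _ (fun x => RtoC 1 * mode z x)%C) by (intros; ring).
  rewrite (fourier_mode_shift (fun _ => RtoC 1)).
  rewrite fourier_unfold by apply cts_const. pose proof PI_RGT_0 as Hpi.
  rewrite (RInt_ext (fun x => Im _) (fun x => -1 * sin (IZR (xi - z) * (x + PI)))).
  2:{ intros x _. simpl. rewrite sin_neg. ring. }
  rewrite (RInt_ext (fun x => Re _) (fun x => cos (IZR (xi - z) * (x + PI)))).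
  2:{ intros x _. simpl. rewrite cos_neg. ring. }
  rewrite RInt_scal_cts, is_RInt_sin_Z.
  2:{ intros x. apply (continuous_comp (fun x => _ * (x + PI)) sin);
          [apply continuous_affine|apply continuous_sin]. }
  destruct (Z.eq_dec xi z) as [->|Hn].
  - rewrite (RInt_ext _ (fun _ => 1)).
    + rewrite RInt_const. unfold scal; simpl; unfold mult; simpl.
      unfold Cmult, RtoC. simpl. f_equal; field; lra.
    + intros x _. rewrite Z.sub_diag, Rmult_0_l, cos_0. auto.
  - rewrite is_RInt_cos_Z by lia. unfold Cmult, RtoC. simpl. f_equal; ring.
Qed.

Lemma fourier_conj f xi : cts f -> fourier (fun x => Cconj (f x)) xi = Cconj (fourier f (- xi)).
Proof.
  intros Hf.
  assert (Hc : cts (fun x => Cconj (f x))).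
  { apply cts_pair; simpl; [apply (cts_Re f Hf)|].
    intros x. apply (continuous_opp (V := R_NormedModule)). apply (cts_Im f Hf). }
  pose proof (cts_mult _ _ Hf (cts_kernel (- xi))) as K.
  rewrite !fourier_unfold by auto. rewrite Cmult_conj.
  assert (E : Cconj (RtoC (/ (2 * PI))) = RtoC (/ (2 * PI))).
  { unfold Cconj, RtoC. simpl. f_equal. ring. }
  rewrite E. f_equal. rewrite Cconj_pair. f_equal.
  - apply RInt_ext. intros x _. simpl. rewrite opp_IZR.
    replace (- (- IZR xi * (x + PI))) with (IZR xi * (x + PI)) by ring.
    rewrite cos_neg, sin_neg. ring.
  - rewrite <- (Rmult_1_l (RInt _ _ _)) at 1. symmetry.
    replace (- RInt (fun x => Im (f x * cis (- (IZR (- xi) * (x + PI))))%C) (- PI) PI)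
      with (-1 * RInt (fun x => Im (f x * cis (- (IZR (- xi) * (x + PI))))%C) (- PI) PI) by ring.
    rewrite <- RInt_scal_cts by (apply (cts_Im _ K)). rewrite Rmult_1_l.
    apply RInt_ext. intros x _. simpl. rewrite opp_IZR.
    replace (- (- IZR xi * (x + PI))) with (IZR xi * (x + PI)) by ring.
    rewrite cos_neg, sin_neg. ring.
Qed.

(** * Trigonometric polynomials and differentiation *)

Definition tp (K : nat) (c : Z -> C) (x : R) : C := csum (fun xi => (c xi * mode xi x)%C) (zr K).

Lemma pc_tp K c : pc (tp K c).
Proof. apply pc_csum. intros xi _. apply pc_scal, pc_mode. Qed.

Lemma cts_tp K c : cts (tp K c).
Proof. apply pc_cts, pc_tp. Qed.

Lemma fourier_term c xi z :
  fourier (fun x => c z * mode z x)%C xi = (if Z.eq_dec xi z then c z else RtoC 0).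
Proof.
  rewrite fourier_scal by apply cts_mode. rewrite fourier_mode.
  destruct (Z.eq_dec xi z); ring.
Qed.

Lemma fourier_tp_in K c xi : In xi (zr K) -> fourier (tp K c) xi = c xi.
Proof.
  intros H. unfold tp.
  rewrite (fourier_csum (fun z x => c z * mode z x)%C).
  2:{ intros z _. apply pc_cts, pc_scal, pc_mode. }
  rewrite (csum_single _ _ xi); [|apply NoDup_zr|auto|].
  - rewrite fourier_term. destruct (Z.eq_dec xi xi); tauto.
  - intros z _ Hz. rewrite fourier_term. destruct (Z.eq_dec xi z); congruence.
Qed.

Lemma fourier_tp_out K c xi : ~ In xi (zr K) -> fourier (tp K c) xi = RtoC 0.
Proof.
  intros H. unfold tp.
  rewrite (fourier_csum (fun z x => c z * mode z x)%C).
  2:{ intros z _. apply pc_cts, pc_scal, pc_mode. }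
  apply csum_zero. intros z Hz. rewrite fourier_term. destruct (Z.eq_dec xi z); congruence.
Qed.

Lemma tp_ext K c d x : (forall xi, In xi (zr K) -> c xi = d xi) -> tp K c x = tp K d x.
Proof. intros H. apply csum_ext. intros xi Hxi. rewrite H; auto. Qed.

Lemma tp_plus K c d x : tp K (fun xi => c xi + d xi)%C x = (tp K c x + tp K d x)%C.
Proof. unfold tp. rewrite <- csum_plus. apply csum_ext. intros. ring. Qed.

Lemma tp_scal K a c x : tp K (fun xi => a * c xi)%C x = (a * tp K c x)%C.
Proof. unfold tp. rewrite <- csum_scal. apply csum_ext. intros. ring. Qed.

(** With a trigonometric polynomial as one factor the convolution of coefficients
    is a finite sum, whatever the regularity of the other factor. *)
Lemma fourier_mult_tp f K c xi :
  cts f -> fourier (fun x => f x * tp K c x)%C xi =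
    csum (fun z => fourier f (xi - z) * c z)%C (zr K).
Proof.
  intros Hf.
  rewrite (fourier_ext _ (fun x => csum (fun z => c z * (f x * mode z x))%C (zr K))).
  - rewrite (fourier_csum (fun z x => c z * (f x * mode z x))%C).
    + apply csum_ext. intros z _. rewrite fourier_scal, fourier_mode_shift; [ring|].
      apply cts_mult; auto. apply cts_mode.
    + intros z _. apply cts_mult; [apply cts_const|apply cts_mult; auto; apply cts_mode].
  - intros x. unfold tp. rewrite <- csum_scal. apply csum_ext. intros. ring.
Qed.

Lemma sum_n_csum (f : nat -> C) n : sum_n f n = csum f (seq 0 (n + 1)).
Proof.
  induction n as [|n IH].
  - rewrite sum_O. simpl. ring.
  - rewrite sum_Sn, IH. replace (S n + 1)%nat with (n + 1 + 1)%nat by lia.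
    rewrite (seq_app (n + 1) 1), csum_app. simpl. unfold plus; simpl.
    replace (S n) with (n + 1)%nat by lia. ring.
Qed.

Lemma trig_sum_tp K c x : trig_sum (- Z.of_nat K) (Z.of_nat K) c x = tp K c x.
Proof.
  unfold trig_sum, tp, zr. rewrite sum_n_csum, csum_map.
  replace (Z.to_nat (Z.of_nat K - - Z.of_nat K) + 1)%nat with (2 * K + 1)%nat by lia.
  reflexivity.
Qed.

(** Componentwise, to match the derivatives [Dx] of the scheme. *)
Definition dC (f f' : R -> C) : Prop :=
  forall x, is_derive (fun y => Re (f y)) x (Re (f' x)) /\
            is_derive (fun y => Im (f y)) x (Im (f' x)).

Lemma dC_ext f g f' g' : (forall x, f x = g x) -> (forall x, f' x = g' x) -> dC f f' -> dC g g'.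
Proof.
  intros H H' D x. destruct (D x) as [D1 D2]. rewrite <- H'. split.
  - apply (is_derive_ext (fun y => Re (f y))); auto. intros; rewrite H; auto.
  - apply (is_derive_ext (fun y => Im (f y))); auto. intros; rewrite H; auto.
Qed.

Lemma dC_const c : dC (fun _ => c) (fun _ => RtoC 0).
Proof. intros x. split; apply (is_derive_const (V := R_NormedModule)). Qed.

Lemma dC_plus f g f' g' : dC f f' -> dC g g' -> dC (fun x => f x + g x)%C (fun x => f' x + g' x)%C.
Proof.
  intros F G x. destruct (F x), (G x).
  split; apply (is_derive_plus (V := R_NormedModule)); auto.
Qed.

Lemma dC_mult f g f' g' :
  dC f f' -> dC g g' -> dC (fun x => f x * g x)%C (fun x => f' x * g x + f x * g' x)%C.
Proof.
  intros F G x. destruct (F x) as [F1 F2], (G x) as [G1 G2].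
  pose proof (fun u v u' v' (P : is_derive u x u') (Q : is_derive v x v') =>
    is_derive_mult u v x u' v' P Q Rmult_comm) as M.
  split.
  - evar_last. { apply (is_derive_minus (V := R_NormedModule)); apply M; eassumption. }
    unfold minus, plus, opp, mult; simpl. unfold Re, Im. ring.
  - evar_last. { apply (is_derive_plus (V := R_NormedModule)); apply M; eassumption. }
    unfold minus, plus, opp, mult; simpl. unfold Re, Im. ring.
Qed.

Lemma dC_scal c f f' : dC f f' -> dC (fun x => c * f x)%C (fun x => c * f' x)%C.
Proof.
  intros F. apply (dC_ext (fun x => c * f x)%C _ (fun x => RtoC 0 * f x + c * f' x)%C).
  - auto.
  - intros; ring.
  - apply dC_mult; auto. apply dC_const.
Qed.

Lemma dC_pow f f' n :
  dC f f' -> dC (fun x => f x ^ S n)%C (fun x => RtoC (INR (S n)) * (f x ^ n * f' x))%C.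
Proof.
  intros F. induction n as [|n IH].
  - apply (dC_ext f _ f'); auto; intros; simpl; ring.
  - apply (dC_ext (fun x => f x * f x ^ S n)%C _
      (fun x => f' x * f x ^ S n + f x * (RtoC (INR (S n)) * (f x ^ n * f' x)))%C).
    + intros; reflexivity.
    + intros x. rewrite (S_INR (S n)), RtoC_plus. simpl. ring.
    + apply dC_mult; auto.
Qed.

Lemma dC_csum {A} (F F' : A -> R -> C) l :
  (forall a, In a l -> dC (F a) (F' a)) ->
  dC (fun x => csum (fun a => F a x) l) (fun x => csum (fun a => F' a x) l).
Proof.
  induction l as [|a l IH]; simpl; intros H; [apply dC_const|].
  apply dC_plus; auto.
Qed.

Lemma dC_cis a b : dC (fun x => cis (a * (x + b))) (fun x => Ci * RtoC a * cis (a * (x + b)))%C.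
Proof. intros x. split; simpl; auto_derive; auto; ring. Qed.

(** The Fourier symbol of the space derivative. *)
Definition dmul (xi : Z) : C := (Ci * RtoC (IZR xi))%C.

Lemma dC_tp K c : dC (tp K c) (tp K (fun xi => dmul xi * c xi)%C).
Proof.
  unfold tp. apply (dC_csum (fun xi x => c xi * mode xi x)%C
    (fun xi x => dmul xi * c xi * mode xi x)%C).
  intros xi _. apply (dC_ext (fun x => c xi * mode xi x)%C _
    (fun x => c xi * (Ci * RtoC (IZR xi) * cis (IZR xi * (x + PI))))%C).
  - auto.
  - intros x. unfold dmul, mode. ring.
  - apply dC_scal. apply dC_cis.
Qed.

Lemma Dx_dC f f' x : dC f f' -> Dx 1 f x = f' x.
Proof.
  intros H. destruct (H x) as [H1 H2].
  change (Dx 1 f x) with (Derive (fun y => Re (f y)) x, Derive (fun y => Im (f y)) x).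
  apply is_derive_unique in H1, H2.
  transitivity (Re (f' x), Im (f' x)); [apply f_equal2; [exact H1|exact H2]|].
  destruct (f' x); reflexivity.
Qed.

Lemma Dx_S f f' n x : dC f f' -> Dx (S n) f x = Dx n f' x.
Proof.
  intros H. unfold Dx. f_equal.
  - replace (S n) with (n + 1)%nat by lia. rewrite <- Derive_n_comp.
    apply Derive_n_ext. intros y. simpl. apply is_derive_unique, H.
  - replace (S n) with (n + 1)%nat by lia. rewrite <- Derive_n_comp.
    apply Derive_n_ext. intros y. simpl. apply is_derive_unique, H.
Qed.

Lemma Dx_0 f x : Dx 0 f x = f x.
Proof. unfold Dx. simpl. destruct (f x); reflexivity. Qed.

Lemma Dx_ext n f g x : (forall y, f y = g y) -> Dx n f x = Dx n g x.
Proof.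
  intros H. unfold Dx. f_equal; apply Derive_n_ext; intros y; rewrite H; reflexivity.
Qed.

Lemma Dx_tp n K c x : Dx n (tp K c) x = tp K (fun xi => dmul xi ^ n * c xi)%C x.
Proof.
  revert c. induction n as [|n IH]; intros c.
  - rewrite Dx_0. apply tp_ext. intros; simpl; ring.
  - rewrite (Dx_S _ _ n x (dC_tp K c)), IH. apply tp_ext. intros; simpl; ring.
Qed.

Lemma RInt_dC h h' :
  dC h h' -> cts h' -> h PI = h (- PI) ->
  RInt (fun x => Re (h' x)) (- PI) PI = 0 /\ RInt (fun x => Im (h' x)) (- PI) PI = 0.
Proof.
  intros D C E. split; apply is_RInt_unique.
  - replace 0 with (minus (Re (h PI)) (Re (h (- PI)))).
    + apply (is_RInt_derive (fun x => Re (h x))); intros x _; [apply D|apply cts_Re; auto].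
    + rewrite E. unfold minus, plus, opp; simpl. ring.
  - replace 0 with (minus (Im (h PI)) (Im (h (- PI)))).
    + apply (is_RInt_derive (fun x => Im (h x))); intros x _; [apply D|apply cts_Im; auto].
    + rewrite E. unfold minus, plus, opp; simpl. ring.
Qed.

(** Integrates the derivative of [f] times the exponential over one period. *)
Lemma fourier_deriv f f' xi :
  pc f -> dC f f' -> cts f' -> fourier f' xi = (dmul xi * fourier f xi)%C.
Proof.
  intros [Hp Hf] D C.
  assert (E : fourier (fun x => f' x + (- dmul xi) * f x)%C xi = RtoC 0).
  { rewrite fourier_unfold by (apply cts_plus; auto; apply cts_mult; auto; apply cts_const).
    set (h := fun x => (f x * cis (- IZR xi * (x + PI)))%C).
    set (h' := fun x => (f' x * cis (- IZR xi * (x + PI)) +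
      f x * (Ci * RtoC (- IZR xi) * cis (- IZR xi * (x + PI))))%C).
    assert (Dh : dC h h') by (apply dC_mult; auto; apply dC_cis).
    assert (Ch : cts h').
    { apply cts_plus; apply cts_mult; auto; try apply cts_mult; try apply cts_const;
        apply cts_cis; intros x; apply continuous_affine. }
    assert (Eh : forall x, h' x = ((f' x + - dmul xi * f x) * cis (- (IZR xi * (x + PI))))%C).
    { intros x. unfold h', dmul. rewrite RtoC_opp.
      replace (- IZR xi * (x + PI)) with (- (IZR xi * (x + PI))) by ring. ring. }
    destruct (RInt_dC h h' Dh Ch) as [E1 E2].
    { unfold h. replace PI with (- PI + 2 * PI) at 1 by ring. rewrite Hp. f_equal.
      replace (- IZR xi * (PI + PI)) with (2 * IZR (- xi) * PI) by (rewrite opp_IZR; ring).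
      replace (- IZR xi * (- PI + PI)) with 0 by ring. rewrite cis_2PI, cis_0. reflexivity. }
    rewrite (RInt_ext _ (fun x => Re (h' x))) by (intros; rewrite Eh; reflexivity).
    rewrite (RInt_ext (fun x => Im _) (fun x => Im (h' x))) by (intros; rewrite Eh; reflexivity).
    rewrite E1, E2. unfold Cmult, RtoC. simpl. f_equal; ring. }
  rewrite fourier_plus, fourier_scal in E;
    [|auto|auto|apply cts_mult; auto; apply cts_const].
  replace (fourier f' xi) with
    (fourier f' xi + - dmul xi * fourier f xi + dmul xi * fourier f xi)%C by ring.
  rewrite E. ring.
Qed.

(** * Uniqueness of Fourier coefficients and inversion *)

Lemma Rabs_bounded_of_cts f : cts f -> exists B, 0 <= B /\ forall x, - PI <= x <= PI -> Cmod (f x) <= B.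
Proof.
  intros Hf. pose proof PI_RGT_0.
  destruct (continuity_ab_maj (fun x => Cmod (f x)) (- PI) PI ltac:(lra)) as [M [HM _]].
  - intros c _. apply continuity_pt_filterlim. apply cts_Cmod; auto.
  - exists (Cmod (f M)). split; [apply Cmod_ge_0|auto].
Qed.

Lemma periodic_Z {A} (f : R -> A) : periodic f -> forall n x, f (x + 2 * PI * IZR n) = f x.
Proof.
  intros H.
  assert (HN : forall n x, f (x + 2 * PI * INR n) = f x).
  { induction n as [|n IH]; intros x; [f_equal; simpl; ring|].
    rewrite S_INR. replace (x + 2 * PI * (INR n + 1)) with ((x + 2 * PI * INR n) + 2 * PI) by ring.
    rewrite H. apply IH. }
  intros n x. destruct (Z_le_gt_dec 0 n).
  - rewrite <- (Z2Nat.id n), <- INR_IZR_INZ by auto. apply HN.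
  - rewrite <- (HN (Z.to_nat (- n)) (x + 2 * PI * IZR n)). f_equal.
    rewrite INR_IZR_INZ, Z2Nat.id, opp_IZR by lia. ring.
Qed.

Lemma reduce_period x : exists n y, x = y + 2 * PI * IZR n /\ - PI <= y <= PI.
Proof.
  pose proof PI_RGT_0. set (t := (x + PI) / (2 * PI)).
  destruct (archimed t) as [H1 H2]. exists (up t - 1)%Z, (x - 2 * PI * IZR (up t - 1)).
  split; [ring|]. rewrite minus_IZR.
  assert (E : x = 2 * PI * t - PI) by (unfold t; field; lra). rewrite E.
  split; nra.
Qed.

Lemma cos_le_of_far d y : 0 < d <= PI -> d <= Rabs y <= 2 * PI - d -> cos y <= cos d.
Proof.
  intros Hd Hy. assert (E : cos y = cos (Rabs y)).
  { unfold Rabs. destruct (Rcase_abs y); [symmetry; apply cos_neg|auto]. }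
  rewrite E. destruct (Rle_or_lt (Rabs y) PI).
  - apply cos_decr_1; lra.
  - replace (cos (Rabs y)) with (cos (2 * PI - Rabs y)).
    + apply cos_decr_1; lra.
    + replace (2 * PI - Rabs y) with (- Rabs y + 2 * INR 1 * PI) by (simpl; ring).
      rewrite cos_period. apply cos_neg.
Qed.

Lemma cos_ge_of_near d y : 0 < d <= PI -> Rabs y <= d -> cos d <= cos y.
Proof.
  intros Hd Hy. assert (E : cos y = cos (Rabs y)).
  { unfold Rabs. destruct (Rcase_abs y); [symmetry; apply cos_neg|auto]. }
  rewrite E. pose proof (Rabs_pos y). apply cos_decr_1; lra.
Qed.

Lemma Bernoulli_ineq t n : 0 <= t -> 1 + INR n * t <= (1 + t) ^ n.
Proof.
  intros Ht. induction n as [|n IH]; [simpl; lra|].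
  rewrite S_INR. simpl. pose proof (pos_INR n). nra.
Qed.

(** Powers of the kernel 1 + cos (x - x0) - cos d exceed 1 only near x0, where
    they grow at least linearly in the exponent; a function orthogonal to all
    of them cannot be positive at x0. *)
Lemma peak_kernel_contradiction (g : R -> R) x0 :
  (forall x, continuous g x) -> - PI < x0 < PI -> 0 < g x0 ->
  (forall d n, RInt (fun x => g x * (1 + cos (x - x0) - cos d) ^ n) (- PI) PI = 0) -> False.
Proof.
  intros Hg Hx0 Hpos H0. pose proof PI_RGT_0 as Hpi.
  destruct (Rabs_bounded_of_cts (fun x => RtoC (g x))) as [B [HB0 HB]]; [apply cts_RtoC; auto|].
  assert (HB' : forall x, - PI <= x <= PI -> Rabs (g x) <= B).
  { intros x Hx. rewrite <- Cmod_R. apply HB; auto. }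
  set (c := g x0 / 2).
  destruct (proj1 (filterlim_locally _ _) (Hg x0) (mkposreal c ltac:(unfold c; lra))) as [d0 Hd0].
  set (d := Rmin (d0 / 2) (Rmin (PI + x0) (PI - x0))).
  assert (Hd : 0 < d) by (unfold d; destruct d0; simpl; repeat apply Rmin_glb_lt; lra).
  assert (Hd1 : d <= d0 / 2) by apply Rmin_l.
  assert (Hd2 : d <= PI + x0) by (eapply Rle_trans; [apply Rmin_r|apply Rmin_l]).
  assert (Hd3 : d <= PI - x0) by (eapply Rle_trans; [apply Rmin_r|apply Rmin_r]).
  assert (Hdpi : d <= PI) by lra.
  assert (Hnear : forall x, Rabs (x - x0) <= d -> c <= g x).
  { intros x Hx. destruct d0 as [d0 P0]; simpl in *.
    specialize (Hd0 x). unfold ball in Hd0; simpl in Hd0; unfold AbsRing_ball, abs, minus, plus, opp in Hd0; simpl in Hd0.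
    specialize (Hd0 ltac:(change (x + - x0) with (x - x0); lra)).
    apply Rabs_lt_between in Hd0. unfold c in *. lra. }
  set (h := fun x => (Rabs (cos (x - x0) - cos d) + (cos (x - x0) - cos d)) / 2).
  assert (Cc : forall x, continuous (fun x => cos (x - x0) - cos d) x).
  { intros x. apply (continuous_minus (V := R_NormedModule)); [|apply continuous_const].
    apply continuous_comp; [|apply continuous_cos].
    apply (continuous_minus (V := R_NormedModule)); [apply continuous_id|apply continuous_const]. }
  assert (Ch : forall x, continuous h x).
  { intros x. unfold h. apply (continuous_mult (K := R_AbsRing)); [|apply continuous_const].
    apply (continuous_plus (V := R_NormedModule)); auto.
    apply continuous_comp; auto. apply continuous_Rabs. }
  assert (Hh0 : forall x, 0 <= h x).
  { intros x. unfold h. pose proof (Rle_abs (- (cos (x - x0) - cos d))). rewrite Rabs_Ropp in H. lra. }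
  assert (I0 : 0 < RInt h (- PI) PI).
  { assert (E : RInt h (- PI) PI = RInt h (- PI) (x0 - d) + RInt h (x0 - d) (x0 + d) + RInt h (x0 + d) PI).
    { rewrite <- (RInt_Chasles (V := R_CompleteNormedModule) h (- PI) (x0 - d) PI)
        by (apply ex_RInt_cts; auto).
      rewrite <- (RInt_Chasles (V := R_CompleteNormedModule) h (x0 - d) (x0 + d) PI)
        by (apply ex_RInt_cts; auto).
      unfold plus; simpl. ring. }
    rewrite E.
    assert (0 <= RInt h (- PI) (x0 - d)) by (apply RInt_ge_0; [lra|apply ex_RInt_cts; auto|auto]).
    assert (0 <= RInt h (x0 + d) PI) by (apply RInt_ge_0; [lra|apply ex_RInt_cts; auto|auto]).
    assert (0 < RInt h (x0 - d) (x0 + d)).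
    { apply RInt_gt_0; [lra| |auto]. intros x Hx.
      assert (cos d < cos (x - x0)).
      { replace (cos (x - x0)) with (cos (Rabs (x - x0))).
        - apply cos_decreasing_1; try apply Rabs_pos; try lra.
          + apply Rabs_le. lra.
          + apply Rabs_def1; lra.
        - unfold Rabs. destruct (Rcase_abs _); [apply cos_neg|auto]. }
      unfold h. rewrite Rabs_pos_eq by lra. lra. }
    lra. }
  assert (Hc : 0 < c) by (unfold c; lra).
  assert (K : forall n, c * INR n * RInt h (- PI) PI <= 2 * PI * B).
  { intros n.
    assert (E : RInt (fun x => c * INR n * h x + - B) (- PI) PI <= 0).
    { rewrite <- (H0 d n). apply RInt_le; [lra| | |].
      - apply ex_RInt_cts. intros x. apply (continuous_plus (V := R_NormedModule)); [|apply continuous_const].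
        apply (continuous_mult (K := R_AbsRing)); auto. apply continuous_const.
      - apply ex_RInt_cts. intros x. apply (continuous_mult (K := R_AbsRing)); auto.
        apply (continuous_comp (fun x => 1 + cos (x - x0) - cos d) (fun t => t ^ n)).
        + apply continuous_ext with (fun x => 1 + (cos (x - x0) - cos d)); [intros; unfold plus; simpl; ring|].
          apply (continuous_plus (V := R_NormedModule)); auto. apply continuous_const.
        + apply (ex_derive_continuous (V := R_NormedModule)). auto_derive; auto.
      - intros x Hx. specialize (HB' x ltac:(lra)). apply Rabs_le_between in HB'.
        destruct (Rle_or_lt (Rabs (x - x0)) d) as [Hn|Hf].
        + pose proof (Hnear x Hn) as Hcg. pose proof (cos_ge_of_near d _ ltac:(lra) Hn) as Hcos.
          unfold h. rewrite Rabs_pos_eq by lra.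
          set (t := cos (x - x0) - cos d) in *. assert (Ht : 0 <= t) by (unfold t; lra).
          replace (1 + cos (x - x0) - cos d) with (1 + t) by (unfold t; ring).
          pose proof (Bernoulli_ineq t n Ht). pose proof (pos_INR n).
          assert (0 <= INR n * t) by nra.
          assert (c * (1 + INR n * t) <= g x * (1 + t) ^ n) by (apply Rmult_le_compat; lra).
          replace (c * INR n * ((t + t) / 2)) with (c * (INR n * t)) by field. lra.
        + assert (Hcos : cos (x - x0) <= cos d).
          { apply cos_le_of_far; [lra|]. split; [lra|]. apply Rabs_le. lra. }
          unfold h. rewrite Rabs_left1 by lra.
          replace ((- (cos (x - x0) - cos d) + (cos (x - x0) - cos d)) / 2) with 0 by field.
          rewrite Rmult_0_r, Rplus_0_l.
          assert (HT : Rabs (1 + cos (x - x0) - cos d) <= 1).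
          { pose proof (COS_bound (x - x0)). pose proof (COS_bound d). apply Rabs_le. lra. }
          assert (HTn : Rabs ((1 + cos (x - x0) - cos d) ^ n) <= 1).
          { rewrite <- RPow_abs. eapply Rle_trans; [apply pow_incr; split; [apply Rabs_pos|exact HT]|].
            rewrite pow1. lra. }
          assert (Rabs (g x * (1 + cos (x - x0) - cos d) ^ n) <= B).
          { rewrite Rabs_mult. replace B with (B * 1) by ring.
            apply Rmult_le_compat; try apply Rabs_pos; auto. apply Rabs_le; auto. }
          apply Rabs_le_between in H. lra. }
    rewrite RInt_plus_cts, RInt_scal_cts, RInt_const in E; auto.
    - unfold scal in E; simpl in E; unfold mult in E; simpl in E. lra.
    - intros x. apply (continuous_mult (K := R_AbsRing)); auto. apply continuous_const.
    - intros x. apply continuous_const. }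
  destruct (INR_unbounded (2 * PI * B / (c * RInt h (- PI) PI))) as [n Hn].
  specialize (K n). assert (P : 0 < c * RInt h (- PI) PI) by nra.
  apply (Rmult_lt_compat_r _ _ _ P) in Hn.
  replace (2 * PI * B / (c * RInt h (- PI) PI) * (c * RInt h (- PI) PI)) with (2 * PI * B) in Hn by (field; lra).
  lra.
Qed.

Lemma RtoC_cos_modes x x0 :
  RtoC (cos (x - x0)) =
  (RtoC (/ 2) * cis (- (x0 + PI)) * mode 1 x + RtoC (/ 2) * cis (x0 + PI) * mode (-1) x)%C.
Proof.
  unfold mode. rewrite <- !Cmult_assoc, <- !cis_plus.
  replace (- (x0 + PI) + IZR 1 * (x + PI)) with (x - x0) by ring.
  replace (x0 + PI + IZR (-1) * (x + PI)) with (- (x - x0)) by ring.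
  unfold cis, RtoC, Cmult, Cplus. simpl. rewrite cos_neg, sin_neg. f_equal; field.
Qed.

(** Multiplication by the kernel replaces each coefficient by a combination of the
    coefficient itself and its two neighbours. *)
Lemma fourier_peak_zero f x0 d :
  cts f -> (forall xi, fourier f xi = RtoC 0) ->
  forall n, cts (fun x => f x * RtoC ((1 + cos (x - x0) - cos d) ^ n))%C /\
    forall xi, fourier (fun x => f x * RtoC ((1 + cos (x - x0) - cos d) ^ n))%C xi = RtoC 0.
Proof.
  intros Hf H0. induction n as [|n [Hc IH]].
  - split.
    + apply cts_ext with f; auto. intros x. simpl. ring.
    + intros xi. rewrite <- (H0 xi). apply fourier_ext. intros x. simpl. ring.
  - set (g := fun x => (f x * RtoC ((1 + cos (x - x0) - cos d) ^ n))%C) in *.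
    assert (E : forall x, (f x * RtoC ((1 + cos (x - x0) - cos d) ^ S n))%C =
      (RtoC (1 - cos d) * g x + (RtoC (/ 2) * cis (- (x0 + PI)) * (g x * mode 1 x) +
        RtoC (/ 2) * cis (x0 + PI) * (g x * mode (-1) x)))%C).
    { intros x. unfold g. rewrite <- tech_pow_Rmult, RtoC_mult.
      replace (1 + cos (x - x0) - cos d) with ((1 - cos d) + cos (x - x0)) at 1 by ring.
      rewrite RtoC_plus, (RtoC_cos_modes x x0). ring. }
    assert (C1 : cts (fun x => g x * mode 1 x)%C) by (apply cts_mult; auto; apply cts_mode).
    assert (C2 : cts (fun x => g x * mode (-1) x)%C) by (apply cts_mult; auto; apply cts_mode).
    assert (S1 : forall c u, cts u -> cts (fun x => c * u x)%C)
      by (intros; apply cts_mult; auto; apply cts_const).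
    split.
    + eapply cts_ext; [intros x; symmetry; apply E|].
      apply cts_plus; [auto|apply cts_plus; auto].
    + intros xi. rewrite (fourier_ext _ _ xi E).
      rewrite !fourier_plus, !fourier_scal, !fourier_mode_shift, !IH; auto.
      * ring.
      * apply cts_plus; auto.
Qed.

Lemma fourier_zero_Re_le f :
  cts f -> (forall xi, fourier f xi = RtoC 0) -> forall x, - PI < x < PI -> Re (f x) <= 0.
Proof.
  intros Hf H0 x0 Hx0. destruct (Rle_or_lt (Re (f x0)) 0) as [|Hlt]; auto. exfalso.
  apply (peak_kernel_contradiction (fun x => Re (f x)) x0); auto; [apply cts_Re; auto|].
  intros d n. destruct (fourier_peak_zero f x0 d Hf H0 n) as [Hc E]. specialize (E 0%Z).
  rewrite fourier_unfold in E by auto. pose proof PI_RGT_0.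
  apply (f_equal Re) in E. rewrite re_scal_l in E. change (Re (RtoC 0)) with 0 in E.
  apply Rmult_integral in E. destruct E as [E|E].
  { assert (0 < / (2 * PI)) by (apply Rinv_0_lt_compat; lra). lra. }
  eapply eq_trans; [|exact E]. apply RInt_ext. intros x _. simpl.
  rewrite Rmult_0_l, Ropp_0, cos_0, sin_0. unfold Re. ring.
Qed.

Lemma fourier_unique0 f : pc f -> (forall xi, fourier f xi = RtoC 0) -> forall x, f x = RtoC 0.
Proof.
  intros [Hp Hf] H0.
  assert (Hle : forall c x, - PI < x < PI -> Re (c * f x)%C <= 0).
  { intros c. apply (fourier_zero_Re_le (fun x => c * f x)%C).
    - apply cts_mult; auto. apply cts_const.
    - intros xi. rewrite fourier_scal, H0; auto. ring. }
  assert (Hin : forall x, - PI < x < PI -> f x = RtoC 0).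
  { intros x Hx. pose proof (Hle (RtoC 1) x Hx). pose proof (Hle (RtoC (-1)) x Hx).
    pose proof (Hle Ci x Hx). pose proof (Hle (- Ci)%C x Hx).
    destruct (f x) as [a b]. simpl in *. unfold RtoC. f_equal; lra. }
  intros x. destruct (reduce_period x) as [n [y [-> Hy]]]. rewrite periodic_Z by auto.
  pose proof PI_RGT_0.
  assert (Hend : f PI = RtoC 0).
  { apply Cmod_eq_0. apply Rle_antisym; [|apply Cmod_ge_0].
    apply le_of_eps with 1; [lra|]. intros e He.
    destruct (proj1 (filterlim_locally _ _) (cts_Cmod f Hf PI) (mkposreal e He)) as [d Hd].
    set (z := PI - Rmin (d / 2) PI).
    assert (0 < Rmin (d / 2) PI) by (apply Rmin_glb_lt; [destruct d; simpl; lra|lra]).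
    pose proof (Rmin_l (d / 2) PI). pose proof (Rmin_r (d / 2) PI).
    assert (Hz : ball PI d z).
    { unfold ball; simpl; unfold AbsRing_ball, abs, minus, plus, opp; simpl.
      unfold z. destruct d as [d Pd]; simpl in *. apply Rabs_def1; lra. }
    specialize (Hd z Hz). rewrite (Hin z) in Hd by (unfold z; lra).
    unfold ball in Hd; simpl in Hd; unfold AbsRing_ball, abs, minus, plus, opp in Hd; simpl in Hd.
    rewrite Cmod_0 in Hd. apply Rabs_lt_between in Hd. lra. }
  destruct (Req_dec y PI) as [->|]; auto.
  destruct (Req_dec y (- PI)) as [->|]; [|apply Hin; lra].
  rewrite <- Hend, <- (Hp (- PI)). f_equal. ring.
Qed.

Lemma fourier_unique f g :
  pc f -> pc g -> (forall xi, fourier f xi = fourier g xi) -> forall x, f x = g x.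
Proof.
  intros Hf Hg H x.
  assert (E : (f x - g x)%C = RtoC 0).
  { apply (fourier_unique0 (fun x => f x - g x)%C); [apply pc_minus; auto|].
    intros xi. rewrite fourier_minus, H by (apply pc_cts; auto). ring. }
  replace (f x) with (f x - g x + g x)%C by ring. rewrite E. ring.
Qed.

Lemma cts_of_unif f : (forall e, 0 < e -> exists g, cts g /\ forall x, Cmod (f x - g x)%C <= e) -> cts f.
Proof.
  intros H.
  assert (K : forall (p : C -> R), (forall z w, Rabs (p z - p w) <= Cmod (z - w)%C) ->
    (forall g, cts g -> forall x, continuous (fun y => p (g y)) x) ->
    forall x, continuous (fun y => p (f y)) x).
  { intros p Hp Hg x. apply filterlim_locally. intros e.
    destruct (H (e / 3) ltac:(destruct e; simpl; lra)) as [g [Cg Hfg]].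
    assert (He : 0 < e / 3) by (destruct e; simpl; lra).
    generalize (proj1 (filterlim_locally _ _) (Hg g Cg x) (mkposreal _ He)).
    apply filter_imp. intros y Hy.
    unfold ball in *; simpl in *; unfold AbsRing_ball, abs, minus, plus, opp in *; simpl in *.
    pose proof (Hp (f y) (g y)). pose proof (Hp (g x) (f x)).
    pose proof (Hfg y). pose proof (Hfg x).
    assert (E : Cmod (g x - f x)%C = Cmod (f x - g x)%C).
    { rewrite <- Cmod_opp. f_equal. ring. }
    rewrite E in *.
    replace (p (f y) + - p (f x)) with ((p (f y) - p (g y)) + (p (g y) + - p (g x)) + (p (g x) - p (f x))) by ring.
    eapply Rle_lt_trans; [apply Rabs_triang|].
    eapply Rle_lt_trans; [apply Rplus_le_compat_r, Rabs_triang|]. lra. }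
  apply cts_pair; apply K.
  - intros z w. apply (re_le_Cmod (z - w)%C).
  - intros g Cg. apply cts_Re; auto.
  - intros z w. eapply Rle_trans; [|apply Rmax_Cmod]. apply (Rmax_r _ (Rabs (snd (z - w)%C))).
  - intros g Cg. apply cts_Im; auto.
Qed.

Lemma csum_perm {A} (f : A -> C) l l' : Permutation l l' -> csum f l = csum f l'.
Proof.
  induction 1; simpl; [reflexivity|rewrite IHPermutation; auto|ring|congruence].
Qed.

Lemma csum_zr_split n m :
  (n <= m)%nat -> exists rest, NoDup rest /\ (forall xi, In xi rest -> (Z.of_nat n < Z.abs xi)%Z) /\
    forall F, csum F (zr m) = (csum F (zr n) + csum F rest)%C.
Proof.
  intros Hnm. exists (filter (fun xi => (Z.of_nat n <? Z.abs xi)%Z) (zr m)).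
  split; [apply NoDup_filter, NoDup_zr|]. split.
  - intros xi H. apply filter_In in H. destruct H as [_ H]. apply Z.ltb_lt; auto.
  - intros F. rewrite <- csum_app. apply csum_perm. apply NoDup_Permutation.
    + apply NoDup_zr.
    + apply NoDup_app; [apply NoDup_zr|apply NoDup_filter, NoDup_zr|].
      intros a H1 H2. apply filter_In in H2. destruct H2 as [_ H2].
      apply Z.ltb_lt in H2. apply in_zr in H1. lia.
    + intros x. rewrite in_app_iff, filter_In, !in_zr, Z.ltb_lt. lia.
Qed.

Lemma tail_small (a : Z -> R) A :
  (forall x, 0 <= a x) -> (forall l, NoDup l -> rsum a l <= A) ->
  forall e, 0 < e -> exists n, forall l, NoDup l ->
    (forall xi, In xi l -> (Z.of_nat n < Z.abs xi)%Z) -> rsum a l <= e.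
Proof.
  intros Ha HA e He.
  destruct (completeness (fun y => exists n, y = rsum a (zr n))) as [s [Hs1 Hs2]].
  - exists A. intros y [n ->]. apply HA, NoDup_zr.
  - exists (rsum a (zr 0)), 0%nat. reflexivity.
  - destruct (classic (exists n, s - e < rsum a (zr n))) as [[n Hn]|Hno].
    + exists n. intros l Hl Hin. destruct (incl_zr (zr n ++ l)) as [m Hm].
      assert (rsum a (zr n ++ l) <= rsum a (zr m)).
      { apply rsum_incl; auto. apply NoDup_app; auto; [apply NoDup_zr|].
        intros x H1 H2. apply in_zr in H1. apply Hin in H2. lia. }
      rewrite rsum_app in H. specialize (Hs1 (rsum a (zr m)) ltac:(exists m; auto)). lra.
    + exfalso. assert (s <= s - e); [|lra]. apply Hs2. intros y [n ->].
      destruct (Rle_or_lt (rsum a (zr n)) (s - e)); auto. exfalso. apply Hno. exists n. lra.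
Qed.

Lemma csum_modes_le (c : Z -> C) x l : Cmod (csum (fun xi => c xi * mode xi x)%C l) <= rsum (fun xi => Cmod (c xi)) l.
Proof.
  eapply Rle_trans; [apply csum_Cmod|]. right. apply rsum_ext. intros xi _.
  rewrite Cmod_mult, Cmod_mode. ring.
Qed.

(** The partial sums converge uniformly to a continuous function that has the same
    coefficients as [f], hence equals [f]. The bound [B] on the tails of the
    coefficients is then also a bound on the remainder of the series. *)
Lemma fourier_inversion f A :
  pc f -> (forall l, NoDup l -> rsum (fun xi => Cmod (fourier f xi)) l <= A) ->
  forall K B, (forall l, NoDup l -> (forall xi, In xi l -> (Z.of_nat K < Z.abs xi)%Z) ->
                 rsum (fun xi => Cmod (fourier f xi)) l <= B) ->
  forall x, Cmod (f x - tp K (fourier f) x)%C <= B.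
Proof.
  intros Hf HA. set (c := fourier f) in *.
  assert (Tail : forall K B, (forall l, NoDup l -> (forall xi, In xi l -> (Z.of_nat K < Z.abs xi)%Z) ->
      rsum (fun xi => Cmod (c xi)) l <= B) -> forall m x, (K <= m)%nat ->
      Cmod (tp m c x - tp K c x)%C <= B).
  { intros K B HB m x Hm. destruct (csum_zr_split K m Hm) as [rest [R1 [R2 R3]]].
    unfold tp. rewrite R3. 
    match goal with |- Cmod ?z <= _ => replace z with (csum (fun xi => c xi * mode xi x)%C rest) by ring end.
    eapply Rle_trans; [apply csum_modes_le|auto]. }
  pose proof (tail_small _ A (fun x => Cmod_ge_0 (c x)) HA) as Small.
  assert (Cv : forall (p : C -> R), (forall z w, Rabs (p z - p w) <= Cmod (z - w)%C) ->
    forall x, ex_finite_lim_seq (fun n => p (tp n c x))).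
  { intros p Hp x. apply ex_lim_seq_cauchy_corr. intros [e He]. simpl.
    destruct (Small (e / 3) ltac:(lra)) as [n Hn]. exists n. intros i j Hi Hj.
    pose proof (Tail n _ Hn i x Hi). pose proof (Tail n _ Hn j x Hj).
    pose proof (Hp (tp i c x) (tp n c x)). pose proof (Hp (tp j c x) (tp n c x)).
    replace (p (tp i c x) - p (tp j c x)) with
      ((p (tp i c x) - p (tp n c x)) - (p (tp j c x) - p (tp n c x))) by ring.
    eapply Rle_lt_trans; [apply Rabs_triang|]. rewrite Rabs_Ropp. lra. }
  assert (PR : forall z w, Rabs (Re z - Re w) <= Cmod (z - w)%C)
    by (intros z w; apply (re_le_Cmod (z - w)%C)).
  assert (PI' : forall z w, Rabs (Im z - Im w) <= Cmod (z - w)%C).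
  { intros z w. eapply Rle_trans; [|apply Rmax_Cmod]. apply (Rmax_r _ (Rabs (snd (z - w)%C))). }
  set (h := fun x => (real (Lim_seq (fun n => Re (tp n c x))), real (Lim_seq (fun n => Im (tp n c x)))) : C).
  assert (HR : forall x, is_lim_seq (fun n => Re (tp n c x)) (Re (h x))).
  { intros x. apply Lim_seq_correct'. apply (Cv Re PR). }
  assert (HI : forall x, is_lim_seq (fun n => Im (tp n c x)) (Im (h x))).
  { intros x. apply Lim_seq_correct'. apply (Cv Im PI'). }
  assert (Close : forall K B, (forall l, NoDup l -> (forall xi, In xi l -> (Z.of_nat K < Z.abs xi)%Z) ->
      rsum (fun xi => Cmod (c xi)) l <= B) -> forall x, Cmod (h x - tp K c x)%C <= B).
  { intros K B HB x.
    assert (B0 : 0 <= B) by (apply (HB []); [constructor|intros ? []]).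
    apply le_of_eps with 2; [lra|]. intros e He.
    destruct (proj1 (is_lim_seq_Reals _ _) (HR x) e He) as [n1 Hn1].
    destruct (proj1 (is_lim_seq_Reals _ _) (HI x) e He) as [n2 Hn2].
    set (m := (n1 + n2 + K)%nat).
    specialize (Hn1 m ltac:(unfold m; lia)). specialize (Hn2 m ltac:(unfold m; lia)).
    unfold Rdist in *.
    replace (h x - tp K c x)%C with ((h x - tp m c x) + (tp m c x - tp K c x))%C by ring.
    eapply Rle_trans; [apply Cmod_triangle|]. pose proof (Tail K B HB m x ltac:(unfold m; lia)).
    assert (Cmod (h x - tp m c x)%C <= 2 * e); [|lra].
    eapply Rle_trans; [apply Cmod_2Rmax|].
    assert (S2 : sqrt 2 <= 2) by (rewrite <- (sqrt_square 2) at 2 by lra; apply sqrt_le_1_alt; lra).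
    assert (Rmax (Rabs (fst (h x - tp m c x)%C)) (Rabs (snd (h x - tp m c x)%C)) <= e).
    { apply Rmax_lub.
      - change (fst (h x - tp m c x)%C) with (Re (h x) - Re (tp m c x)). rewrite Rabs_minus_sym. lra.
      - change (snd (h x - tp m c x)%C) with (Im (h x) - Im (tp m c x)). rewrite Rabs_minus_sym. lra. }
    pose proof (Rmax_l (Rabs (fst (h x - tp m c x)%C)) (Rabs (snd (h x - tp m c x)%C))).
    pose proof (Rabs_pos (fst (h x - tp m c x)%C)). apply Rmult_le_compat; try lra. apply sqrt_pos. }
  assert (Hh : pc h).
  { split.
    - intros x. unfold h. f_equal; f_equal; apply Lim_seq_ext; intros n;
        destruct (pc_tp n c) as [P _]; rewrite P; auto.
    - apply cts_of_unif. intros e He. destruct (Small e He) as [n Hn].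
      exists (tp n c). split; [apply cts_tp|]. apply Close; auto. }
  assert (Fh : forall xi, fourier f xi = fourier h xi).
  { intros xi.
    assert (E : Cmod (fourier h xi - c xi)%C <= 0).
    { apply le_of_eps with 1; [lra|]. intros e He. destruct (Small e He) as [n Hn].
      set (m := (n + Z.to_nat (Z.abs xi))%nat).
      rewrite <- (fourier_tp_in m c xi) by (apply in_zr; unfold m; lia).
      rewrite <- fourier_minus by (try apply cts_tp; apply pc_cts; auto).
      rewrite Rmult_1_r, Rplus_0_l. apply fourier_bound.
      - apply pc_cts, pc_minus; auto. apply pc_tp.
      - apply Close. intros l Hl Hin. apply Hn; auto. intros z Hz. specialize (Hin z Hz). unfold m in Hin. lia. }
    assert (E' : (fourier h xi - c xi)%C = RtoC 0).
    { apply Cmod_eq_0. pose proof (Cmod_ge_0 (fourier h xi - c xi)%C). lra. }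
    change (c xi = fourier h xi).
    replace (fourier h xi) with (fourier h xi - c xi + c xi)%C by ring. rewrite E'. ring. }
  intros K B HB x. rewrite (fourier_unique f h Hf Hh Fh x). apply Close; auto.
Qed.

(** * Sobolev spaces as algebras *)

Definition Hs (s : R) (f : R -> C) (B : R) : Prop := pc f /\ hb s (fourier f) B.

Lemma Hs_ext s f g B : (forall x, f x = g x) -> Hs s f B -> Hs s g B.
Proof.
  intros H [P Q]. split; [apply pc_ext with f; auto|].
  apply hb_ext with (fourier f); auto. intros; apply fourier_ext; auto.
Qed.

Lemma Hs_pos s f B : Hs s f B -> 0 <= B.
Proof. intros [_ [H _]]; auto. Qed.

Lemma Hs_pc s f B : Hs s f B -> pc f.
Proof. intros [H _]; auto. Qed.

Lemma Hs_le s f B B' : B <= B' -> Hs s f B -> Hs s f B'.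
Proof. intros H [P Q]. split; auto. apply hb_le with B; auto. Qed.

Lemma Hs_mono s t f B : t <= s -> Hs s f B -> Hs t f B.
Proof. intros H [P Q]. split; auto. apply hb_mono with s; auto. Qed.

Lemma Hs_plus s f g A B : Hs s f A -> Hs s g B -> Hs s (fun x => f x + g x)%C (A + B).
Proof.
  intros [P Q] [P' Q']. split; [apply pc_plus; auto|].
  apply hb_ext with (fun xi => fourier f xi + fourier g xi)%C; [|apply hb_plus; auto].
  intros; rewrite fourier_plus; auto; apply pc_cts; auto.
Qed.

Lemma Hs_scal s c f B : Hs s f B -> Hs s (fun x => c * f x)%C (Cmod c * B).
Proof.
  intros [P Q]. split; [apply pc_scal; auto|].
  apply hb_ext with (fun xi => c * fourier f xi)%C; [|apply hb_scal; auto].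
  intros; rewrite fourier_scal; auto; apply pc_cts; auto.
Qed.

Lemma Hs_opp s f B : Hs s f B -> Hs s (fun x => - f x)%C B.
Proof.
  intros [P Q]. split; [apply pc_opp; auto|].
  apply hb_ext with (fun xi => - fourier f xi)%C; [|apply hb_opp; auto].
  intros; rewrite fourier_opp; auto; apply pc_cts; auto.
Qed.

Lemma Hs_minus s f g A B : Hs s f A -> Hs s g B -> Hs s (fun x => f x - g x)%C (A + B).
Proof. intros. apply Hs_plus; auto. apply Hs_opp; auto. Qed.

Lemma hb_const s c : hb s (fourier (fun _ => c)) (Cmod c).
Proof.
  split; [apply Cmod_ge_0|]. intros l Hl.
  assert (E : forall xi, fourier (fun _ => c) xi = (if Z.eq_dec xi 0 then c else RtoC 0)).
  { intros xi. rewrite <- (fourier_term (fun _ => c)). apply fourier_ext.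
    intros x. rewrite mode_0. ring. }
  rewrite (rsum_filter (fun xi => (xi =? 0)%Z)).
  rewrite (rsum_ext _ (fun _ => 0) (filter (fun xi => negb (xi =? 0)%Z) l)).
  2:{ intros xi Hxi. apply filter_In in Hxi. destruct Hxi as [_ Hxi].
      apply Bool.negb_true_iff, Z.eqb_neq in Hxi. rewrite E.
      destruct (Z.eq_dec xi 0); [tauto|]. rewrite Cmod_0. ring. }
  rewrite rsum_const, Rmult_0_r, Rplus_0_r.
  apply Rle_trans with (rsum (fun xi => (wt s xi * Cmod (fourier (fun _ => c) xi)) ^ 2) [0%Z]).
  - apply rsum_incl; [apply NoDup_filter; auto| |intros; apply pow2_ge_0].
    intros xi Hxi. apply filter_In in Hxi. destruct Hxi as [_ Hxi]. apply Z.eqb_eq in Hxi.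
    left; auto.
  - cbn [rsum]. rewrite E. destruct (Z.eq_dec 0 0); [|tauto].
    unfold wt. replace (1 + IZR 0 ^ 2) with 1 by ring.
    unfold Rpower. rewrite ln_1, Rmult_0_r, exp_0. lra.
Qed.

Lemma Hs_const s c : Hs s (fun _ => c) (Cmod c).
Proof. split; [apply pc_const|apply hb_const]. Qed.

Lemma Hs_tp s K c B : hb s c B -> Hs s (tp K c) B.
Proof.
  intros H. split; [apply pc_tp|]. apply hb_dom1 with s c; auto. intros xi.
  destruct (in_dec Z.eq_dec xi (zr K)).
  - rewrite fourier_tp_in by auto. lra.
  - rewrite fourier_tp_out, Cmod_0 by auto. pose proof (wt_pos s xi).
    pose proof (Cmod_ge_0 (c xi)). nra.
Qed.

Lemma unif_approx s f B :
  1 / 2 < s -> Hs s f B -> forall e, 0 < e ->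
  exists K, forall x, Cmod (f x - tp K (fourier f) x)%C <= e.
Proof.
  intros Hs' [P Q] e He. destruct (l1_embed s Hs') as [C0 [_ HC]].
  assert (HA : forall l, NoDup l -> rsum (fun xi => Cmod (fourier f xi)) l <= C0 * B) by (intros; apply HC; auto).
  destruct (tail_small _ _ (fun x => Cmod_ge_0 (fourier f x)) HA e He) as [n Hn].
  exists n. apply fourier_inversion with (C0 * B); auto.
Qed.

(** Sobolev embedding. *)
Lemma sup_bound s :
  1 / 2 < s -> exists C0, 1 <= C0 /\ forall f B, Hs s f B -> forall x, Cmod (f x) <= C0 * B.
Proof.
  intros Hs'. destruct (l1_embed s Hs') as [C0 [H1 HC]]. exists C0. split; auto.
  intros f B Hf x. apply le_of_eps with 1; [lra|]. intros e He.
  destruct (unif_approx s f B Hs' Hf e He) as [K HK]. specialize (HK x).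
  replace (f x) with (tp K (fourier f) x + (f x - tp K (fourier f) x))%C by ring.
  eapply Rle_trans; [apply Cmod_triangle|].
  assert (Cmod (tp K (fourier f) x) <= C0 * B); [|lra].
  eapply Rle_trans; [apply csum_modes_le|]. apply HC; [apply Hf|apply NoDup_zr].
Qed.

Lemma hb_sq_sum s a B l : hb s a B -> NoDup l -> rsum (fun xi => (wt s xi * Cmod (a xi)) ^ 2) l <= B ^ 2.
Proof. intros [_ H]; auto. Qed.

(** By duality: the weight at the output frequency is split between the two input
    frequencies, and the factor left without a weight is summable. *)
Lemma algebra_tp s :
  1 / 2 < s -> exists C0, 1 <= C0 /\ forall f c K A B,
    cts f -> hb s (fourier f) A -> hb s c B ->
    hb s (fourier (fun x => f x * tp K c x)%C) (C0 * A * B).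
Proof.
  intros Hs'. destruct (l1_embed s Hs') as [C1 [H1 HC]].
  pose proof (Rpower_ge1 2 s ltac:(lra) ltac:(lra)) as P2.
  exists (Rpower 2 s * (2 * C1)). split; [nra|].
  intros f c K A B Hf HA HB. pose proof (hb_pos _ _ _ HA). pose proof (hb_pos _ _ _ HB).
  apply hb_dual. { repeat apply Rmult_le_pos; lra. }
  intros l v V Hl HV Hv.
  set (y := fun xi => Cmod (v xi) / wt s xi).
  assert (Hy : forall xi, 0 <= y xi).
  { intros xi. apply Rmult_le_pos; [apply Cmod_ge_0|left; apply Rinv_0_lt_compat, wt_pos]. }
  set (X := fun (a b : Z -> R) => rsum (fun x => rsum (fun z => a (x - z)%Z * b z * y x) (zr K)) l).
  apply Rle_trans with (Rpower 2 s * X (fun z => wt s z * Cmod (fourier f z)) (fun z => Cmod (c z))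
     + Rpower 2 s * X (fun z => Cmod (fourier f z)) (fun z => wt s z * Cmod (c z))).
  - unfold X. rewrite <- !rsum_scal, <- rsum_plus. apply rsum_le. intros xi _.
    rewrite <- !rsum_scal, <- rsum_plus.
    rewrite fourier_mult_tp by auto. eapply Rle_trans; [apply Rle_abs|].
    eapply Rle_trans; [apply re_le_Cmod|]. rewrite Cmod_mult.
    eapply Rle_trans; [apply Rmult_le_compat_r; [apply Cmod_ge_0|apply csum_Cmod]|].
    rewrite Rmult_comm, <- rsum_scal. apply rsum_le. intros z _. rewrite Cmod_mult.
    replace (Cmod (v xi)) with (wt s xi * y xi).
    2:{ unfold y. pose proof (wt_pos s xi). field. lra. }
    pose proof (wt_subadd s xi z ltac:(lra)) as Hsub.
    set (a := Cmod (fourier f (xi - z))). set (b := Cmod (c z)).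
    assert (P : 0 <= a * b * y xi).
    { apply Rmult_le_pos; auto. apply Rmult_le_pos; apply Cmod_ge_0. }
    replace (wt s xi * y xi * (a * b)) with (wt s xi * (a * b * y xi)) by ring.
    eapply Rle_trans; [apply Rmult_le_compat_r; [exact P|exact Hsub]|]. right; ring.
  - assert (X1 : X (fun z => wt s z * Cmod (fourier f z)) (fun z => Cmod (c z)) <= A * (C1 * B) * V).
    { apply (trilinear_l1_right (fun z => wt s z * Cmod (fourier f z)) (fun z => Cmod (c z)) y); auto;
      [apply NoDup_zr|intros; apply Cmod_ge_0|nra| |].
      - intros l' Hl'. apply hb_sq_sum; auto.
      - apply HC; auto. apply NoDup_zr. }
    assert (X2 : X (fun z => Cmod (fourier f z)) (fun z => wt s z * Cmod (c z)) <= (C1 * A) * B * V).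
    { apply (trilinear_l1_diff (fun z => Cmod (fourier f z)) (fun z => wt s z * Cmod (c z)) y); auto;
      [apply NoDup_zr|intros; apply Cmod_ge_0|nra|].
      apply hb_sq_sum; auto. apply NoDup_zr. }
    replace (Rpower 2 s * (2 * C1) * A * B * V) with
      (Rpower 2 s * (A * (C1 * B) * V) + Rpower 2 s * (C1 * A * B * V)) by ring.
    apply Rplus_le_compat; apply Rmult_le_compat_l; lra.
Qed.

(** One factor is replaced by its partial Fourier sums, which converge uniformly;
    this avoids infinite convolutions altogether. *)
Lemma algebra s :
  1 / 2 < s -> exists C0, 1 <= C0 /\ forall f g A B, Hs s f A -> Hs s g B ->
    Hs s (fun x => f x * g x)%C (C0 * A * B).
Proof.
  intros Hs'. destruct (algebra_tp s Hs') as [C0 [H1 HC]].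
  destruct (sup_bound s Hs') as [C1 [H2 HS]]. exists C0. split; auto.
  intros f g A B Hf Hg. pose proof (Hs_pos _ _ _ Hf). pose proof (Hs_pos _ _ _ Hg).
  destruct Hf as [Pf Qf]. destruct Hg as [Pg Qg].
  split; [apply pc_mult; auto|].
  apply hb_approx with (fun _ => C1 * A + 1). { repeat apply Rmult_le_pos; lra. }
  intros e He. destruct (unif_approx s g B Hs' (conj Pg Qg) e He) as [K HK].
  exists (fourier (fun x => f x * tp K (fourier g) x)%C). split.
  - apply HC; auto. apply pc_cts; auto.
  - intros xi. rewrite <- fourier_minus by (apply cts_mult; try apply pc_cts; auto; apply pc_tp).
    apply fourier_bound.
    + apply pc_cts, pc_minus; apply pc_mult; auto. apply pc_tp.
    + intros x. replace (f x * g x - f x * tp K (fourier g) x)%C with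
        (f x * (g x - tp K (fourier g) x))%C by ring.
      rewrite Cmod_mult, Rmult_comm. specialize (HK x). specialize (HS f A (conj Pf Qf) x).
      apply Rmult_le_compat; try apply Cmod_ge_0; auto. lra.
Qed.

Lemma Hs_pow_bound s :
  1 / 2 < s -> exists C0, 1 <= C0 /\ forall n f A, Hs s f A -> Hs s (fun x => f x ^ n)%C ((C0 * A) ^ n).
Proof.
  intros Hs'. destruct (algebra s Hs') as [C0 [H1 HC]]. exists C0. split; auto.
  intros n f A Hf. induction n as [|n IH]; simpl.
  - pose proof (Hs_const s (RtoC 1)) as H. rewrite Cmod_1 in H. exact H.
  - rewrite Rmult_assoc, <- Rmult_assoc. apply HC; auto.
Qed.

(** Induction on the exponent, writing f^(n+1) - g^(n+1) as
    f (f^n - g^n) + (f - g) g^n. *)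
Lemma Hs_pow_diff s n A :
  1 / 2 < s -> 0 <= A -> exists D, 0 <= D /\ forall f g d, Hs s f A -> Hs s g A ->
    Hs s (fun x => f x - g x)%C d -> Hs s (fun x => f x ^ n - g x ^ n)%C (D * d).
Proof.
  intros Hs' HA. destruct (algebra s Hs') as [C0 [H1 HC]].
  destruct (Hs_pow_bound s Hs') as [C1 [H2 HP]].
  induction n as [|n [D [HD IH]]].
  - exists 0. split; [lra|]. intros f g d Hf Hg Hd. rewrite Rmult_0_l.
    apply Hs_ext with (fun _ => RtoC 0); [intros; simpl; ring|].
    pose proof (Hs_const s (RtoC 0)) as H. rewrite Cmod_0 in H. exact H.
  - exists (C0 * A * D + C0 * (C1 * A) ^ n).
    assert (0 <= (C1 * A) ^ n) by (apply pow_le; nra).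
    split. { apply Rplus_le_le_0_compat; repeat apply Rmult_le_pos; auto; lra. }
    intros f g d Hf Hg Hd.
    apply Hs_ext with (fun x => f x * (f x ^ n - g x ^ n) + (f x - g x) * g x ^ n)%C;
      [intros; simpl; ring|].
    replace ((C0 * A * D + C0 * (C1 * A) ^ n) * d) with
      (C0 * A * (D * d) + C0 * d * (C1 * A) ^ n) by ring.
    apply Hs_plus; apply HC; auto.
Qed.

(** The mean of the powers of a + d and a - d is even in d, so it differs from a^n
    quadratically. The half difference, odd in d, is carried along by the induction. *)
Lemma Hs_pow_mean s n A :
  1 / 2 < s -> 0 <= A -> exists D, 0 <= D /\ forall a d t, Hs s a A -> Hs s d t -> t <= A ->
    Hs s (fun x => RtoC (/ 2) * ((a x + d x) ^ n + (a x - d x) ^ n) - a x ^ n)%C (D * t ^ 2) /\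
    Hs s (fun x => RtoC (/ 2) * ((a x + d x) ^ n - (a x - d x) ^ n))%C (D * t).
Proof.
  intros Hs' HA. destruct (algebra s Hs') as [C0 [H1 HC]].
  destruct (Hs_pow_bound s Hs') as [C1 [H2 HP]].
  assert (Half : forall z : C, (RtoC (/ 2) * (z + z))%C = z).
  { intros [z1 z2]. unfold RtoC, Cmult, Cplus. simpl. f_equal; field. }
  induction n as [|n [D [HD IH]]].
  - exists 0. split; [lra|]. intros a d t Ha Hd Ht. rewrite !Rmult_0_l.
    pose proof (Hs_const s (RtoC 0)) as H. rewrite Cmod_0 in H.
    split; (apply Hs_ext with (fun _ => RtoC 0); [|exact H]); intros; simpl; [rewrite Half|]; ring.
  - set (E := (C1 * A) ^ n). assert (HE : 0 <= E) by (apply pow_le; nra).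
    exists (C0 * A * D + C0 * D + C0 * A * D + C0 * (D * A ^ 2 + E)).
    assert (0 <= A ^ 2) by apply pow2_ge_0.
    assert (Z1 : 0 <= C0 * A * D) by (repeat apply Rmult_le_pos; lra).
    assert (Z2 : 0 <= C0 * D) by (repeat apply Rmult_le_pos; lra).
    assert (Z3 : 0 <= C0 * (D * A ^ 2 + E)) by (apply Rmult_le_pos; nra).
    split; [lra|]. intros a d t Ha Hd Ht. pose proof (Hs_pos _ _ _ Hd) as Ht0.
    destruct (IH a d t Ha Hd Ht) as [I1 I2]. pose proof (HP n a A Ha) as Hp.
    set (P := fun x => (RtoC (/ 2) * ((a x + d x) ^ n + (a x - d x) ^ n) - a x ^ n)%C) in *.
    set (Q := fun x => (RtoC (/ 2) * ((a x + d x) ^ n - (a x - d x) ^ n))%C) in *.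
    split.
    + apply Hs_ext with (fun x => a x * P x + d x * Q x)%C.
      { intros x. unfold P, Q. rewrite !Cpow_S. ring. }
      apply Hs_le with (C0 * A * (D * t ^ 2) + C0 * t * (D * t)); [|apply Hs_plus; apply HC; auto].
      assert (0 <= t ^ 2) by apply pow2_ge_0. nra.
    + apply Hs_ext with (fun x => a x * Q x + d x * (P x + a x ^ n))%C.
      { intros x. unfold P, Q. rewrite !Cpow_S. ring. }
      apply Hs_le with (C0 * A * (D * t) + C0 * t * (D * t ^ 2 + E)).
      2:{ apply Hs_plus; apply HC; auto. apply Hs_plus; auto. }
      assert (t ^ 2 <= A ^ 2) by (apply pow_incr; lra).
      assert (D * t ^ 2 <= D * A ^ 2) by (apply Rmult_le_compat_l; auto).
      assert (C0 * t * (D * t ^ 2 + E) <= C0 * t * (D * A ^ 2 + E)) by (apply Rmult_le_compat_l; nra).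
      nra.
Qed.

(** * Energy estimates *)

Lemma Cmod_dmul xi : Cmod (dmul xi) = Rabs (IZR xi).
Proof. unfold dmul. rewrite Cmod_mult, Cmod_Ci, Cmod_R. ring. Qed.

Lemma hb_dmul s a A : hb (s + 1) a A -> hb s (fun xi => dmul xi * a xi)%C A.
Proof.
  apply hb_dom1. intros xi. rewrite Cmod_mult, Cmod_dmul, wt_plus.
  pose proof (abs_le_wt1 xi). pose proof (wt_pos s xi). pose proof (Cmod_ge_0 (a xi)).
  rewrite Rmult_assoc. apply Rmult_le_compat_l; [lra|]. apply Rmult_le_compat_r; auto.
Qed.

Lemma hb_dmul_pow n s a A : hb (s + INR n) a A -> hb s (fun xi => dmul xi ^ n * a xi)%C A.
Proof.
  revert s. induction n as [|n IH]; intros s H.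
  - apply hb_ext with a; [intros; simpl; ring|]. simpl in H. rewrite Rplus_0_r in H. auto.
  - apply hb_ext with (fun xi => dmul xi * (dmul xi ^ n * a xi))%C; [intros; rewrite Cpow_S; ring|].
    apply hb_dmul. apply IH. rewrite S_INR in H. replace (s + 1 + INR n) with (s + (INR n + 1)) by ring. auto.
Qed.

(** Hermitian symmetry, the Fourier side of being real valued. *)
Lemma fourier_real f xi :
  cts f -> (forall x, Cconj (f x) = f x) -> fourier f (- xi) = Cconj (fourier f xi).
Proof.
  intros Hf Hr. rewrite <- (fourier_ext _ f (- xi) Hr), fourier_conj by auto.
  f_equal. f_equal. lia.
Qed.

(** The transport term loses no derivative: antisymmetrising in the two
    frequencies replaces the derivative on [e] by a commutator. *)
Lemma transport_energy s :
  3 / 2 < s -> exists C0, 0 <= C0 /\ forall W e A E K,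
    cts W -> (forall x, Cconj (W x) = W x) -> hb s (fourier W) A -> hb s e E ->
    Rabs (rsum (fun xi => wt s xi ^ 2 *
       Re (fourier (fun x => W x * tp K (fun z => dmul z * e z) x) xi * Cconj (e xi))%C) (zr K))
    <= C0 * A * E ^ 2.
Proof.
  intros Hs'. destruct (l1_embed (s - 1) ltac:(lra)) as [C1 [H1 HC]].
  set (C2 := (2 + 2 * s) * Rpower 2 s).
  assert (HC2 : 0 <= C2) by (apply Rmult_le_pos; [lra|left; apply Rpower_pos]).
  exists (C2 * (3 * C1)). split; [apply Rmult_le_pos; lra|].
  intros W e A E K HW Wr HA HE. pose proof (hb_pos _ _ _ HA). pose proof (hb_pos _ _ _ HE).
  set (T := fun x z => wt s x ^ 2 * Re (fourier W (x - z) * (dmul z * e z) * Cconj (e x))%C).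
  assert (E1 : rsum (fun xi => wt s xi ^ 2 *
       Re (fourier (fun x => W x * tp K (fun z => dmul z * e z) x) xi * Cconj (e xi))%C) (zr K)
     = rsum (fun x => rsum (T x) (zr K)) (zr K)).
  { apply rsum_ext. intros x _. unfold T. rewrite rsum_scal. f_equal.
    rewrite fourier_mult_tp, <- csum_Re by auto. f_equal.
    rewrite Cmult_comm, <- csum_scal. apply csum_ext. intros; ring. }
  rewrite E1. set (X := rsum (fun x => rsum (T x) (zr K)) (zr K)).
  assert (E2 : 2 * X = rsum (fun x => rsum (fun z => T x z + T z x) (zr K)) (zr K)).
  { rewrite (rsum_ext (fun x => rsum (fun z => T x z + T z x) (zr K))
      (fun x => rsum (T x) (zr K) + rsum (fun z => T z x) (zr K)))
      by (intros; apply rsum_plus).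
    rewrite rsum_plus. fold X. rewrite <- (rsum_swap T). fold X. ring. }
  set (a := fun x => Cmod (fourier W x)). set (m := fun x => Cmod (e x)).
  assert (E3 : forall x z, Rabs (T x z + T z x) <=
    C2 * (wt 1 (x - z) * a (x - z)%Z * (wt s z * m z) * (wt s x * m x)
        + wt s (x - z) * a (x - z)%Z * (wt 1 z * m z) * (wt s x * m x)
        + wt s (x - z) * a (x - z)%Z * (wt s z * m z) * (wt 1 x * m x))).
  { intros x z.
    assert (R1 : T x z + T z x = Re (Ci * RtoC (wt s x ^ 2 * IZR z - wt s z ^ 2 * IZR x) *
        (fourier W (x - z) * (e z * Cconj (e x))))%C).
    { unfold T. replace (z - x)%Z with (- (x - z))%Z by lia.
      rewrite (fourier_real W (x - z) HW Wr). unfold dmul.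
      destruct (fourier W (x - z)) as [w1 w2], (e x) as [p q], (e z) as [r t].
      unfold Ci, RtoC, Cmult, Cconj, Re. cbn [fst snd]. ring. }
    rewrite R1. eapply Rle_trans; [apply re_le_Cmod|].
    rewrite !Cmod_mult, Cmod_Ci, Cmod_conj, Cmod_R, Rmult_1_l.
    change (Cmod (fourier W (x - z))) with (a (x - z)%Z).
    change (Cmod (e z)) with (m z). change (Cmod (e x)) with (m x).
    assert (P : 0 <= a (x - z)%Z * (m z * m x)).
    { repeat apply Rmult_le_pos; apply Cmod_ge_0. }
    eapply Rle_trans; [apply Rmult_le_compat_r; [exact P|apply commutator_symbol; lra]|].
    fold C2. right. ring. }
  set (Y := fun (p q r : Z -> R) => rsum (fun x => rsum (fun z => p (x - z)%Z * q z * r x) (zr K)) (zr K)).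
  assert (HX : 2 * Rabs X <= C2 * (Y (fun x => wt 1 x * a x) (fun z => wt s z * m z) (fun x => wt s x * m x)
      + Y (fun x => wt s x * a x) (fun z => wt 1 z * m z) (fun x => wt s x * m x)
      + Y (fun x => wt s x * a x) (fun z => wt s z * m z) (fun x => wt 1 x * m x))).
  { rewrite <- (Rabs_pos_eq 2) at 1 by lra. rewrite <- Rabs_mult, E2.
    eapply Rle_trans; [apply rsum_Rabs|].
    unfold Y. rewrite <- !rsum_plus, <- rsum_scal. apply rsum_le. intros x _.
    eapply Rle_trans; [apply rsum_Rabs|].
    rewrite <- !rsum_plus, <- rsum_scal. apply rsum_le. intros z _. apply E3. }
  assert (L1 : forall b B, hb s b B -> forall l, NoDup l -> rsum (fun x => wt 1 x * Cmod (b x)) l <= C1 * B).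
  { intros b B Hb l Hl.
    rewrite (rsum_ext _ (fun x => Cmod (RtoC (wt 1 x) * b x)%C)).
    - apply HC; auto. apply hb_dom1 with s b; auto. intros x.
      rewrite Cmod_mult, Cmod_R, Rabs_pos_eq by (left; apply wt_pos).
      rewrite <- Rmult_assoc, <- wt_plus. replace (s - 1 + 1) with s by ring. lra.
    - intros x _. rewrite Cmod_mult, Cmod_R, Rabs_pos_eq by (left; apply wt_pos). auto. }
  pose proof (NoDup_zr K) as ND.
  assert (N0 : forall t b x, 0 <= wt t x * Cmod (b x))
    by (intros; apply Rmult_le_pos; [left; apply wt_pos|apply Cmod_ge_0]).
  assert (Y1 : Y (fun x => wt 1 x * a x) (fun z => wt s z * m z) (fun x => wt s x * m x) <= (C1 * A) * E * E).
  { apply (trilinear_l1_diff (fun x => wt 1 x * a x) (fun z => wt s z * m z) (fun x => wt s x * m x)); auto.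
    - intros x. apply N0.
    - nra.
    - intros l Hl. apply L1; auto.
    - apply hb_sq_sum; auto.
    - apply hb_sq_sum; auto. }
  assert (Y2 : Y (fun x => wt s x * a x) (fun z => wt 1 z * m z) (fun x => wt s x * m x) <= A * (C1 * E) * E).
  { apply (trilinear_l1_right (fun x => wt s x * a x) (fun z => wt 1 z * m z) (fun x => wt s x * m x)); auto.
    - intros x. apply N0.
    - nra.
    - intros l Hl. apply hb_sq_sum; auto.
    - apply L1; auto.
    - apply hb_sq_sum; auto. }
  assert (Y3 : Y (fun x => wt s x * a x) (fun z => wt s z * m z) (fun x => wt 1 x * m x) <= A * E * (C1 * E)).
  { apply (trilinear_l1_left (fun x => wt s x * a x) (fun z => wt s z * m z) (fun x => wt 1 x * m x)); auto.
    - intros x. apply N0.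
    - nra.
    - intros l Hl. apply hb_sq_sum; auto.
    - apply hb_sq_sum; auto.
    - apply L1; auto. }
  assert (2 * Rabs X <= C2 * (3 * (C1 * A * E * E))).
  { eapply Rle_trans; [exact HX|]. apply Rmult_le_compat_l; auto. lra. }
  assert (0 <= C2 * (C1 * A * E * E)) by (apply Rmult_le_pos; [exact HC2|]; repeat apply Rmult_le_pos; lra).
  replace (C2 * (3 * C1) * A * E ^ 2) with (3 * (C2 * (C1 * A * E * E))) by ring.
  pose proof (Rabs_pos X). lra.
Qed.

Lemma weighted_pair s a b A B l :
  NoDup l -> hb s a A -> hb s b B ->
  Rabs (rsum (fun xi => wt s xi ^ 2 * Re (a xi * Cconj (b xi))%C) l) <= A * B.
Proof.
  intros Hl Ha Hb. eapply Rle_trans; [apply rsum_Rabs|].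
  apply Rle_trans with (rsum (fun xi => (wt s xi * Cmod (a xi)) * (wt s xi * Cmod (b xi))) l).
  - apply rsum_le. intros xi _. rewrite Rabs_mult, Rabs_pos_eq by apply pow2_ge_0.
    replace (wt s xi * Cmod (a xi) * (wt s xi * Cmod (b xi))) with
      (wt s xi ^ 2 * (Cmod (a xi) * Cmod (b xi))) by ring.
    apply Rmult_le_compat_l; [apply pow2_ge_0|].
    eapply Rle_trans; [apply re_le_Cmod|]. rewrite Cmod_mult, Cmod_conj. lra.
  - apply rsum_CS; try apply (hb_sq_sum s); auto; eapply hb_pos; eauto.
Qed.

(** Stability of the flux difference: only the smoother of the two functions
    is charged with an extra derivative. *)
Lemma flux_stability s k R B :
  3 / 2 < s -> (1 <= k)%nat -> 0 <= R -> 0 <= B ->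
  exists C0, 0 <= C0 /\ forall K cv cH E,
    Hs s (tp K cH) R -> Hs (s + 1) (tp K cv) B -> (forall x, Cconj (tp K cH x) = tp K cH x) ->
    Hs s (fun x => tp K cv x - tp K cH x)%C E ->
    Rabs (rsum (fun xi => wt s xi ^ 2 * Re (dmul xi *
       (fourier (fun x => tp K cv x ^ k)%C xi - fourier (fun x => tp K cH x ^ k)%C xi) *
       Cconj (fourier (fun x => tp K cv x - tp K cH x)%C xi))%C) (zr K)) <= C0 * E ^ 2.
Proof.
  intros Hs' Hk HR HB. destruct k as [|k]; [lia|].
  destruct (transport_energy s Hs') as [C1 [H1 HT]].
  destruct (Hs_pow_bound s ltac:(lra)) as [C2 [H2 HP]].
  destruct (algebra s ltac:(lra)) as [C3 [H3 HA]].
  destruct (Hs_pow_diff s k (R + B) ltac:(lra) ltac:(lra)) as [D [HD HPD]].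
  set (n := INR (S k)). assert (Hn : 0 <= n) by apply pos_INR.
  assert (HR2 : 0 <= (C2 * R) ^ k) by (apply pow_le; nra).
  exists (n * (C1 * (C2 * R) ^ k + C3 * D * B)).
  split. { apply Rmult_le_pos; auto. apply Rplus_le_le_0_compat; repeat apply Rmult_le_pos; lra. }
  intros K cv cH E HH Hv Hr HE. pose proof (Hs_pos _ _ _ HE) as HE0.
  set (v := tp K cv) in *. set (H := tp K cH) in *.
  set (e := fourier (fun x => v x - H x)%C) in *.
  set (v' := tp K (fun xi => dmul xi * cv xi)%C). set (H' := tp K (fun xi => dmul xi * cH xi)%C).
  assert (Cv' : cts v') by apply cts_tp. assert (CH' : cts H') by apply cts_tp.
  assert (Cv : cts v) by apply cts_tp. assert (CH : cts H) by apply cts_tp.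
  assert (Dv : forall xi, (dmul xi * fourier (fun x => v x ^ S k)%C xi)%C =
      (RtoC n * fourier (fun x => v x ^ k * v' x)%C xi)%C).
  { intros xi. rewrite <- (fourier_deriv _ (fun x => RtoC n * (v x ^ k * v' x))%C).
    - apply fourier_scal. apply cts_mult; auto. apply pc_cts, pc_pow, pc_tp.
    - apply pc_pow, pc_tp.
    - apply dC_pow, dC_tp.
    - apply cts_mult; [apply cts_const|]. apply cts_mult; auto. apply pc_cts, pc_pow, pc_tp. }
  assert (DH : forall xi, (dmul xi * fourier (fun x => H x ^ S k)%C xi)%C =
      (RtoC n * fourier (fun x => H x ^ k * H' x)%C xi)%C).
  { intros xi. rewrite <- (fourier_deriv _ (fun x => RtoC n * (H x ^ k * H' x))%C).
    - apply fourier_scal. apply cts_mult; auto. apply pc_cts, pc_pow, pc_tp.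
    - apply pc_pow, pc_tp.
    - apply dC_pow, dC_tp.
    - apply cts_mult; [apply cts_const|]. apply cts_mult; auto. apply pc_cts, pc_pow, pc_tp. }
  set (F1 := fourier (fun x => H x ^ k * tp K (fun z => dmul z * e z) x)%C).
  set (F2 := fourier (fun x => (v x ^ k - H x ^ k) * v' x)%C).
  assert (Ev : forall x, tp K (fun z => dmul z * e z)%C x = (v' x - H' x)%C).
  { intros x. unfold v', H'.
    replace (tp K (fun xi => dmul xi * cv xi)%C x - tp K (fun xi => dmul xi * cH xi)%C x)%C with
      (tp K (fun xi => dmul xi * cv xi)%C x + (- RtoC 1) * tp K (fun xi => dmul xi * cH xi)%C x)%C by ring.
    rewrite <- tp_scal, <- tp_plus. apply tp_ext. intros xi Hxi. unfold e.
    rewrite fourier_minus by auto. unfold v, H. rewrite !fourier_tp_in by auto. ring. }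
  assert (Pk : cts (fun x => H x ^ k)%C) by (apply pc_cts, pc_pow, pc_tp).
  assert (Pk' : cts (fun x => v x ^ k)%C) by (apply pc_cts, pc_pow, pc_tp).
  assert (Split : forall xi, (dmul xi * (fourier (fun x => v x ^ S k)%C xi - fourier (fun x => H x ^ S k)%C xi))%C
      = (RtoC n * F1 xi + RtoC n * F2 xi)%C).
  { intros xi.
    replace (dmul xi * (fourier (fun x => v x ^ S k)%C xi - fourier (fun x => H x ^ S k)%C xi))%C with
      (dmul xi * fourier (fun x => v x ^ S k)%C xi - dmul xi * fourier (fun x => H x ^ S k)%C xi)%C by ring.
    rewrite Dv, DH.
    assert (EE : (fourier (fun x => v x ^ k * v' x)%C xi - fourier (fun x => H x ^ k * H' x)%C xi)%C
      = (F1 xi + F2 xi)%C).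
    { unfold F1, F2. rewrite <- fourier_minus by (apply cts_mult; auto).
      rewrite <- fourier_plus.
      - apply fourier_ext. intros x. rewrite Ev. ring.
      - apply cts_mult; auto. apply cts_tp.
      - apply cts_mult; auto. apply pc_cts, pc_minus; apply pc_pow, pc_tp. }
    replace (RtoC n * F1 xi + RtoC n * F2 xi)%C with (RtoC n * (F1 xi + F2 xi))%C by ring.
    rewrite <- EE. ring. }
  assert (He : hb s e E) by apply HE.
  assert (B1 : Rabs (rsum (fun xi => wt s xi ^ 2 * Re (F1 xi * Cconj (e xi))%C) (zr K)) <= C1 * (C2 * R) ^ k * E ^ 2).
  { apply HT; auto.
    - intros x. rewrite Cpow_conj. rewrite Hr. auto.
    - apply (HP k H R HH). }
  assert (Hv0 : Hs s v B) by (apply Hs_mono with (s + 1); auto; lra).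
  assert (Hv' : Hs s v' B).
  { split; [apply pc_tp|]. apply hb_ext with (fun xi => dmul xi * fourier v xi)%C.
    - intros xi. symmetry. apply fourier_deriv; auto; [apply pc_tp|apply dC_tp].
    - apply hb_dmul. apply Hv. }
  assert (B2 : Rabs (rsum (fun xi => wt s xi ^ 2 * Re (F2 xi * Cconj (e xi))%C) (zr K)) <= C3 * (D * E) * B * E).
  { apply weighted_pair; auto; [apply NoDup_zr|].
    apply (HA (fun x => v x ^ k - H x ^ k)%C v' (D * E) B); auto.
    apply HPD; auto; [apply Hs_le with B|apply Hs_le with R]; auto; lra. }
  rewrite (rsum_ext _ (fun xi => n * (wt s xi ^ 2 * Re (F1 xi * Cconj (e xi))%C) +
     n * (wt s xi ^ 2 * Re (F2 xi * Cconj (e xi))%C))).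
  2:{ intros xi _. rewrite Split.
      replace ((RtoC n * F1 xi + RtoC n * F2 xi) * Cconj (e xi))%C with
        (RtoC n * (F1 xi * Cconj (e xi)) + RtoC n * (F2 xi * Cconj (e xi)))%C by ring.
      rewrite re_plus, !re_scal_l. ring. }
  rewrite rsum_plus, !rsum_scal. eapply Rle_trans; [apply Rabs_triang|].
  rewrite !Rabs_mult, (Rabs_pos_eq n) by auto.
  replace (n * (C1 * (C2 * R) ^ k + C3 * D * B) * E ^ 2) with
    (n * (C1 * (C2 * R) ^ k * E ^ 2) + n * (C3 * (D * E) * B * E)) by ring.
  apply Rplus_le_compat; apply Rmult_le_compat_l; auto.
Qed.

(** * Time regularity of Fourier coefficients *)

Lemma MVT_bound (f f' : R -> R) a b L :
  (forall t, a < t < b -> is_derive f t (f' t)) -> (forall t, a < t < b -> Rabs (f' t) <= L) ->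
  forall x y, a < x < b -> a < y < b -> Rabs (f y - f x) <= L * Rabs (y - x).
Proof.
  intros Hd HL x y Hx Hy.
  assert (Hin : forall z, Rmin x y <= z <= Rmax x y -> a < z < b).
  { intros z [Hz1 Hz2]. split.
    - eapply Rlt_le_trans; [|exact Hz1]. apply Rmin_glb_lt; lra.
    - eapply Rle_lt_trans; [exact Hz2|]. apply Rmax_lub_lt; lra. }
  destruct (MVT_gen f x y f') as [c [Hc E]].
  - intros z Hz. apply Hd, Hin. lra.
  - intros z Hz. apply derivable_continuous_pt. exists (f' z). apply is_derive_Reals, Hd, Hin; auto.
  - rewrite E, Rabs_mult. apply Rmult_le_compat_r; [apply Rabs_pos|]. apply HL, Hin; auto.
Qed.

Lemma is_derive_of_quadratic (f : R -> R) t l d b :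
  0 < d -> (forall y, Rabs (y - t) < d -> Rabs (f y - f t - (y - t) * l) <= b * (y - t) ^ 2) ->
  is_derive f t l.
Proof.
  intros Hd H. apply is_derive_Reals. intros e He.
  assert (Hb : 0 < Rabs b + 1) by (pose proof (Rabs_pos b); lra).
  assert (Hp : 0 < Rmin d (e / (Rabs b + 1))).
  { apply Rmin_glb_lt; auto. apply Rdiv_lt_0_compat; auto. }
  exists (mkposreal _ Hp). intros h Hh Hlt. simpl in Hlt.
  assert (L1 : Rabs h < d) by (eapply Rlt_le_trans; [exact Hlt|apply Rmin_l]).
  assert (L2 : Rabs h < e / (Rabs b + 1)) by (eapply Rlt_le_trans; [exact Hlt|apply Rmin_r]).
  specialize (H (t + h)). replace (t + h - t) with h in H by ring. specialize (H L1).
  replace ((f (t + h) - f t) / h - l) with ((f (t + h) - f t - h * l) * / h) by (field; auto).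
  rewrite Rabs_mult, Rabs_inv. assert (Hh' : 0 < Rabs h) by (apply Rabs_pos_lt; auto).
  apply Rle_lt_trans with ((Rabs b + 1) * Rabs h).
  - apply Rmult_le_reg_r with (Rabs h); auto. rewrite Rmult_assoc, Rinv_l by lra.
    rewrite Rmult_1_r. eapply Rle_trans; [exact H|]. rewrite <- (pow2_abs h).
    pose proof (Rle_abs b). assert (0 <= Rabs h ^ 2) by apply pow2_ge_0. nra.
  - apply (Rmult_lt_compat_l (Rabs b + 1)) in L2; auto.
    replace ((Rabs b + 1) * (e / (Rabs b + 1))) with e in L2 by (field; lra). auto.
Qed.

Lemma Taylor_quadratic (f f' : R -> R) a b L :
  0 <= L ->
  (forall t, a < t < b -> is_derive f t (f' t)) ->
  (forall t t', a < t < b -> a < t' < b -> Rabs (f' t - f' t') <= L * Rabs (t - t')) ->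
  forall x y, a < x < b -> a < y < b -> Rabs (f y - f x - (y - x) * f' x) <= L * (y - x) ^ 2.
Proof.
  intros HL0 Hd HL x y Hx Hy.
  assert (Hin : forall z, Rmin x y <= z <= Rmax x y -> a < z < b).
  { intros z [Hz1 Hz2]. split.
    - eapply Rlt_le_trans; [|exact Hz1]. apply Rmin_glb_lt; lra.
    - eapply Rle_lt_trans; [exact Hz2|]. apply Rmax_lub_lt; lra. }
  destruct (MVT_gen f x y f') as [c [Hc E]].
  - intros z Hz. apply Hd, Hin. lra.
  - intros z Hz. apply derivable_continuous_pt. exists (f' z). apply is_derive_Reals, Hd, Hin; auto.
  - rewrite E. replace (f' c * (y - x) - (y - x) * f' x) with ((f' c - f' x) * (y - x)) by ring.
    rewrite Rabs_mult. specialize (HL c x (Hin c Hc) Hx).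
    assert (Hcx : Rabs (c - x) <= Rabs (y - x)).
    { unfold Rmin, Rmax in Hc. destruct (Rle_dec x y).
      - rewrite !Rabs_pos_eq; lra.
      - rewrite !Rabs_left1; lra. }
    rewrite <- (pow2_abs (y - x)). pose proof (Rabs_pos (y - x)).
    assert (L * Rabs (c - x) <= L * Rabs (y - x)) by (apply Rmult_le_compat_l; auto).
    replace (L * Rabs (y - x) ^ 2) with (L * Rabs (y - x) * Rabs (y - x)) by ring.
    apply Rmult_le_compat_r; lra.
Qed.

(** Taylor expansion with a step of length T / 4 pointing towards the farther end
    of the interval. *)
Lemma Landau_inequality (f f' f'' : R -> R) T A :
  0 < T -> (forall t, 0 < t < T -> is_derive f t (f' t)) ->
  (forall t, 0 < t < T -> is_derive f' t (f'' t)) ->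
  (forall t, 0 < t < T -> Rabs (f t) <= A) -> (forall t, 0 < t < T -> Rabs (f'' t) <= A) ->
  forall t, 0 < t < T -> Rabs (f' t) <= (8 / T + T) * A.
Proof.
  intros HT Hd Hd' HA HA' t Ht.
  assert (A0 : 0 <= A) by (eapply Rle_trans; [apply Rabs_pos|apply (HA t Ht)]).
  pose proof (Taylor_quadratic f f' 0 T A A0 Hd
    (fun x y Hx Hy => MVT_bound f' f'' 0 T A Hd' HA' y x Hy Hx) t) as Q.
  assert (K : forall h, Rabs h = T / 4 -> 0 < t + h < T -> Rabs (f' t) <= (8 / T + T) * A).
  { intros h Hh Hth. specialize (Q (t + h) Ht Hth). replace (t + h - t) with h in Q by ring.
    pose proof (HA t Ht). pose proof (HA (t + h) Hth).
    assert (E : Rabs (h * f' t) <= 2 * A + A * (T / 4) ^ 2).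
    { replace (h * f' t) with ((f (t + h) - f t) - (f (t + h) - f t - h * f' t)) by ring.
      eapply Rle_trans; [apply Rabs_triang|]. rewrite Rabs_Ropp.
      pose proof (Rabs_triang (f (t + h)) (- f t)). rewrite Rabs_Ropp in H1.
      change (f (t + h) + - f t) with (f (t + h) - f t) in H1.
      rewrite <- (pow2_abs h), Hh in Q. lra. }
    rewrite Rabs_mult, Hh in E.
    apply Rmult_le_reg_l with (T / 4); [lra|]. eapply Rle_trans; [exact E|].
    replace (T / 4 * ((8 / T + T) * A)) with (2 * A + A * (T ^ 2 / 4)) by (field; lra).
    assert (0 <= T ^ 2) by apply pow2_ge_0. apply Rplus_le_compat_l. apply Rmult_le_compat_l; auto.
    lra. }
  destruct (Rle_or_lt t (T / 2)).
  - apply (K (T / 4)); [apply Rabs_pos_eq|]; lra.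
  - apply (K (- (T / 4))); [rewrite Rabs_Ropp; apply Rabs_pos_eq|]; lra.
Qed.

(** Centred at the midpoint, the quadrature error as a function of the half length
    y has derivative - y (g' (c + y) - g' (c - y)), which is quadratically small. *)
Lemma trapezoid (f g g' g'' : R -> R) a b L :
  0 <= L ->
  (forall t, a < t < b -> is_derive f t (g t)) -> (forall t, a < t < b -> is_derive g t (g' t)) ->
  (forall t, a < t < b -> is_derive g' t (g'' t)) -> (forall t, a < t < b -> Rabs (g'' t) <= L) ->
  forall t h, a < t -> 0 < h -> t + h < b ->
  Rabs (f (t + h) - f t - h / 2 * (g t + g (t + h))) <= L * h ^ 3.
Proof.
  intros L0 Hf Hg Hg' HL t h Ht Hh Hth. set (c := t + h / 2).
  set (phi := fun y => f (c + y) - f (c - y) - y * (g (c + y) + g (c - y))).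
  assert (D : forall y, 0 <= y <= h / 2 -> is_derive phi y (- y * (g' (c + y) - g' (c - y)))).
  { intros y Hy. unfold phi.
    assert (I1 : a < c + y < b) by (unfold c; lra). assert (I2 : a < c - y < b) by (unfold c; lra).
    pose proof (Hf _ I1) as F1. pose proof (Hf _ I2) as F2.
    pose proof (Hg _ I1) as G1. pose proof (Hg _ I2) as G2.
    auto_derive.
    - repeat split; eexists; eassumption.
    - apply is_derive_unique in F1, F2, G1, G2.
      change (Derive (fun x => f x) (c + y)) with (Derive f (c + y)).
      change (Derive (fun x => g x) (c + y)) with (Derive g (c + y)).
      change (c + - y) with (c - y).
      change (Derive (fun x => f x) (c - y)) with (Derive f (c - y)).
      change (Derive (fun x => g x) (c - y)) with (Derive g (c - y)).
      rewrite F1, F2, G1, G2. ring. }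
  destruct (MVT_gen phi 0 (h / 2) (fun y => - y * (g' (c + y) - g' (c - y)))) as [z [Hz E]].
  - rewrite Rmin_left, Rmax_right by lra. intros y Hy. apply D; lra.
  - rewrite Rmin_left, Rmax_right by lra. intros y Hy.
    apply derivable_continuous_pt. eexists. apply is_derive_Reals, D; lra.
  - rewrite Rmin_left, Rmax_right in Hz by lra.
    assert (E0 : phi 0 = 0) by (unfold phi; rewrite Rplus_0_r, Rminus_0_r; ring).
    assert (E1 : phi (h / 2) = f (t + h) - f t - h / 2 * (g t + g (t + h))).
    { unfold phi, c. replace (t + h / 2 + h / 2) with (t + h) by field.
      replace (t + h / 2 - h / 2) with t by field. ring. }
    rewrite <- E1. replace (phi (h / 2)) with (phi (h / 2) - phi 0) by (rewrite E0; ring).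
    rewrite E, !Rabs_mult, Rabs_Ropp.
    rewrite (Rabs_pos_eq z), (Rabs_pos_eq (h / 2 - 0)) by lra.
    assert (B : Rabs (g' (c + z) - g' (c - z)) <= L * h).
    { eapply Rle_trans; [apply (MVT_bound g' g'' a b L Hg' HL); unfold c; lra|].
      apply Rmult_le_compat_l; auto. rewrite Rabs_pos_eq; lra. }
    pose proof (Rabs_pos (g' (c + z) - g' (c - z))).
    assert (z * Rabs (g' (c + z) - g' (c - z)) <= h * (L * h)) by (apply Rmult_le_compat; lra).
    assert (0 <= z * Rabs (g' (c + z) - g' (c - z))) by (apply Rmult_le_pos; lra).
    assert (z * Rabs (g' (c + z) - g' (c - z)) * (h / 2 - 0) <= h * (L * h) * h)
      by (apply Rmult_le_compat; lra).
    lra.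
Qed.

Definition pcR (g : R -> R) : Prop := periodic g /\ forall x, continuous g x.

Definition cpx (g : R -> R) (x : R) : C := RtoC (g x).

Lemma pc_cpx g : pcR g -> pc (cpx g).
Proof. intros [P Q]. apply pc_RtoC; auto. Qed.

Lemma pcR_of_pc g : pc (cpx g) -> pcR g.
Proof.
  intros [P Q]. split.
  - intros x. specialize (P x). unfold cpx in P. apply RtoC_inj in P. auto.
  - intros x. apply (cts_Re _ Q).
Qed.

(** The Lipschitz bound on [G'] makes the difference quotients of [G] in time
    converge uniformly in x, which is what differentiation under the integral
    sign of the Fourier coefficients requires. The class is closed under
    products. *)
Record C1L (T b : R) (G G' : R -> R -> R) : Prop := {
  C1L_pc : forall t, 0 < t < T -> pcR (G t);
  C1L_d : forall t x, 0 < t < T -> is_derive (fun s => G s x) t (G' t x);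
  C1L_b : forall t x, 0 < t < T -> Rabs (G t x) <= b;
  C1L_b' : forall t x, 0 < t < T -> Rabs (G' t x) <= b;
  C1L_lip : forall t t' x, 0 < t < T -> 0 < t' < T -> Rabs (G' t x - G' t' x) <= b * Rabs (t - t')
}.

Lemma C1L_pos T b G G' : 0 < T -> C1L T b G G' -> 0 <= b.
Proof. intros HT H. eapply Rle_trans; [apply Rabs_pos|apply (C1L_b _ _ _ _ H (T / 2) 0); lra]. Qed.

Lemma C1L_quad T b G G' :
  0 < T -> C1L T b G G' -> forall x t y, 0 < t < T -> 0 < y < T ->
  Rabs (G y x - G t x - (y - t) * G' t x) <= b * (y - t) ^ 2.
Proof.
  intros HT H x t y Ht Hy.
  apply (Taylor_quadratic (fun s => G s x) (fun s => G' s x) 0 T b); auto.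
  - eapply C1L_pos; eauto.
  - intros; apply (C1L_d _ _ _ _ H); auto.
  - intros; apply (C1L_lip _ _ _ _ H); auto.
Qed.

Lemma pcR_mult f g : pcR f -> pcR g -> pcR (fun x => f x * g x).
Proof.
  intros [P1 C1] [P2 C2]. split; [intros x; rewrite P1, P2; auto|].
  intros x. apply (continuous_mult (K := R_AbsRing)); auto.
Qed.

Lemma pcR_const c : pcR (fun _ => c).
Proof. split; [intros x; auto|intros x; apply continuous_const]. Qed.

Lemma C1L_const T b c : Rabs c <= b -> C1L T b (fun _ _ => c) (fun _ _ => 0).
Proof.
  intros H. pose proof (Rabs_pos c). split; intros.
  - apply pcR_const.
  - apply (is_derive_const (V := R_NormedModule)).
  - auto.
  - rewrite Rabs_R0. lra.
  - rewrite Rminus_0_r, Rabs_R0. apply Rmult_le_pos; [lra|apply Rabs_pos].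
Qed.

Lemma C1L_lip0 T b G G' : C1L T b G G' ->
  forall t t' x, 0 < t < T -> 0 < t' < T -> Rabs (G t x - G t' x) <= b * Rabs (t - t').
Proof.
  intros H t t' x Ht Ht'.
  apply (MVT_bound (fun s => G s x) (fun s => G' s x) 0 T b); auto.
  - intros; apply (C1L_d _ _ _ _ H); auto.
  - intros; apply (C1L_b' _ _ _ _ H); auto.
Qed.

Lemma C1L_mult T b c F F' G G' :
  0 < T -> C1L T b F F' -> C1L T c G G' ->
  C1L T (4 * b * c) (fun t x => F t x * G t x) (fun t x => F' t x * G t x + F t x * G' t x).
Proof.
  intros HT HF HG. pose proof (C1L_pos _ _ _ _ HT HF) as Hb. pose proof (C1L_pos _ _ _ _ HT HG) as Hc.
  assert (bc : 0 <= b * c) by nra.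
  split.
  - intros t Ht. apply pcR_mult; [apply (C1L_pc _ _ _ _ HF)|apply (C1L_pc _ _ _ _ HG)]; auto.
  - intros t x Ht.
    pose proof (is_derive_mult (fun s => F s x) (fun s => G s x) t (F' t x) (G' t x)
      (C1L_d _ _ _ _ HF t x Ht) (C1L_d _ _ _ _ HG t x Ht) Rmult_comm) as H. exact H.
  - intros t x Ht. rewrite Rabs_mult.
    pose proof (C1L_b _ _ _ _ HF t x Ht). pose proof (C1L_b _ _ _ _ HG t x Ht).
    assert (Rabs (F t x) * Rabs (G t x) <= b * c) by (apply Rmult_le_compat; auto; apply Rabs_pos). lra.
  - intros t x Ht. eapply Rle_trans; [apply Rabs_triang|]. rewrite !Rabs_mult.
    pose proof (C1L_b _ _ _ _ HF t x Ht). pose proof (C1L_b _ _ _ _ HG t x Ht).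
    pose proof (C1L_b' _ _ _ _ HF t x Ht). pose proof (C1L_b' _ _ _ _ HG t x Ht).
    assert (Rabs (F' t x) * Rabs (G t x) <= b * c) by (apply Rmult_le_compat; auto; apply Rabs_pos).
    assert (Rabs (F t x) * Rabs (G' t x) <= b * c) by (apply Rmult_le_compat; auto; apply Rabs_pos). lra.
  - intros t t' x Ht Ht'.
    pose proof (C1L_b _ _ _ _ HF t' x Ht'). pose proof (C1L_b _ _ _ _ HG t x Ht).
    pose proof (C1L_b' _ _ _ _ HF t' x Ht'). pose proof (C1L_b' _ _ _ _ HG t x Ht).
    pose proof (C1L_lip _ _ _ _ HF t t' x Ht Ht'). pose proof (C1L_lip _ _ _ _ HG t t' x Ht Ht').
    pose proof (C1L_lip0 _ _ _ _ HF t t' x Ht Ht'). pose proof (C1L_lip0 _ _ _ _ HG t t' x Ht Ht').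
    set (D := Rabs (t - t')) in *. assert (HD : 0 <= D) by apply Rabs_pos.
    replace (F' t x * G t x + F t x * G' t x - (F' t' x * G t' x + F t' x * G' t' x)) with
      ((F' t x - F' t' x) * G t x + F' t' x * (G t x - G t' x)
       + ((F t x - F t' x) * G' t x + F t' x * (G' t x - G' t' x))) by ring.
    assert (M : forall p q r s, Rabs p <= r -> Rabs q <= s -> Rabs (p * q) <= r * s).
    { intros p q r s P Q. rewrite Rabs_mult. apply Rmult_le_compat; auto; apply Rabs_pos. }
    eapply Rle_trans; [apply Rabs_triang|].
    eapply Rle_trans; [apply Rplus_le_compat; apply Rabs_triang|].
    pose proof (M (F' t x - F' t' x) (G t x) (b * D) c ltac:(auto) ltac:(auto)).
    pose proof (M (F' t' x) (G t x - G t' x) b (c * D) ltac:(auto) ltac:(auto)).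
    pose proof (M (F t x - F t' x) (G' t x) (b * D) c ltac:(auto) ltac:(auto)).
    pose proof (M (F t' x) (G' t x - G' t' x) b (c * D) ltac:(auto) ltac:(auto)). lra.
Qed.

Lemma C1L_ext T b F F' G G' :
  (forall t x, F t x = G t x) -> (forall t x, F' t x = G' t x) -> C1L T b F F' -> C1L T b G G'.
Proof.
  intros E E' [H1 H2 H3 H4 H5]. split; intros.
  - destruct (H1 t H) as [P Q]. split; [intros x; rewrite <- !E; apply P|].
    intros x. apply (continuous_ext (F t)); auto.
  - rewrite <- E'. apply (is_derive_ext (fun s => F s x)); auto.
  - rewrite <- E; auto.
  - rewrite <- E'; auto.
  - rewrite <- !E'; auto.
Qed.

Lemma C1L_pow T b F F' n :
  0 < T -> C1L T b F F' ->
  exists c, C1L T c (fun t x => F t x ^ S n) (fun t x => INR (S n) * (F t x ^ n * F' t x)).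
Proof.
  intros HT HF. induction n as [|n [c IH]].
  - exists b. apply (C1L_ext T b F F'); auto; intros; simpl; ring.
  - exists (4 * b * c).
    apply (C1L_ext T _ (fun t x => F t x * F t x ^ S n)
      (fun t x => F' t x * F t x ^ S n + F t x * (INR (S n) * (F t x ^ n * F' t x)))).
    + intros; reflexivity.
    + intros t x. rewrite (S_INR (S n)). simpl (F t x ^ S n). ring.
    + apply C1L_mult; auto.
Qed.

(** [G'] is a uniform limit in x of difference quotients. *)
Lemma C1L_pc' T b G G' : 0 < T -> C1L T b G G' -> forall t, 0 < t < T -> pcR (G' t).
Proof.
  intros HT H t Ht. pose proof (C1L_pos _ _ _ _ HT H) as Hb.
  apply pcR_of_pc. split.
  - intros x. unfold cpx. f_equal.
    pose proof (C1L_d _ _ _ _ H t x Ht) as D1. pose proof (C1L_d _ _ _ _ H t (x + 2 * PI) Ht) as D2.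
    apply is_derive_unique in D1, D2.
    rewrite <- D1, <- D2. apply Derive_ext_loc.
    assert (Hd : 0 < Rmin t (T - t)) by (apply Rmin_glb_lt; lra).
    exists (mkposreal _ Hd). intros y Hy.
    unfold ball in Hy; simpl in Hy; unfold AbsRing_ball, abs, minus, plus, opp in Hy; simpl in Hy.
    apply Rabs_lt_between in Hy. pose proof (Rmin_l t (T - t)). pose proof (Rmin_r t (T - t)).
    destruct (C1L_pc _ _ _ _ H y ltac:(lra)) as [P _]. apply P.
  - apply cts_of_unif. intros e He.
    set (h := Rmin (e / (b + 1)) ((T - t) / 2)).
    assert (Hh : 0 < h). { apply Rmin_glb_lt; [apply Rdiv_lt_0_compat; lra|lra]. }
    assert (Hh1 : h <= e / (b + 1)) by apply Rmin_l. assert (Hh2 : h <= (T - t) / 2) by apply Rmin_r.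
    exists (fun x => RtoC (/ h) * (cpx (G (t + h)%R) x - cpx (G t) x))%C. split.
    + apply pc_cts, pc_scal, pc_minus; apply pc_cpx, (C1L_pc _ _ _ _ H); lra.
    + intros x. unfold cpx. rewrite <- RtoC_minus, <- RtoC_mult, <- RtoC_minus, Cmod_R.
      pose proof (C1L_quad T b G G' HT H x t (t + h) Ht ltac:(lra)) as Q.
      replace (t + h - t) with h in Q by ring.
      replace (G' t x - / h * (G (t + h) x - G t x)) with (- ((G (t + h) x - G t x - h * G' t x) / h))
        by (field; lra).
      rewrite Rabs_Ropp. unfold Rdiv. rewrite Rabs_mult, (Rabs_pos_eq (/ h)) by (left; apply Rinv_0_lt_compat; lra).
      apply Rmult_le_reg_r with h; auto. rewrite Rmult_assoc, Rinv_l, Rmult_1_r by lra.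
      eapply Rle_trans; [exact Q|]. simpl. rewrite Rmult_1_r, <- Rmult_assoc.
      apply Rmult_le_compat_r; [lra|].
      apply Rle_trans with (b * (e / (b + 1))); [apply Rmult_le_compat_l; auto|].
      replace (b * (e / (b + 1))) with (e * (b / (b + 1))) by (field; lra).
      rewrite <- (Rmult_1_r e) at 2. apply Rmult_le_compat_l; [lra|].
      apply Rmult_le_reg_r with (b + 1); [lra|]. field_simplify; lra.
Qed.

(** A real function of time once [g] depends on time, so that one-variable calculus
    applies; [hb_dual] converts bounds on it into bounds on norms. *)
Definition pair_coef (v : Z -> C) (l : list Z) (g : R -> R) : R :=
  rsum (fun xi => Re (fourier (cpx g) xi * v xi)%C) l.

Lemma pair_coef_derive T b G G' v l :
  0 < T -> C1L T b G G' -> forall t, 0 < t < T ->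
  is_derive (fun s => pair_coef v l (G s)) t (pair_coef v l (G' t)).
Proof.
  intros HT H t Ht.
  set (V := rsum (fun xi => Cmod (v xi)) l).
  apply is_derive_of_quadratic with (Rmin t (T - t)) (b * V).
  { apply Rmin_glb_lt; lra. }
  intros y Hy. apply Rabs_lt_between in Hy.
  pose proof (Rmin_l t (T - t)). pose proof (Rmin_r t (T - t)).
  assert (Hy' : 0 < y < T) by lra.
  pose proof (pc_cts _ (pc_cpx _ (C1L_pc _ _ _ _ H t Ht))) as Ct.
  pose proof (pc_cts _ (pc_cpx _ (C1L_pc _ _ _ _ H y Hy'))) as Cy.
  pose proof (pc_cts _ (pc_cpx _ (C1L_pc' _ _ _ _ HT H t Ht))) as Ct'.
  assert (Cs : cts (fun x => RtoC (y - t) * cpx (G' t) x)%C) by (apply cts_mult; auto; apply cts_const).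
  set (q := fun x => (cpx (G y) x - cpx (G t) x - RtoC (y - t) * cpx (G' t) x)%C).
  assert (E : pair_coef v l (G y) - pair_coef v l (G t) - (y - t) * pair_coef v l (G' t)
    = rsum (fun xi => Re (fourier q xi * v xi)%C) l).
  { unfold pair_coef.
    replace (rsum (fun xi => Re (fourier (cpx (G y)) xi * v xi)%C) l -
       rsum (fun xi => Re (fourier (cpx (G t)) xi * v xi)%C) l -
       (y - t) * rsum (fun xi => Re (fourier (cpx (G' t)) xi * v xi)%C) l) with
     (rsum (fun xi => Re (fourier (cpx (G y)) xi * v xi)%C) l +
       (-1) * rsum (fun xi => Re (fourier (cpx (G t)) xi * v xi)%C) l +
       (-(y - t)) * rsum (fun xi => Re (fourier (cpx (G' t)) xi * v xi)%C) l) by ring.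
    rewrite <- !rsum_scal, <- !rsum_plus. apply rsum_ext. intros xi _. unfold q.
    assert (C12 : cts (fun x => cpx (G y) x - cpx (G t) x)%C) by (apply cts_plus; auto; apply cts_opp; auto).
    rewrite (fourier_minus _ _ xi C12 Cs), (fourier_minus _ _ xi Cy Ct), (fourier_scal _ _ xi Ct').
    destruct (fourier (cpx (G y)) xi), (fourier (cpx (G t)) xi), (fourier (cpx (G' t)) xi), (v xi).
    unfold Cminus, Cplus, Copp, Cmult, RtoC, Re. cbn [fst snd]. ring. }
  rewrite E. eapply Rle_trans; [apply rsum_Rabs|].
  replace (b * V * (y - t) ^ 2) with ((b * (y - t) ^ 2) * V) by ring.
  unfold V. rewrite <- rsum_scal. apply rsum_le. intros xi _.
  eapply Rle_trans; [apply re_le_Cmod|]. rewrite Cmod_mult.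
  apply Rmult_le_compat_r; [apply Cmod_ge_0|]. apply fourier_bound.
  - apply cts_plus; [apply cts_plus; auto; apply cts_opp; auto|apply cts_opp; auto].
  - intros x. unfold q, cpx. rewrite <- !RtoC_minus, <- RtoC_mult, <- RtoC_minus, Cmod_R.
    apply (C1L_quad T b G G'); auto.
Qed.

Lemma pair_coef_bound s g B v V l :
  NoDup l -> hb s (fourier (cpx g)) B -> 0 <= V ->
  rsum (fun xi => (Cmod (v xi) / wt s xi) ^ 2) l <= V ^ 2 -> Rabs (pair_coef v l g) <= B * V.
Proof.
  intros Hl Hg HV Hv. eapply Rle_trans; [apply rsum_Rabs|].
  eapply Rle_trans; [|apply (hb_pair s (fourier (cpx g)) B v V l); auto].
  apply rsum_le. intros xi _. eapply Rle_trans; [apply re_le_Cmod|]. rewrite Cmod_mult. lra.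
Qed.

(** * Consistency of the scheme along the exact solution *)

(** With its converse [in_H_of_hb], this identifies the norm defined by a two-sided
    series with the supremum of its finite partial sums. *)
Lemma hb_of_in_H s f B : Hnorm_le s f B -> Hs s f B.
Proof.
  intros [[Hp [Hc [E1 E2]]] HB]. split; [split; auto|].
  set (a := sobolev_term s f) in *.
  assert (P : forall xi, 0 <= a xi).
  { intros xi. unfold a, sobolev_term. apply Rmult_le_pos; [left; apply Rpower_pos|apply pow2_ge_0]. }
  assert (Part : forall (b : nat -> R) n, (forall i, 0 <= b i) -> ex_series b ->
     rsum b (seq 0 n) <= Series b).
  { intros b n Hb Hex. apply Rle_trans with (rsum b (seq 0 (S n))).
    - rewrite seq_S, rsum_app. simpl. specialize (Hb n). lra.
    - assert (Eq : sum_n b n = rsum b (seq 0 (S n))).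
      { clear. induction n as [|n IH]; [rewrite sum_O; simpl; ring|].
        rewrite sum_Sn, IH. rewrite (seq_S (S n)), rsum_app. unfold plus; simpl. ring. }
      rewrite <- Eq. apply (is_lim_seq_incr_compare (sum_n b)).
      + apply Series_correct; auto.
      + intros m. rewrite sum_Sn. unfold plus; simpl. specialize (Hb (S m)). lra. }
  assert (Tot : forall l, NoDup l -> rsum a l <= sum_Z a).
  { intros l Hl. destruct (incl_zr l) as [K HK].
    apply Rle_trans with (rsum a (map Z.of_nat (seq 0 (S K)) ++ map (fun j => (- Z.of_nat (S j))%Z) (seq 0 K))).
    - apply rsum_incl; auto. intros x Hx. apply HK, in_zr in Hx. apply in_or_app.
      destruct (Z_le_gt_dec 0 x).
      + left. apply in_map_iff. exists (Z.to_nat x). split; [lia|]. apply in_seq. lia.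
      + right. apply in_map_iff. exists (Z.to_nat (- x) - 1)%nat. split; [lia|]. apply in_seq. lia.
    - rewrite rsum_app, !rsum_map. unfold sum_Z. apply Rplus_le_compat.
      + apply (Part (fun n => a (Z.of_nat n))); auto.
      + apply (Part (fun n => a (- Z.of_nat (S n))%Z)); auto. }
  assert (S0 : 0 <= sum_Z a) by (apply (Tot []); constructor).
  split; [eapply Rle_trans; [apply sqrt_pos|exact HB]|]. intros l Hl.
  rewrite (rsum_ext _ a).
  - eapply Rle_trans; [apply Tot; auto|]. rewrite <- (pow2_sqrt _ S0). apply pow_incr.
    split; [apply sqrt_pos|exact HB].
  - intros xi _. rewrite Rpow_mult_distr, wt_sq. reflexivity.
Qed.

Lemma in_H_of_hb s f B : Hs s f B -> Hnorm_le s f B.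
Proof.
  intros [[Hp Hc] [HB Ha]].
  set (a := sobolev_term s f).
  assert (P : forall xi, 0 <= a xi).
  { intros xi. unfold a, sobolev_term. apply Rmult_le_pos; [left; apply Rpower_pos|apply pow2_ge_0]. }
  assert (Ha' : forall l, NoDup l -> rsum a l <= B ^ 2).
  { intros l Hl. rewrite (rsum_ext _ (fun xi => (wt s xi * Cmod (fourier f xi)) ^ 2)); auto.
    intros xi _. rewrite Rpow_mult_distr, wt_sq. reflexivity. }
  assert (Eq : forall (b : nat -> R) n, sum_n b n = rsum b (seq 0 (S n))).
  { intros b n. induction n as [|n IH]; [rewrite sum_O; simpl; ring|].
    rewrite sum_Sn, IH. rewrite (seq_S (S n)), rsum_app. unfold plus; simpl. ring. }
  assert (Ex : forall b : nat -> R, (forall i, 0 <= b i) -> (forall n, rsum b (seq 0 (S n)) <= B ^ 2) ->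
    ex_series b).
  { intros b Hb HB'. destruct (ex_finite_lim_seq_incr (sum_n b) (B ^ 2)) as [y Hy].
    - intros n. rewrite sum_Sn. unfold plus; simpl. specialize (Hb (S n)). lra.
    - intros n. rewrite Eq; auto.
    - exists y. exact Hy. }
  assert (N1 : forall n, NoDup (map Z.of_nat (seq 0 n))).
  { intros n. apply Injective_map_NoDup; [intros i j; lia|apply seq_NoDup]. }
  assert (N2 : forall n, NoDup (map (fun j => (- Z.of_nat (S j))%Z) (seq 0 n))).
  { intros n. apply Injective_map_NoDup; [intros i j; lia|apply seq_NoDup]. }
  assert (X1 : ex_series (fun n => a (Z.of_nat n))).
  { apply Ex; auto. intros n. rewrite <- (rsum_map Z.of_nat). apply Ha', N1. }
  assert (X2 : ex_series (fun n => a (- Z.of_nat (S n))%Z)).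
  { apply Ex; auto. intros n. rewrite <- (rsum_map (fun j => (- Z.of_nat (S j))%Z) a). apply Ha', N2. }
  split; [split; [auto|split; [auto|split; auto]]|].
  unfold Hnorm. fold a. rewrite <- (sqrt_pow2 B HB). apply sqrt_le_1_alt.
  assert (L : is_lim_seq (fun n => sum_n (fun n => a (Z.of_nat n)) n + sum_n (fun n => a (- Z.of_nat (S n))%Z) n) (sum_Z a)).
  { apply is_lim_seq_plus'; apply Series_correct; auto. }
  assert (Bd : forall n, sum_n (fun n => a (Z.of_nat n)) n + sum_n (fun n => a (- Z.of_nat (S n))%Z) n <= B ^ 2).
  { intros n. rewrite !Eq, <- (rsum_map Z.of_nat), <- (rsum_map (fun j => (- Z.of_nat (S j))%Z) a), <- rsum_app.
    apply Ha'. apply NoDup_app; auto. intros x H1 H2.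
    apply in_map_iff in H1. apply in_map_iff in H2. destruct H1 as [i [<- _]], H2 as [j [E _]]. lia. }
  apply (is_lim_seq_le _ _ _ _ Bd L (is_lim_seq_const _)).
Qed.

Lemma periodic_Derive (f : R -> R) : periodic f -> periodic (fun x => Derive f x).
Proof.
  intros H x. unfold Derive. f_equal. apply Lim_ext. intros h.
  rewrite (H x). replace (x + 2 * PI + h) with (x + h + 2 * PI) by ring. rewrite (H (x + h)).
  reflexivity.
Qed.

(** The third space derivative is continuous because the equation expresses it
    through continuous functions, so all three derivatives can be integrated by
    parts. *)
Lemma equation_fourier k eps tc u0 u T b t xi :
  (1 <= k)%nat -> 0 < eps -> 0 < t < T -> T < tc ->
  classical_solution k eps tc u0 u -> C1L T b u (dt 1 u) ->
  fourier (cpx (dt 1 u t)) xi =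
  (- RtoC (eps ^ 2) * (dmul xi ^ 3 * fourier (cpx (u t)) xi)
   - RtoC (/ INR k) * (dmul xi * fourier (fun x => cpx (u t) x ^ k)%C xi))%C.
Proof.
  intros Hk Heps Ht HT Hsol HC. destruct k as [|k]; [lia|].
  assert (Ht' : 0 < t < tc) by lra. assert (HT0 : 0 < T) by lra.
  assert (Pu : periodic (u t)) by (apply (sol_periodic _ _ _ _ _ Hsol); lra).
  pose proof (fun x j => sol_derivable_x _ _ _ _ _ Hsol t x j Ht') as Dj.
  set (d1 := Derive_n (u t) 1). set (d2 := Derive_n (u t) 2). set (d3 := Derive_n (u t) 3).
  assert (D1 : forall x, is_derive (u t) x (d1 x)) by (intros x; apply Derive_correct, (Dj x 1%nat); lia).
  assert (D2 : forall x, is_derive d1 x (d2 x)) by (intros x; apply Derive_correct, (Dj x 2%nat); lia).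
  assert (D3 : forall x, is_derive d2 x (d3 x)) by (intros x; apply Derive_correct, (Dj x 3%nat); lia).
  assert (P1 : periodic d1) by (apply periodic_Derive; auto).
  assert (P2 : periodic d2) by (apply (periodic_Derive d1); auto).
  assert (Cu : forall x, continuous (u t) x)
    by (intros x; apply (ex_derive_continuous (V := R_NormedModule)); eexists; apply D1).
  assert (C1 : forall x, continuous d1 x)
    by (intros x; apply (ex_derive_continuous (V := R_NormedModule)); eexists; apply D2).
  assert (C2 : forall x, continuous d2 x)
    by (intros x; apply (ex_derive_continuous (V := R_NormedModule)); eexists; apply D3).
  assert (DC : forall f f' : R -> R, (forall x, is_derive f x (f' x)) -> dC (cpx f) (cpx f')).
  { intros f f' H x. split; simpl; [apply H|apply (is_derive_const (V := R_NormedModule))]. }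
  destruct (C1L_pc' _ _ _ _ HT0 HC t Ht) as [Pd Cd].
  set (w' := fun x => (RtoC (INR (S k)) * (cpx (u t) x ^ k * cpx d1 x))%C).
  assert (Dw : dC (fun x => cpx (u t) x ^ S k)%C w') by (apply dC_pow, DC, D1).
  assert (pu : pc (cpx (u t))) by (apply pc_cpx; split; auto).
  assert (Cw' : cts w').
  { apply cts_mult; [apply cts_const|]. apply cts_mult; [apply pc_cts, pc_pow, pu|apply cts_RtoC; auto]. }
  assert (Eqn : forall x, (cpx (dt 1 u t) x + RtoC (eps ^ 2) * cpx d3 x + RtoC (/ INR (S k)) * w' x)%C = RtoC 0).
  { intros x. pose proof (sol_equation _ _ _ _ _ Hsol t x Ht') as E.
    assert (Ew : Derive (fun y => u t y ^ S k) x = INR (S k) * (u t x ^ k * d1 x)).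
    { apply is_derive_unique. pose proof (is_derive_pow (u t) (S k) x (d1 x) (D1 x)) as H.
      evar_last; [exact H|]. simpl pred. ring. }
    rewrite Ew in E. change (Derive (fun s => u s x) t) with (dt 1 u t x) in E.
    fold d3 in E. unfold w', cpx. rewrite <- RtoC_pow, <- !RtoC_mult, <- !RtoC_plus. f_equal. exact E. }
  assert (eps2 : RtoC (eps ^ 2) <> RtoC 0).
  { intros H. apply RtoC_inj in H. assert (0 < eps ^ 2) by (apply pow_lt; auto). lra. }
  assert (C3 : cts (cpx d3)).
  { apply cts_ext with (fun x => (- / RtoC (eps ^ 2)) * (cpx (dt 1 u t) x + RtoC (/ INR (S k)) * w' x))%C.
    - intros x. specialize (Eqn x).
      replace (cpx (dt 1 u t) x + RtoC (/ INR (S k)) * w' x)%C with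
        (cpx (dt 1 u t) x + RtoC (eps ^ 2) * cpx d3 x + RtoC (/ INR (S k)) * w' x - RtoC (eps ^ 2) * cpx d3 x)%C by ring.
      rewrite Eqn. field. exact eps2.
    - apply cts_mult; [apply cts_const|]. apply cts_plus; [apply cts_RtoC; auto|].
      apply cts_mult; auto. apply cts_const. }
  assert (F3 : fourier (cpx d3) xi = (dmul xi ^ 3 * fourier (cpx (u t)) xi)%C).
  { rewrite (fourier_deriv (cpx d2) (cpx d3)); auto; [|apply pc_RtoC; auto].
    rewrite (fourier_deriv (cpx d1) (cpx d2)); auto; [|apply pc_RtoC; auto|apply cts_RtoC; auto].
    rewrite (fourier_deriv (cpx (u t)) (cpx d1)); auto; [|apply cts_RtoC; auto]. simpl. ring. }
  assert (Fw : fourier w' xi = (dmul xi * fourier (fun x => cpx (u t) x ^ S k)%C xi)%C).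
  { apply fourier_deriv; auto. apply pc_pow; auto. }
  rewrite <- F3, <- Fw.
  rewrite (fourier_ext _ (fun x => - RtoC (eps ^ 2) * cpx d3 x + (- RtoC (/ INR (S k))) * w' x)%C).
  - rewrite fourier_plus, !fourier_scal; auto; [ring| |]; apply cts_mult; auto; apply cts_const.
  - intros x. specialize (Eqn x).
    replace (cpx (dt 1 u t) x) with ((cpx (dt 1 u t) x + RtoC (eps ^ 2) * cpx d3 x + RtoC (/ INR (S k)) * w' x)
      - RtoC (eps ^ 2) * cpx d3 x - RtoC (/ INR (S k)) * w' x)%C at 1 by ring.
    rewrite Eqn. ring.
Qed.

Lemma dt_derive gamma m T B u :
  regularity_bound gamma m T B u -> forall j t x, (j < 3)%nat -> 0 < t < T ->
  is_derive (fun s => dt j u s x) t (dt (S j) u t x).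
Proof.
  intros H j t x Hj Ht. apply Derive_correct.
  apply (reg_derivable _ _ _ _ _ H t x (S j) Ht). lia.
Qed.

Lemma reg_Hs gamma m T B u s :
  regularity_bound gamma m T B u -> s <= gamma + m -> forall t, 0 <= t <= T -> Hs s (cpx (u t)) B.
Proof.
  intros H Hs' t Ht. apply Hs_mono with (gamma + m); auto.
  apply hb_of_in_H. apply (reg_u _ _ _ _ _ H); auto.
Qed.

(** Sobolev embedding bounds u, u_tt and u_ttt pointwise, and Landau's inequality
    then bounds u_t. *)
Lemma solution_C1L gamma m T B :
  1 / 2 < gamma -> 1 <= m -> 0 < T ->
  exists b, 0 <= b /\ forall u, regularity_bound gamma m T B u ->
    C1L T b u (dt 1 u) /\ C1L T b (dt 1 u) (dt 2 u).
Proof.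
  intros Hg Hm HT. destruct (sup_bound gamma Hg) as [C0 [H1 HS]].
  set (A := Rabs (C0 * B)). assert (HA : 0 <= A) by apply Rabs_pos.
  assert (HA' : C0 * B <= A) by apply Rle_abs.
  assert (HT8 : 0 < 8 / T) by (apply Rdiv_lt_0_compat; lra).
  exists ((8 / T + T) * A + A). split; [nra|]. intros u H.
  assert (B0 : forall t x, 0 < t < T -> Rabs (u t x) <= A).
  { intros t x Ht. rewrite <- Cmod_R. eapply Rle_trans; [apply (HS (cpx (u t)) B)|auto].
    apply (reg_Hs gamma m T B u); auto; lra. }
  assert (B2 : forall t x, 0 < t < T -> Rabs (dt 2 u t x) <= A).
  { intros t x Ht. rewrite <- Cmod_R. eapply Rle_trans; [apply (HS (cpx (dt 2 u t)) B)|auto].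
    apply Hs_mono with (gamma + 3); [lra|]. apply hb_of_in_H, (reg_dt2 _ _ _ _ _ H); auto. }
  assert (B3 : forall t x, 0 < t < T -> Rabs (dt 3 u t x) <= A).
  { intros t x Ht. rewrite <- Cmod_R. eapply Rle_trans; [apply (HS (cpx (dt 3 u t)) B)|auto].
    apply hb_of_in_H, (reg_dt3 _ _ _ _ _ H); auto. }
  pose proof (dt_derive _ _ _ _ _ H) as D.
  assert (B1 : forall t x, 0 < t < T -> Rabs (dt 1 u t x) <= (8 / T + T) * A).
  { intros t x Ht. exact (Landau_inequality (fun s => u s x) (fun s => dt 1 u s x) (fun s => dt 2 u s x) T A HT
      (fun r Hr => D 0%nat r x ltac:(lia) Hr) (fun r Hr => D 1%nat r x ltac:(lia) Hr)
      (fun r Hr => B0 r x Hr) (fun r Hr => B2 r x Hr) t Ht). }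
  assert (P0 : 0 <= (8 / T + T) * A) by nra.
  assert (Cu : C1L T ((8 / T + T) * A + A) u (dt 1 u)).
  { split.
    - intros t Ht. apply pcR_of_pc. apply (Hs_pc gamma _ B). apply (reg_Hs gamma m T B u); auto; lra.
    - intros t x Ht. apply (D 0%nat); auto; lia.
    - intros t x Ht. specialize (B0 t x Ht). lra.
    - intros t x Ht. specialize (B1 t x Ht). lra.
    - intros t t' x Ht Ht'.
      eapply Rle_trans; [apply (MVT_bound (fun s => dt 1 u s x) (fun s => dt 2 u s x) 0 T A); auto|].
      apply Rmult_le_compat_r; [apply Rabs_pos|lra]. }
  split; auto. split.
  - exact (C1L_pc' T _ u _ HT Cu).
  - intros t x Ht. apply (D 1%nat); auto; lia.
  - intros t x Ht. specialize (B1 t x Ht). lra.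
  - intros t x Ht. specialize (B2 t x Ht). lra.
  - intros t t' x Ht Ht'.
    eapply Rle_trans; [apply (MVT_bound (fun s => dt 2 u s x) (fun s => dt 3 u s x) 0 T A); auto|].
    apply Rmult_le_compat_r; [apply Rabs_pos|lra].
Qed.

(** Landau's inequality for the pairings of u with test families bounds u_t in
    H^(s+1), and with it the Lipschitz constant of u in that space. *)
Lemma solution_dt1_Hs gamma m T B b u s :
  0 < T -> 0 <= B -> s + 1 <= gamma + m -> s + 1 <= gamma + 3 -> regularity_bound gamma m T B u ->
  C1L T b u (dt 1 u) -> C1L T b (dt 1 u) (dt 2 u) ->
  (forall t, 0 < t < T -> hb (s + 1) (fourier (cpx (dt 1 u t))) ((8 / T + T) * B)) /\
  (forall t t', 0 < t < T -> 0 < t' < T ->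
     hb (s + 1) (fun xi => fourier (cpx (u t')) xi - fourier (cpx (u t)) xi)%C
       ((8 / T + T) * B * Rabs (t' - t))).
Proof.
  intros HT HB H1 H2 H Cu Cu1.
  assert (HT8 : 0 < 8 / T) by (apply Rdiv_lt_0_compat; lra).
  assert (P0 : 0 <= (8 / T + T) * B) by nra.
  assert (Key : forall l v V, NoDup l -> 0 <= V ->
    rsum (fun xi => (Cmod (v xi) / wt (s + 1) xi) ^ 2) l <= V ^ 2 ->
    forall t, 0 < t < T -> Rabs (pair_coef v l (dt 1 u t)) <= (8 / T + T) * (B * V)).
  { intros l v V Hl HV Hv.
    apply (Landau_inequality (fun s => pair_coef v l (u s)) _ (fun s => pair_coef v l (dt 2 u s)) T); auto.
    - apply (pair_coef_derive T b u (dt 1 u)); auto.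
    - apply (pair_coef_derive T b (dt 1 u) (dt 2 u)); auto.
    - intros t Ht. apply (pair_coef_bound (s + 1)); auto. apply (reg_Hs gamma m T B u); auto; lra.
    - intros t Ht. apply (pair_coef_bound (s + 1)); auto.
      apply hb_mono with (gamma + 3); auto. apply hb_of_in_H, (reg_dt2 _ _ _ _ _ H); auto. }
  split.
  - intros t Ht. apply hb_dual; auto. intros l v V Hl HV Hv.
    rewrite Rmult_assoc. eapply Rle_trans; [apply Rle_abs|]. apply (Key l v V); auto.
  - intros t t' Ht Ht'. apply hb_dual.
    { apply Rmult_le_pos; auto. apply Rabs_pos. }
    intros l v V Hl HV Hv.
    replace (rsum (fun xi => Re ((fourier (cpx (u t')) xi - fourier (cpx (u t)) xi) * v xi)%C) l)
      with (pair_coef v l (u t') - pair_coef v l (u t)).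
    + eapply Rle_trans; [apply Rle_abs|].
      eapply Rle_trans; [apply (MVT_bound (fun s => pair_coef v l (u s)) (fun s => pair_coef v l (dt 1 u s)) 0 T
        ((8 / T + T) * (B * V)) (pair_coef_derive T b u (dt 1 u) v l HT Cu)
        (Key l v V Hl HV Hv) t t' Ht Ht')|right; ring].
    + unfold pair_coef.
      replace (rsum (fun xi => Re (fourier (cpx (u t')) xi * v xi)%C) l -
        rsum (fun xi => Re (fourier (cpx (u t)) xi * v xi)%C) l) with
       (rsum (fun xi => Re (fourier (cpx (u t')) xi * v xi)%C) l +
        (-1) * rsum (fun xi => Re (fourier (cpx (u t)) xi * v xi)%C) l) by ring.
      rewrite <- rsum_scal, <- rsum_plus. apply rsum_ext. intros xi _.
      destruct (fourier (cpx (u t')) xi), (fourier (cpx (u t)) xi), (v xi).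
      unfold Cminus, Cplus, Copp, Cmult, Re. cbn [fst snd]. ring.
Qed.

(** It vanishes on the range of frequencies exactly when the step from [f] to [g]
    satisfies the scheme ([CN_step_defect]); along the exact solution it is the
    local truncation error multiplied by tau. *)
Definition defect (k : nat) (eps tau : R) (f g : R -> C) (xi : Z) : C :=
  (fourier g xi - fourier f xi
   + RtoC (tau * eps ^ 2) * (dmul xi ^ 3 * fourier (half_sum g f) xi)
   + RtoC (tau / INR k) * (dmul xi * fourier (fun x => half_sum g f x ^ k) xi))%C.

Lemma half_sum_eq v w x : half_sum v w x = (RtoC (/ 2) * (v x + w x))%C.
Proof.
  unfold half_sum. destruct (v x), (w x).
  unfold Cdiv, Cinv, Cmult, Cplus, RtoC. cbn [fst snd]. f_equal; field.
Qed.

Lemma Cmod_half : Cmod (RtoC (/ 2)) = / 2.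
Proof. rewrite Cmod_R. apply Rabs_pos_eq. lra. Qed.

Lemma Hs_half s f A : Hs s f A -> Hs s (fun x => RtoC (/ 2) * f x)%C (/ 2 * A).
Proof. intros H. pose proof (Hs_scal s (RtoC (/ 2)) f A H) as E. rewrite Cmod_half in E. exact E. Qed.

Lemma Hs_scal_nat s n f A : Hs s f A -> Hs s (fun x => RtoC (INR n) * f x)%C (INR n * A).
Proof.
  intros H. pose proof (Hs_scal s (RtoC (INR n)) f A H) as E.
  rewrite Cmod_R, Rabs_pos_eq in E by apply pos_INR. exact E.
Qed.

Lemma pc_half_sum v w : pc v -> pc w -> pc (half_sum v w).
Proof.
  intros. apply pc_ext with (fun x => RtoC (/ 2) * (v x + w x))%C.
  - intros x. symmetry. apply half_sum_eq.
  - apply pc_scal, pc_plus; auto.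
Qed.

Lemma Hs_half_sum s v w A B : Hs s v A -> Hs s w B -> Hs s (half_sum v w) (/ 2 * (A + B)).
Proof.
  intros Hv Hw. apply Hs_ext with (fun x => RtoC (/ 2) * (v x + w x))%C.
  - intros x. symmetry. apply half_sum_eq.
  - apply Hs_half, Hs_plus; auto.
Qed.

Lemma fourier_half_sum v w xi :
  cts v -> cts w -> fourier (half_sum v w) xi = (RtoC (/ 2) * (fourier v xi + fourier w xi))%C.
Proof.
  intros. rewrite (fourier_ext _ _ xi (half_sum_eq v w)), fourier_scal, fourier_plus; auto.
  apply cts_plus; auto.
Qed.

(** The defect is the trapezoidal error of the Fourier coefficients plus the effect
    of replacing the mean of the powers by the power of the mean, which is
    quadratic in the increment of u over the step. The third time derivative
    needed for the first part is obtained by differentiating the equation twice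
    in time, which costs three space derivatives of u_tt and one of (u^k)_tt. *)
Lemma consistency_open (k : nat) gamma m T B s :
  (2 <= k)%nat -> 3 / 2 < s -> s <= gamma -> 1 <= m -> 0 < T -> 0 <= B ->
  exists C0, 0 <= C0 /\ forall u0 tc u eps, T < tc -> 0 < eps <= 1 ->
    classical_solution k eps tc u0 u -> regularity_bound gamma m T B u ->
    forall t tau, 0 < t -> 0 < tau -> t + tau < T ->
    hb s (defect k eps tau (cpx (u t)) (cpx (u (t + tau)))) (C0 * tau ^ 3).
Proof.
  intros Hk Hs' Hsg Hm HT HB. destruct k as [|[|j]]; [lia|lia|]. clear Hk.
  set (k := S (S j)).
  destruct (solution_C1L gamma m T B ltac:(lra) Hm HT) as [b [Hb HC]].
  destruct (algebra (s + 1) ltac:(lra)) as [Ca [Ha1 Ha]].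
  destruct (Hs_pow_bound (s + 1) ltac:(lra)) as [Cp [Hp1 Hp]].
  set (L := (8 / T + T) * B).
  assert (HT8 : 0 < 8 / T) by (apply Rdiv_lt_0_compat; lra).
  assert (HL : 0 <= L) by (unfold L; nra).
  destruct (Hs_pow_mean (s + 1) k (B + L * T) ltac:(lra) ltac:(nra)) as [D [HD Hmean]].
  (* W bounds (u^k)_tt in H^(s+1): two factors u_t, or one factor u_tt *)
  set (W := INR k * (INR (S j) * (Ca * (Ca * (Cp * B) ^ j * L) * L) + Ca * (Cp * B) ^ S j * B)).
  assert (HBj : forall i, 0 <= (Cp * B) ^ i) by (intros; apply pow_le; nra).
  assert (HW : 0 <= W).
  { unfold W. apply Rmult_le_pos; [apply pos_INR|]. apply Rplus_le_le_0_compat.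
    - apply Rmult_le_pos; [apply pos_INR|]. repeat apply Rmult_le_pos; auto; lra.
    - repeat apply Rmult_le_pos; auto; lra. }
  exists (B + W + D * L ^ 2). assert (0 <= L ^ 2) by apply pow2_ge_0.
  split; [assert (0 <= D * L ^ 2) by nra; lra|].
  intros u0 tc u eps HTc Heps Hsol Hreg t tau Ht Htau Htt.
  destruct (HC u Hreg) as [Cu Cu1].
  set (u1 := dt 1 u) in *. set (u2 := dt 2 u) in *.
  destruct (solution_dt1_Hs gamma m T B b u s HT HB ltac:(lra) ltac:(lra) Hreg Cu Cu1) as [Hd1 Hlip].
  fold L in Hd1, Hlip. fold u1 in Hd1.
  assert (Hu : forall r, 0 < r < T -> Hs (s + 1) (cpx (u r)) B)
    by (intros; apply (reg_Hs gamma m T B u); auto; lra).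
  assert (Hu1 : forall r, 0 < r < T -> Hs (s + 1) (cpx (u1 r)) L).
  { intros r Hr. split; [|apply Hd1; auto]. apply pc_cpx. apply (C1L_pc _ _ _ _ Cu1); auto. }
  assert (Hu2 : forall r, 0 < r < T -> Hs (s + 3) (cpx (u2 r)) B).
  { intros r Hr. apply Hs_mono with (gamma + 3); [lra|]. apply hb_of_in_H, (reg_dt2 _ _ _ _ _ Hreg); auto. }
  set (w := fun r x => u r x ^ k).
  set (w1 := fun r x => INR k * (u r x ^ S j * u1 r x)).
  set (w2 := fun r x => INR k * (INR (S j) * (u r x ^ j * u1 r x) * u1 r x + u r x ^ S j * u2 r x)).
  destruct (C1L_pow T b u u1 (S j) HT Cu) as [bw Cw]. fold k in Cw. change (C1L T bw w w1) in Cw.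
  assert (Cw1 : exists c, C1L T c w1 w2).
  { destruct (C1L_pow T b u u1 j HT Cu) as [c Hc].
    exists (4 * INR k * (4 * c * b)).
    apply (C1L_ext T _ (fun r x => INR k * (u r x ^ S j * u1 r x))
      (fun r x => 0 * (u r x ^ S j * u1 r x) + INR k * (INR (S j) * (u r x ^ j * u1 r x) * u1 r x + u r x ^ S j * u2 r x))).
    - reflexivity.
    - intros; unfold w2; ring.
    - apply (C1L_mult T (INR k) (4 * c * b) (fun _ _ => INR k) (fun _ _ => 0)
        (fun r x => u r x ^ S j * u1 r x)); auto.
      + apply C1L_const. rewrite Rabs_pos_eq; [lra|apply pos_INR].
      + apply (C1L_mult T c b (fun r x => u r x ^ S j) _ u1 u2); auto. }
  destruct Cw1 as [bw1 Cw1].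
  assert (Hw2 : forall r, 0 < r < T -> Hs (s + 1) (cpx (w2 r)) W).
  { intros r Hr. pose proof (Hu r Hr) as h0. pose proof (Hu1 r Hr) as h1.
    assert (h2 : Hs (s + 1) (cpx (u2 r)) B) by (apply Hs_mono with (s + 3); [lra|apply Hu2; auto]).
    apply Hs_ext with (fun x => RtoC (INR k) * (RtoC (INR (S j)) * (cpx (u r) x ^ j * cpx (u1 r) x * cpx (u1 r) x)
       + cpx (u r) x ^ S j * cpx (u2 r) x))%C.
    - intros x. unfold w2, cpx.
      rewrite <- !RtoC_pow, <- !RtoC_mult, <- RtoC_plus, <- RtoC_mult. f_equal. ring.
    - unfold W. apply Hs_scal_nat. apply Hs_plus.
      + apply Hs_scal_nat.
        apply (Ha (fun x => cpx (u r) x ^ j * cpx (u1 r) x)%C (cpx (u1 r))); auto.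
      + apply (Ha (fun x => cpx (u r) x ^ S j)%C (cpx (u2 r))); auto. }
  assert (Ht1 : 0 < t < T) by lra. assert (Ht2 : 0 < t + tau < T) by lra.
  assert (Ew : forall r xi, fourier (fun x => cpx (u r) x ^ k)%C xi = fourier (cpx (w r)) xi).
  { intros r xi. apply fourier_ext. intros x. unfold cpx, w. rewrite RtoC_pow. reflexivity. }
  set (v3 := fun xi => (- RtoC (eps ^ 2) * dmul xi ^ 3)%C).
  set (v1 := fun xi => (- RtoC (/ INR k) * dmul xi)%C).
  assert (Eq : forall r xi, 0 < r < T ->
    fourier (cpx (u1 r)) xi = (v3 xi * fourier (cpx (u r)) xi + v1 xi * fourier (cpx (w r)) xi)%C).
  { intros r xi Hr. rewrite <- Ew. unfold u1.
    rewrite (equation_fourier k eps tc u0 u T b r xi); auto; [|unfold k; lia|lra].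
    unfold v3, v1. ring. }
  set (rho1 := fun xi => (fourier (cpx (u (t + tau)%R)) xi - fourier (cpx (u t)) xi
    - RtoC (tau / 2) * (v3 xi * (fourier (cpx (u t)) xi + fourier (cpx (u (t + tau)%R)) xi)
       + v1 xi * (fourier (cpx (w t)) xi + fourier (cpx (w (t + tau)%R)) xi)))%C).
  assert (R1 : hb s rho1 ((B + W) * tau ^ 3)).
  { apply hb_dual. { apply Rmult_le_pos; [lra|]. apply pow_le; lra. }
    intros l v V Hl HV Hv.
    set (f := fun r => pair_coef v l (u r)).
    set (P := fun (a c : R -> R -> R) r => pair_coef (fun xi => v3 xi * v xi)%C l (a r)
                 + pair_coef (fun xi => v1 xi * v xi)%C l (c r)).
    assert (Pd : forall a a' c c' ba bc, C1L T ba a a' -> C1L T bc c c' -> forall r, 0 < r < T ->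
       is_derive (P a c) r (P a' c' r)).
    { intros a a' c c' ba bc Aa Cc r Hr.
      apply (is_derive_plus (V := R_NormedModule)); [apply (pair_coef_derive T ba)|apply (pair_coef_derive T bc)]; auto. }
    assert (Df : forall r, 0 < r < T -> is_derive f r (P u w r)).
    { intros r Hr. replace (P u w r) with (pair_coef v l (u1 r)).
      - apply (pair_coef_derive T b u u1); auto.
      - unfold P, pair_coef. rewrite <- rsum_plus. apply rsum_ext. intros xi _.
        rewrite Eq, <- re_plus by auto. f_equal. ring. }
    assert (Bd : forall r, 0 < r < T -> Rabs (P u2 w2 r) <= (B + W) * V).
    { intros r Hr. unfold P. eapply Rle_trans; [apply Rabs_triang|]. rewrite Rmult_plus_distr_r.
      apply Rplus_le_compat.
      - apply Rle_trans with (rsum (fun xi => Cmod (dmul xi ^ 3 * fourier (cpx (u2 r)) xi)%C * Cmod (v xi)) l).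
        + eapply Rle_trans; [apply rsum_Rabs|]. apply rsum_le. intros xi _.
          eapply Rle_trans; [apply re_le_Cmod|].
          replace (fourier (cpx (u2 r)) xi * (v3 xi * v xi))%C with
            (- RtoC (eps ^ 2) * (dmul xi ^ 3 * fourier (cpx (u2 r)) xi * v xi))%C by (unfold v3; ring).
          rewrite Cmod_mult, Cmod_opp, Cmod_R, Rabs_pos_eq, (Cmod_mult _ (v xi)) by apply pow2_ge_0.
          assert (eps ^ 2 <= 1) by nra.
          assert (0 <= Cmod (dmul xi ^ 3 * fourier (cpx (u2 r)) xi)%C * Cmod (v xi))
            by (apply Rmult_le_pos; apply Cmod_ge_0). nra.
        + apply (hb_pair s (fun xi => dmul xi ^ 3 * fourier (cpx (u2 r)) xi)%C); auto.
          apply (hb_dmul_pow 3). replace (s + INR 3) with (s + 3) by (simpl; ring). apply Hu2; auto.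
      - apply Rle_trans with (rsum (fun xi => Cmod (dmul xi * fourier (cpx (w2 r)) xi)%C * Cmod (v xi)) l).
        + eapply Rle_trans; [apply rsum_Rabs|]. apply rsum_le. intros xi _.
          eapply Rle_trans; [apply re_le_Cmod|].
          replace (fourier (cpx (w2 r)) xi * (v1 xi * v xi))%C with
            (- RtoC (/ INR k) * (dmul xi * fourier (cpx (w2 r)) xi * v xi))%C by (unfold v1; ring).
          assert (K1 : 1 <= INR k) by (apply (le_INR 1); unfold k; lia).
          assert (K2 : / INR k <= 1) by (rewrite <- Rinv_1; apply Rinv_le_contravar; lra).
          assert (K3 : 0 < / INR k) by (apply Rinv_0_lt_compat; lra).
          rewrite Cmod_mult, Cmod_opp, Cmod_R, Rabs_pos_eq, (Cmod_mult _ (v xi)) by lra.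
          assert (0 <= Cmod (dmul xi * fourier (cpx (w2 r)) xi)%C * Cmod (v xi))
            by (apply Rmult_le_pos; apply Cmod_ge_0). nra.
        + apply (hb_pair s (fun xi => dmul xi * fourier (cpx (w2 r)) xi)%C); auto.
          apply hb_dmul. apply Hw2; auto. }
    assert (BV : 0 <= (B + W) * V) by (apply Rmult_le_pos; lra).
    pose proof (trapezoid f (P u w) (P u1 w1) (P u2 w2) 0 T ((B + W) * V) BV Df
      (Pd u u1 w w1 b bw Cu Cw) (Pd u1 u2 w1 w2 b bw1 Cu1 Cw1) Bd t tau Ht Htau ltac:(lra)) as Tr.
    replace (rsum (fun xi => Re (rho1 xi * v xi)%C) l) with (f (t + tau) - f t - tau / 2 * (P u w t + P u w (t + tau))).
    - eapply Rle_trans; [apply Rle_abs|]. eapply Rle_trans; [exact Tr|]. right; ring.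
    - unfold f, P, pair_coef.
      match goal with |- ?a - ?a' - ?c * (?x + ?y + (?x' + ?y')) = _ =>
        replace (a - a' - c * (x + y + (x' + y'))) with
          (a + (-1) * a' + (- c) * x + (- c) * y + (- c) * x' + (- c) * y') by ring end.
      rewrite <- !rsum_scal, <- !rsum_plus. apply rsum_ext. intros xi _. unfold rho1.
      generalize (fourier (cpx (u (t + tau))) xi) (fourier (cpx (u t)) xi) (fourier (cpx (w t)) xi)
        (fourier (cpx (w (t + tau))) xi) (v3 xi) (v1 xi) (v xi).
      intros [a1 a2] [b1 b2] [c1 c2] [d1 d2] [e1 e2] [f1 f2] [g1 g2].
      unfold Cminus, Cplus, Copp, Cmult, RtoC, Re. cbn [fst snd]. ring. }
  (* u (t + tau) = a + d and u t = a - d, with d of order tau *)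
  set (a := half_sum (cpx (u (t + tau))) (cpx (u t))).
  set (d := fun x => (RtoC (/ 2) * (cpx (u (t + tau)%R) x - cpx (u t) x))%C).
  assert (Hd : Hs (s + 1) d (L * tau)).
  { apply Hs_le with (/ 2 * (L * tau)); [assert (0 <= L * tau) by nra; lra|].
    apply (Hs_half _ (fun x => cpx (u (t + tau)%R) x - cpx (u t) x)%C).
    split; [apply pc_minus; [apply (Hu _ Ht2)|apply (Hu _ Ht1)]|].
    apply hb_ext with (fun xi => fourier (cpx (u (t + tau)%R)) xi - fourier (cpx (u t)) xi)%C.
    - intros xi. rewrite fourier_minus; auto; apply pc_cts; [apply (Hu _ Ht2)|apply (Hu _ Ht1)].
    - replace (L * tau) with (L * Rabs (t + tau - t)); [apply Hlip; auto|].
      f_equal. rewrite Rabs_pos_eq; lra. }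
  assert (Hav : Hs (s + 1) a (B + L * T)).
  { apply Hs_le with (/ 2 * (B + B)); [nra|]. apply Hs_half_sum; auto. }
  destruct (Hmean a d (L * tau) Hav Hd ltac:(nra)) as [Q _].
  assert (Ead : forall x, (a x + d x)%C = cpx (u (t + tau)%R) x /\ (a x - d x)%C = cpx (u t) x).
  { intros x. unfold a, d. rewrite half_sum_eq.
    destruct (cpx (u (t + tau)) x), (cpx (u t) x).
    unfold Cminus, Cplus, Copp, Cmult, RtoC. cbn [fst snd]. split; f_equal; field. }
  set (q := fun x => (RtoC (/ 2) * ((a x + d x) ^ k + (a x - d x) ^ k) - a x ^ k)%C) in *.
  assert (Cw' : forall r, 0 < r < T -> cts (cpx (w r))).
  { intros r Hr. apply pc_cts, pc_cpx, (C1L_pc _ _ _ _ Cw); auto. }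
  assert (Fq : forall xi, fourier q xi = (RtoC (/ 2) * (fourier (cpx (w (t + tau)%R)) xi + fourier (cpx (w t)) xi)
     - fourier (fun x => a x ^ k)%C xi)%C).
  { intros xi.
    rewrite (fourier_ext _ (fun x => RtoC (/ 2) * (cpx (w (t + tau)%R) x + cpx (w t) x) - a x ^ k)%C).
    - rewrite fourier_minus, fourier_scal, fourier_plus; auto.
      + apply cts_plus; auto.
      + apply cts_mult; [apply cts_const|apply cts_plus; auto].
      + apply pc_cts, pc_pow. apply Hav.
    - intros x. unfold q. destruct (Ead x) as [E1 E2]. rewrite E1, E2. unfold cpx, w.
      rewrite !RtoC_pow. reflexivity. }
  assert (R2 : hb s (fun xi => - RtoC (tau / INR k) * (dmul xi * fourier q xi))%C (D * L ^ 2 * tau ^ 3)).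
  { assert (K1 : 1 <= INR k) by (apply (le_INR 1); unfold k; lia).
    apply hb_le with (Cmod (- RtoC (tau / INR k)) * (D * (L * tau) ^ 2)).
    - rewrite Cmod_opp, Cmod_R, Rabs_pos_eq by (apply Rmult_le_pos; [lra|left; apply Rinv_0_lt_compat; lra]).
      replace (D * L ^ 2 * tau ^ 3) with (tau * (D * (L * tau) ^ 2)) by ring.
      apply Rmult_le_compat_r.
      + apply Rmult_le_pos; auto. apply pow2_ge_0.
      + unfold Rdiv. rewrite <- (Rmult_1_r tau) at 2. apply Rmult_le_compat_l; [lra|].
        rewrite <- Rinv_1. apply Rinv_le_contravar; lra.
    - apply (hb_scal s (- RtoC (tau / INR k))%C (fun xi => dmul xi * fourier q xi)%C).
      apply hb_dmul. apply Q. }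
  replace ((B + W + D * L ^ 2) * tau ^ 3) with ((B + W) * tau ^ 3 + D * L ^ 2 * tau ^ 3) by ring.
  apply hb_ext with (fun xi => rho1 xi + - RtoC (tau / INR k) * (dmul xi * fourier q xi))%C;
    [|apply hb_plus; auto].
  intros xi. rewrite Fq. unfold rho1, defect. fold k. fold a.
  assert (Ea : fourier a xi = (RtoC (/ 2) * (fourier (cpx (u (t + tau)%R)) xi + fourier (cpx (u t)) xi))%C).
  { unfold a. apply fourier_half_sum; apply pc_cts; [apply (Hu _ Ht2)|apply (Hu _ Ht1)]. }
  rewrite Ea. unfold v3, v1.
  assert (Ek : RtoC (tau / INR k) = (RtoC tau * RtoC (/ INR k))%C) by (rewrite <- RtoC_mult; reflexivity).
  assert (Et : RtoC (tau / 2) = (RtoC tau * RtoC (/ 2))%C) by (rewrite <- RtoC_mult; reflexivity).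
  rewrite Ek, Et, RtoC_mult. ring.
Qed.

(** At t = 0 and t = T the bound is a limit, by continuity in time for fixed x. *)
Lemma solution_lipschitz k eps tc u0 u T b :
  0 < T -> T < tc -> classical_solution k eps tc u0 u -> C1L T b u (dt 1 u) ->
  forall t t' x, 0 <= t <= T -> 0 <= t' <= T -> Rabs (u t x - u t' x) <= b * Rabs (t - t').
Proof.
  intros HT HTc Hsol HC t t' x Ht Ht'. pose proof (C1L_pos _ _ _ _ HT HC) as Hb.
  assert (Near : forall r, 0 <= r <= T -> forall e, 0 < e ->
    exists q, 0 < q < T /\ Rabs (q - r) <= e /\ Rabs (u q x - u r x) <= e).
  { intros r Hr e He.
    pose proof (sol_continuous _ _ _ _ _ Hsol r x ltac:(lra)) as Hc.
    destruct (proj1 (filterlim_locally _ _) Hc (mkposreal e He)) as [d Hd].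
    set (h := Rmin (Rmin (d / 2) e) (T / 4)).
    assert (Hh : 0 < h) by (destruct d; simpl in *; unfold h; repeat apply Rmin_glb_lt; simpl; lra).
    assert (h1 : h <= d / 2) by (eapply Rle_trans; [apply Rmin_l|apply Rmin_l]).
    assert (h2 : h <= e) by (eapply Rle_trans; [apply Rmin_l|apply Rmin_r]).
    assert (h3 : h <= T / 4) by apply Rmin_r.
    assert (Hd0 : 0 < d) by apply cond_pos.
    assert (Q : forall q, Rabs (q - r) <= h -> 0 < q < T ->
      0 < q < T /\ Rabs (q - r) <= e /\ Rabs (u q x - u r x) <= e).
    { intros q Hq Hq'. split; auto. split; [lra|].
      specialize (Hd (q, x)). simpl in Hd.
      assert (Bq : ball (r, x) d (q, x)).
      { split; simpl; [|apply ball_center].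
        unfold ball; simpl; unfold AbsRing_ball, abs, minus, plus, opp; simpl.
        change (q + - r) with (q - r). lra. }
      specialize (Hd Bq ltac:(lra)).
      unfold ball in Hd; simpl in Hd; unfold AbsRing_ball, abs, minus, plus, opp in Hd; simpl in Hd.
      change (u q x + - u r x) with (u q x - u r x) in Hd. lra. }
    destruct (Rle_or_lt r (T / 2)).
    - exists (r + h). apply Q; [|lra]. replace (r + h - r) with h by ring. rewrite Rabs_pos_eq; lra.
    - exists (r - h). apply Q; [|lra]. replace (r - h - r) with (- h) by ring.
      rewrite Rabs_Ropp, Rabs_pos_eq; lra. }
  apply le_of_eps with (2 + 2 * b); [lra|]. intros e He.
  destruct (Near t Ht e He) as [q [Hq [Q1 Q2]]]. destruct (Near t' Ht' e He) as [q' [Hq' [Q1' Q2']]].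
  pose proof (C1L_lip0 _ _ _ _ HC q q' x Hq Hq') as L.
  assert (E : Rabs (q - q') <= Rabs (t - t') + 2 * e).
  { replace (q - q') with ((q - t) + (t - t') + - (q' - t')) by ring.
    eapply Rle_trans; [apply Rabs_triang|]. eapply Rle_trans; [apply Rplus_le_compat_r, Rabs_triang|].
    rewrite Rabs_Ropp. lra. }
  replace (u t x - u t' x) with (- (u q x - u t x) + (u q x - u q' x) + (u q' x - u t' x)) by ring.
  eapply Rle_trans; [apply Rabs_triang|]. eapply Rle_trans; [apply Rplus_le_compat_r, Rabs_triang|].
  rewrite Rabs_Ropp.
  assert (b * Rabs (q - q') <= b * (Rabs (t - t') + 2 * e)) by (apply Rmult_le_compat_l; auto). lra.
Qed.

Lemma Cmod_pow_diff n A :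
  0 <= A -> exists D, 0 <= D /\ forall z w, Cmod z <= A -> Cmod w <= A ->
    Cmod (z ^ n - w ^ n)%C <= D * Cmod (z - w)%C.
Proof.
  intros HA. induction n as [|n [D [HD IH]]].
  - exists 0. split; [lra|]. intros z w _ _. replace (z ^ 0 - w ^ 0)%C with (RtoC 0) by (simpl; ring).
    rewrite Cmod_0. lra.
  - exists (A * D + A ^ n). assert (P : 0 <= A ^ n) by (apply pow_le; auto). split; [nra|].
    intros z w Hz Hw. replace (z ^ S n - w ^ S n)%C with (z * (z ^ n - w ^ n) + (z - w) * w ^ n)%C
      by (rewrite !Cpow_S; ring).
    eapply Rle_trans; [apply Cmod_triangle|]. rewrite !Cmod_mult, Cmod_pow.
    specialize (IH z w Hz Hw). pose proof (Cmod_ge_0 (z - w)%C). pose proof (Cmod_ge_0 w).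
    pose proof (Cmod_ge_0 z). pose proof (Cmod_ge_0 (z ^ n - w ^ n)%C).
    assert (Cmod w ^ n <= A ^ n) by (apply pow_incr; auto).
    assert (Cmod z * Cmod (z ^ n - w ^ n)%C <= A * (D * Cmod (z - w)%C)) by (apply Rmult_le_compat; auto).
    assert (Cmod (z - w)%C * Cmod w ^ n <= Cmod (z - w)%C * A ^ n) by (apply Rmult_le_compat_l; auto).
    lra.
Qed.

Lemma Cmod_fourier_diff f g xi e :
  cts f -> cts g -> (forall x, Cmod (f x - g x)%C <= e) -> Cmod (fourier f xi - fourier g xi)%C <= e.
Proof.
  intros Hf Hg H. rewrite <- fourier_minus by auto. apply fourier_bound; auto.
  apply cts_plus; auto. apply cts_opp; auto.
Qed.

(** The time derivatives are only available on the open interval, so the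
    estimate at the end points is obtained by continuity in time. *)
Lemma consistency (k : nat) gamma m T B s :
  (2 <= k)%nat -> 3 / 2 < s -> s <= gamma -> 1 <= m -> 0 < T -> 0 <= B ->
  exists C0, 0 <= C0 /\ forall u0 tc u eps, T < tc -> 0 < eps <= 1 ->
    classical_solution k eps tc u0 u -> regularity_bound gamma m T B u ->
    forall t tau, 0 <= t -> 0 < tau -> t + tau <= T ->
    hb s (defect k eps tau (cpx (u t)) (cpx (u (t + tau)))) (C0 * tau ^ 3).
Proof.
  intros Hk Hs' Hsg Hm HT HB.
  destruct (consistency_open k gamma m T B s Hk Hs' Hsg Hm HT HB) as [C0 [HC0 Hopen]].
  destruct (solution_C1L gamma m T B ltac:(lra) Hm HT) as [b [Hb HC]].
  destruct (sup_bound s ltac:(lra)) as [C1 [HC1 HS]].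
  set (A := C1 * B). assert (HA : 0 <= A) by (unfold A; nra).
  destruct (Cmod_pow_diff k A HA) as [D [HD HPD]].
  exists C0. split; auto. intros u0 tc u eps HTc Heps Hsol Hreg t tau Ht Htau Htt.
  assert (Lip : forall r q x, 0 <= r <= T -> 0 <= q <= T -> Cmod (cpx (u r) x - cpx (u q) x)%C <= b * Rabs (r - q)).
  { intros r q x Hr Hq. unfold cpx. rewrite <- RtoC_minus, Cmod_R.
    apply (solution_lipschitz k eps tc u0 u T b); auto. apply HC; auto. }
  assert (Hu : forall r, 0 <= r <= T -> Hs s (cpx (u r)) B)
    by (intros; apply (reg_Hs gamma m T B u); auto; lra).
  assert (Hk1 : 1 <= INR k) by (apply (le_INR 1); lia).
  assert (Hk2 : / INR k <= 1) by (rewrite <- Rinv_1; apply Rinv_le_contravar; lra).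
  assert (Hk3 : 0 < / INR k) by (apply Rinv_0_lt_compat; lra).
  assert (HAk : 0 <= A ^ k) by (apply pow_le; auto).
  apply hb_approx with (fun xi => 2 * b + Cmod (dmul xi ^ 3)%C * (T * b + 2 * A)
     + Cmod (dmul xi) * (T * (D * b) + 2 * A ^ k)).
  { apply Rmult_le_pos; auto. apply pow_le; lra. }
  intros e He. set (h := Rmin e (tau / 4)).
  assert (Hh : 0 < h) by (apply Rmin_glb_lt; lra).
  assert (h1 : h <= e) by apply Rmin_l. assert (h2 : h <= tau / 4) by apply Rmin_r.
  exists (defect k eps (tau - 2 * h) (cpx (u (t + h))) (cpx (u (t + h + (tau - 2 * h))))). split.
  { apply hb_le with (C0 * (tau - 2 * h) ^ 3).
    - apply Rmult_le_compat_l; auto. apply pow_incr. lra.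
    - apply (Hopen u0 tc u eps); auto; lra. }
  intros xi. replace (t + h + (tau - 2 * h)) with (t + tau - h) by ring.
  set (f := cpx (u t)). set (f' := cpx (u (t + h))).
  set (g := cpx (u (t + tau))). set (g' := cpx (u (t + tau - h))).
  assert (Ff : Hs s f B) by (apply Hu; lra). assert (Ff' : Hs s f' B) by (apply Hu; lra).
  assert (Fg : Hs s g B) by (apply Hu; lra). assert (Fg' : Hs s g' B) by (apply Hu; lra).
  set (a := half_sum g f). set (a' := half_sum g' f').
  assert (Fa : Hs s a B).
  { replace B with (/ 2 * (B + B)) by field. apply Hs_half_sum; auto. }
  assert (Fa' : Hs s a' B).
  { replace B with (/ 2 * (B + B)) by field. apply Hs_half_sum; auto. }
  assert (Df : forall x, Cmod (f x - f' x)%C <= b * h).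
  { intros x. eapply Rle_trans; [apply Lip; lra|]. right. f_equal.
    replace (t - (t + h)) with (- h) by ring. rewrite Rabs_Ropp, Rabs_pos_eq; lra. }
  assert (Dg : forall x, Cmod (g x - g' x)%C <= b * h).
  { intros x. eapply Rle_trans; [apply Lip; lra|]. right. f_equal.
    replace (t + tau - (t + tau - h)) with h by ring. rewrite Rabs_pos_eq; lra. }
  assert (Da : forall x, Cmod (a x - a' x)%C <= b * h).
  { intros x. unfold a, a'. rewrite !half_sum_eq.
    replace (RtoC (/ 2) * (g x + f x) - RtoC (/ 2) * (g' x + f' x))%C with
      (RtoC (/ 2) * ((g x - g' x) + (f x - f' x)))%C by ring.
    rewrite Cmod_mult, Cmod_half. pose proof (Cmod_triangle (g x - g' x) (f x - f' x)).
    specialize (Df x). specialize (Dg x). lra. }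
  pose proof (fun x => HS a B Fa x) as Sa. pose proof (fun x => HS a' B Fa' x) as Sa'.
  fold A in Sa, Sa'.
  set (p := fun x => (a x ^ k)%C). set (p' := fun x => (a' x ^ k)%C).
  assert (Dp : forall x, Cmod (p x - p' x)%C <= D * (b * h)).
  { intros x. eapply Rle_trans; [apply HPD; auto|]. apply Rmult_le_compat_l; auto. }
  assert (Cf : cts f) by apply Ff. assert (Cf' : cts f') by apply Ff'.
  assert (Cg : cts g) by apply Fg. assert (Cg' : cts g') by apply Fg'.
  assert (Ca : cts a) by apply Fa. assert (Ca' : cts a') by apply Fa'.
  assert (Cp : cts p) by (apply pc_cts, pc_pow, Fa). assert (Cp' : cts p') by (apply pc_cts, pc_pow, Fa').
  pose proof (Cmod_fourier_diff f f' xi _ Cf Cf' Df) as Xf.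
  pose proof (Cmod_fourier_diff g g' xi _ Cg Cg' Dg) as Xg.
  pose proof (Cmod_fourier_diff a a' xi _ Ca Ca' Da) as Xa.
  pose proof (Cmod_fourier_diff p p' xi _ Cp Cp' Dp) as Xp.
  pose proof (fourier_bound a' xi A Ca' Sa') as Ya.
  assert (Yp : Cmod (fourier p' xi) <= A ^ k).
  { apply fourier_bound; auto. intros x. unfold p'. rewrite Cmod_pow. apply pow_incr. split; auto.
    apply Cmod_ge_0. }
  assert (Z : forall (F F' : C) c c', Cmod (F - F')%C <= c -> Cmod F' <= c' ->
    Cmod (RtoC tau * F - RtoC (tau - 2 * h) * F')%C <= T * c + 2 * h * c').
  { intros F F' c c' h3 h4.
    replace (RtoC tau * F - RtoC (tau - 2 * h) * F')%C with (RtoC tau * (F - F') + RtoC (2 * h) * F')%C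
      by (rewrite RtoC_minus; ring).
    eapply Rle_trans; [apply Cmod_triangle|]. rewrite !Cmod_mult, !Cmod_R, !Rabs_pos_eq by lra.
    pose proof (Cmod_ge_0 (F - F')%C). pose proof (Cmod_ge_0 F').
    apply Rplus_le_compat; apply Rmult_le_compat; lra. }
  pose proof (Z _ _ _ _ Xa Ya) as Za. pose proof (Z _ _ _ _ Xp Yp) as Zp.
  unfold defect. fold a. fold a'. fold p. fold p'.
  replace (fourier g xi - fourier f xi + RtoC (tau * eps ^ 2) * (dmul xi ^ 3 * fourier a xi) +
     RtoC (tau / INR k) * (dmul xi * fourier p xi) -
     (fourier g' xi - fourier f' xi + RtoC ((tau - 2 * h) * eps ^ 2) * (dmul xi ^ 3 * fourier a' xi) +
      RtoC ((tau - 2 * h) / INR k) * (dmul xi * fourier p' xi)))%C with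
   ((fourier g xi - fourier g' xi) + - (fourier f xi - fourier f' xi)
    + RtoC (eps ^ 2) * (dmul xi ^ 3 * (RtoC tau * fourier a xi - RtoC (tau - 2 * h) * fourier a' xi))
    + RtoC (/ INR k) * (dmul xi * (RtoC tau * fourier p xi - RtoC (tau - 2 * h) * fourier p' xi)))%C.
  2:{ unfold Rdiv. rewrite !RtoC_mult. ring. }
  eapply Rle_trans; [apply Cmod_triangle|].
  eapply Rle_trans; [apply Rplus_le_compat_r, Cmod_triangle|].
  eapply Rle_trans; [apply Rplus_le_compat_r, Rplus_le_compat_r, Cmod_triangle|].
  rewrite Cmod_opp. rewrite (Cmod_mult (RtoC (eps ^ 2))), (Cmod_mult (dmul xi ^ 3)%C).
  rewrite (Cmod_mult (RtoC (/ INR k))), (Cmod_mult (dmul xi)).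
  rewrite (Cmod_R (eps ^ 2)), (Cmod_R (/ INR k)).
  rewrite (Rabs_pos_eq (eps ^ 2)) by apply pow2_ge_0. rewrite (Rabs_pos_eq (/ INR k)) by lra.
  pose proof (Cmod_ge_0 (dmul xi ^ 3)%C) as M3. pose proof (Cmod_ge_0 (dmul xi)) as M1.
  set (m3 := Cmod (dmul xi ^ 3)%C) in *. set (m1 := Cmod (dmul xi)) in *.
  set (za := Cmod (RtoC tau * fourier a xi - RtoC (tau - 2 * h) * fourier a' xi)%C) in *.
  set (zp := Cmod (RtoC tau * fourier p xi - RtoC (tau - 2 * h) * fourier p' xi)%C) in *.
  assert (Za0 : 0 <= za) by apply Cmod_ge_0. assert (Zp0 : 0 <= zp) by apply Cmod_ge_0.
  assert (T1 : eps ^ 2 * (m3 * za) <= m3 * (T * (b * h) + 2 * h * A)).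
  { assert (eps ^ 2 <= 1) by nra. assert (0 <= m3 * za) by nra.
    assert (m3 * za <= m3 * (T * (b * h) + 2 * h * A)) by (apply Rmult_le_compat_l; auto). nra. }
  assert (T2 : / INR k * (m1 * zp) <= m1 * (T * (D * (b * h)) + 2 * h * A ^ k)).
  { assert (0 <= m1 * zp) by nra.
    assert (m1 * zp <= m1 * (T * (D * (b * h)) + 2 * h * A ^ k)) by (apply Rmult_le_compat_l; auto). nra. }
  apply Rle_trans with (h * (2 * b + m3 * (T * b + 2 * A) + m1 * (T * (D * b) + 2 * A ^ k))).
  - lra.
  - apply Rmult_le_compat_r; auto.
    assert (0 <= m3 * (T * b + 2 * A)) by (apply Rmult_le_pos; nra).
    assert (0 <= D * b) by nra.
    assert (0 <= m1 * (T * (D * b) + 2 * A ^ k)) by (apply Rmult_le_pos; nra). lra.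
Qed.

(** * Projection and interpolation errors *)

Lemma Hs_proj_error s t K f B :
  s <= t -> (1 <= K)%nat -> Hs t f B ->
  Hs s (fun x => f x - tp K (fourier f) x)%C (Rpower (INR K) (- (t - s)) * B).
Proof.
  intros Hst HK [Hp Hf]. split; [apply pc_minus; auto; apply pc_tp|].
  apply hb_dom with t (fourier f); auto; [left; apply Rpower_pos|]. intros xi.
  rewrite fourier_minus by (try apply cts_tp; apply pc_cts; auto).
  assert (HK1 : 1 <= INR K) by (apply (le_INR 1); auto).
  destruct (in_dec Z.eq_dec xi (zr K)) as [Hi|Hn].
  - rewrite fourier_tp_in by auto. replace (fourier f xi - fourier f xi)%C with (RtoC 0) by ring.
    rewrite Cmod_0, Rmult_0_r. apply Rmult_le_pos; [left; apply Rpower_pos|].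
    apply Rmult_le_pos; [left; apply wt_pos|apply Cmod_ge_0].
  - rewrite fourier_tp_out by auto. replace (fourier f xi - RtoC 0)%C with (fourier f xi) by ring.
    rewrite <- Rmult_assoc. apply Rmult_le_compat_r; [apply Cmod_ge_0|].
    apply wt_tail; auto. rewrite in_zr in Hn. rewrite <- abs_IZR, INR_IZR_INZ. apply IZR_le. lia.
Qed.

Lemma Hs_tp_fourier s K f B : Hs s f B -> Hs s (tp K (fourier f)) B.
Proof. intros [_ H]. apply Hs_tp; auto. Qed.

Lemma proj_error_sup s :
  1 / 2 < s -> exists C0, 0 <= C0 /\ forall K f B, (1 <= K)%nat -> Hs s f B ->
    forall x, Cmod (f x - tp K (fourier f) x)%C <= C0 * Rpower (INR K) (- (s - 1 / 2)) * B.
Proof.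
  intros Hs'. destruct (l1_tail s Hs') as [C0 [H0 HT]]. destruct (l1_embed s Hs') as [C1 [H1 HE]].
  exists C0. split; [lra|]. intros K f B HK [Hp Hf].
  apply fourier_inversion with (C1 * B); auto.
Qed.

Lemma rsum_support (f : Z -> R) K l :
  NoDup l -> (forall xi, 0 <= f xi) -> (forall xi, ~ In xi (zr K) -> f xi = 0) ->
  rsum f l <= rsum f (zr K).
Proof.
  intros Hl Hf H0.
  rewrite (rsum_filter (fun xi => if in_dec Z.eq_dec xi (zr K) then true else false)).
  rewrite (rsum_ext f (fun _ => 0) (filter (fun x => negb _) l)).
  - rewrite rsum_const, Rmult_0_r, Rplus_0_r. apply rsum_incl; auto; [apply NoDup_filter; auto|].
    intros xi Hxi. apply filter_In in Hxi. destruct Hxi as [_ Hxi].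
    destruct (in_dec Z.eq_dec xi (zr K)); [auto|discriminate].
  - intros xi Hxi. apply filter_In in Hxi. destruct Hxi as [_ Hxi].
    destruct (in_dec Z.eq_dec xi (zr K)); [discriminate|auto].
Qed.

Lemma length_zr K : length (zr K) = (2 * K + 1)%nat.
Proof. unfold zr. rewrite length_map, length_seq. reflexivity. Qed.

Lemma hb_tp_coef s K e E :
  0 <= s -> 0 <= E -> (forall xi, In xi (zr K) -> Cmod (e xi) <= E) ->
  hb s (fourier (tp K e)) (sqrt (2 * INR K + 1) * Rpower (1 + INR K) s * E).
Proof.
  intros Hs' HE H. pose proof (pos_INR K) as HK. pose proof (Rpower_pos (1 + INR K) s) as HP.
  assert (HB : 0 <= sqrt (2 * INR K + 1) * Rpower (1 + INR K) s * E).
  { repeat apply Rmult_le_pos; auto; [apply sqrt_pos|lra]. }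
  split; auto. intros l Hl. eapply Rle_trans; [apply (rsum_support _ K); auto|].
  - intros; apply pow2_ge_0.
  - intros xi Hn. rewrite fourier_tp_out, Cmod_0 by auto. ring.
  - apply Rle_trans with (rsum (fun _ => (Rpower (1 + INR K) s * E) ^ 2) (zr K)).
    + apply rsum_le. intros xi Hxi. rewrite fourier_tp_in by auto. apply pow_incr. split.
      { apply Rmult_le_pos; [left; apply wt_pos|apply Cmod_ge_0]. }
      apply Rmult_le_compat; [left; apply wt_pos|apply Cmod_ge_0| |auto].
      apply wt_upper; auto. apply in_zr in Hxi. rewrite <- abs_IZR, INR_IZR_INZ. apply IZR_le. lia.
    + rewrite rsum_const, length_zr. rewrite plus_INR, mult_INR. simpl (INR 2). simpl (INR 1).
      right. replace ((sqrt (2 * INR K + 1) * Rpower (1 + INR K) s * E) ^ 2) with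
        (sqrt (2 * INR K + 1) ^ 2 * (Rpower (1 + INR K) s * E) ^ 2) by ring.
      rewrite pow2_sqrt by lra. ring.
Qed.

Lemma dft_csum L f xi :
  (0 < L)%nat -> dft L f xi = (RtoC (/ INR L) *
    csum (fun j => f (grid L j) * cis (- (IZR xi * (grid L j + PI))))%C (seq 0 L))%C.
Proof.
  intros HL. unfold dft. rewrite sum_n_csum. replace (L - 1 + 1)%nat with L by lia. reflexivity.
Qed.

Lemma dft_plus L f g xi : (0 < L)%nat -> dft L (fun x => f x + g x)%C xi = (dft L f xi + dft L g xi)%C.
Proof.
  intros HL. rewrite !dft_csum by auto. rewrite <- Cmult_plus_distr_l, <- csum_plus. f_equal.
  apply csum_ext. intros; ring.
Qed.

Lemma dft_bound L f xi B :
  (0 < L)%nat -> (forall x, Cmod (f x) <= B) -> Cmod (dft L f xi) <= B.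
Proof.
  intros HL HB. rewrite dft_csum, Cmod_mult, Cmod_R by auto.
  assert (HL' : 0 < INR L) by (apply lt_0_INR; auto).
  rewrite Rabs_pos_eq by (left; apply Rinv_0_lt_compat; auto).
  apply Rmult_le_reg_l with (INR L); auto. rewrite <- Rmult_assoc, Rinv_r, Rmult_1_l by lra.
  eapply Rle_trans; [apply csum_Cmod|].
  apply Rle_trans with (rsum (fun _ : nat => B) (seq 0 L)).
  - apply rsum_le. intros j _. rewrite Cmod_mult, Cmod_cis, Rmult_1_r. auto.
  - rewrite rsum_const, length_seq. lra.
Qed.

Lemma cis_nat a n : cis (INR n * a) = (cis a ^ n)%C.
Proof.
  induction n as [|n IH]; [simpl; rewrite Rmult_0_l; apply cis_0|].
  rewrite S_INR, Cpow_S, <- IH, <- cis_plus. f_equal. ring.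
Qed.

Lemma geometric_csum (q : C) n : ((q - 1) * csum (fun j => q ^ j) (seq 0 n) = q ^ n - 1)%C.
Proof.
  induction n as [|n IH]; [simpl; ring|].
  rewrite seq_S, csum_app, Cmult_plus_distr_l, IH. simpl. ring.
Qed.

(** It makes the geometric sum of the ratios of two distinct grid modes vanish. *)
Lemma cis_neq_1 a : 0 < Rabs a < 2 * PI -> cis a <> RtoC 1.
Proof.
  intros Ha H. assert (E : cos a = 1) by (injection H; auto).
  assert (E2 : cos (Rabs a) = 1).
  { unfold Rabs. destruct (Rcase_abs a); [rewrite cos_neg|]; auto. }
  replace (Rabs a) with (2 * (Rabs a / 2)) in E2 by field.
  rewrite cos_2a_sin in E2. assert (0 < sin (Rabs a / 2)) by (apply sin_gt_0; lra). nra.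
Qed.

Lemma dft_mode L z xi :
  (Z.abs (z - xi) < Z.of_nat L)%Z -> dft L (mode z) xi = RtoC (if Z.eq_dec xi z then 1 else 0).
Proof.
  intros Hlt. assert (HL : (0 < L)%nat) by lia. assert (HL' : 0 < INR L) by (apply lt_0_INR; auto).
  rewrite dft_csum by auto.
  set (a := 2 * PI * IZR (z - xi) / INR L).
  rewrite (csum_ext _ (fun j => cis a ^ j)%C).
  2:{ intros j _. rewrite <- cis_nat. unfold mode. rewrite <- cis_plus. f_equal.
      unfold grid, a. rewrite minus_IZR. field. lra. }
  destruct (Z.eq_dec xi z) as [->|Hn].
  - assert (Ea : cis a = RtoC 1).
    { unfold a. rewrite Z.sub_diag. replace (2 * PI * 0 / INR L) with 0 by (field; lra). apply cis_0. }
    rewrite (csum_ext _ (fun _ => RtoC 1)).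
    2:{ intros j _. rewrite Ea. apply Cpow_1_l. }
    assert (Ec : forall l : list nat, csum (fun _ => RtoC 1) l = RtoC (INR (length l))).
    { induction l as [|x l IH]; [reflexivity|]. cbn [csum length]. rewrite IH, S_INR, <- RtoC_plus. f_equal. ring. }
    rewrite Ec, length_seq, <- RtoC_mult. f_equal. field. lra.
  - assert (Hd : (1 <= Z.abs (z - xi))%Z) by lia.
    assert (Hd1 : 1 <= Rabs (IZR (z - xi))) by (rewrite <- abs_IZR; apply (IZR_le 1); auto).
    assert (Hd2 : Rabs (IZR (z - xi)) < INR L).
    { rewrite <- abs_IZR, INR_IZR_INZ. apply IZR_lt; auto. }
    pose proof PI_RGT_0 as Hpi.
    assert (Hq : cis a <> RtoC 1).
    { apply cis_neq_1. unfold a, Rdiv. rewrite !Rabs_mult, (Rabs_pos_eq 2), (Rabs_pos_eq PI) by lra.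
      rewrite (Rabs_pos_eq (/ INR L)) by (left; apply Rinv_0_lt_compat; auto). split.
      - apply Rmult_lt_0_compat; [apply Rmult_lt_0_compat; lra|apply Rinv_0_lt_compat; auto].
      - apply Rmult_lt_reg_r with (INR L); auto. rewrite Rmult_assoc, Rinv_l, Rmult_1_r by lra.
        apply Rmult_lt_compat_l; lra. }
    assert (Hq1 : (cis a ^ L)%C = RtoC 1).
    { rewrite <- cis_nat. replace (INR L * a) with (2 * IZR (z - xi) * PI) by (unfold a; field; lra).
      apply cis_2PI. }
    pose proof (geometric_csum (cis a) L) as G. rewrite Hq1 in G.
    replace (RtoC 1 - 1)%C with (RtoC 0) in G by ring.
    destruct (Ceq_dec (csum (fun j => cis a ^ j)%C (seq 0 L)) (RtoC 0)) as [E|E].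
    + rewrite E. ring.
    + exfalso. apply (Cmult_neq_0 (cis a - 1) _) in E; auto.
      intros E'. apply Hq. replace (cis a) with (cis a - 1 + 1)%C by ring. rewrite E'. ring.
Qed.

Lemma dft_tp L K c xi :
  (2 * K < L)%nat -> In xi (zr K) -> dft L (tp K c) xi = c xi.
Proof.
  intros HL Hxi. rewrite dft_csum by lia.
  assert (E : csum (fun j => tp K c (grid L j) * cis (- (IZR xi * (grid L j + PI))))%C (seq 0 L) =
    csum (fun z => c z * csum (fun j => mode z (grid L j) * cis (- (IZR xi * (grid L j + PI)))) (seq 0 L))%C (zr K)).
  { rewrite (csum_ext _ (fun j => csum (fun z => c z * (mode z (grid L j) * cis (- (IZR xi * (grid L j + PI)))))%C (zr K))).
    - rewrite csum_swap. apply csum_ext. intros z _. apply csum_scal.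
    - intros j _. unfold tp. rewrite Cmult_comm, <- csum_scal. apply csum_ext. intros; ring. }
  rewrite E, <- csum_scal.
  rewrite (csum_ext _ (fun z => c z * dft L (mode z) xi)%C).
  2:{ intros z _. rewrite dft_csum by lia. ring. }
  apply in_zr in Hxi.
  rewrite (csum_single _ _ xi); [|apply NoDup_zr|apply in_zr; auto|].
  - rewrite dft_mode by lia. destruct (Z.eq_dec xi xi); [ring|tauto].
  - intros z Hz Hne. apply in_zr in Hz. rewrite dft_mode by lia.
    destruct (Z.eq_dec xi z); [congruence|ring].
Qed.

Lemma dft_conj L (v : R -> R) xi : (0 < L)%nat -> dft L (cpx v) (- xi) = Cconj (dft L (cpx v) xi).
Proof.
  intros HL. rewrite !dft_csum by auto. rewrite Cmult_conj.
  assert (E : forall r : R, Cconj (RtoC r) = RtoC r).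
  { intros r. unfold Cconj, RtoC. simpl. f_equal. ring. }
  rewrite E. f_equal. generalize (seq 0 L). intros l. induction l as [|j l IH]; simpl; [symmetry; apply E|].
  rewrite Cplus_conj, Cmult_conj, IH, cis_conj. unfold cpx at 1 3. rewrite E. f_equal. f_equal. f_equal.
  rewrite opp_IZR. ring.
Qed.

(** The discrete transform is exact on the partial Fourier sum, and each of its
    coefficients is at most the supremum of the remainder. Counting the 2 K + 1
    low frequencies costs half a power of [K], the supremum norm the other half. *)
Lemma interpolation_error s t :
  0 <= s -> 1 / 2 < t ->
  exists C0, 0 <= C0 /\ forall K f B, (1 <= K)%nat -> Hs t f B ->
    hb s (fourier (tp K (fun xi => fourier f xi - dft (4 * K) f xi)%C))
      (C0 * Rpower (INR K) (- (t - s - 1)) * B).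
Proof.
  intros Hs' Ht. destruct (proj_error_sup t Ht) as [C1 [H1 HE]].
  exists (2 * Rpower 2 s * C1).
  split. { repeat apply Rmult_le_pos; auto; [lra|left; apply Rpower_pos]. }
  intros K f B HK Hf. pose proof (Hs_pos _ _ _ Hf) as HB.
  assert (HK1 : 1 <= INR K) by (apply (le_INR 1); auto).
  set (E := C1 * Rpower (INR K) (- (t - 1 / 2)) * B).
  assert (HE0 : 0 <= E) by (repeat apply Rmult_le_pos; auto; left; apply Rpower_pos).
  apply hb_le with (sqrt (2 * INR K + 1) * Rpower (1 + INR K) s * E).
  - assert (S1 : sqrt (2 * INR K + 1) <= 2 * Rpower (INR K) (1 / 2)).
    { replace (1 / 2) with (/ 2) by field. rewrite Rpower_sqrt by lra.
      replace (2 * sqrt (INR K)) with (sqrt (2 * 2 * INR K))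
        by (rewrite sqrt_mult, sqrt_square by lra; reflexivity).
      apply sqrt_le_1_alt. lra. }
    assert (S2 : Rpower (1 + INR K) s <= Rpower 2 s * Rpower (INR K) s).
    { rewrite Rpower_mult_distr by lra. apply Rle_Rpower_l; lra. }
    apply Rle_trans with (2 * Rpower (INR K) (1 / 2) * (Rpower 2 s * Rpower (INR K) s) * E).
    + apply Rmult_le_compat_r; auto. apply Rmult_le_compat; auto; [apply sqrt_pos|left; apply Rpower_pos].
    + unfold E. replace (- (t - s - 1)) with (1 / 2 + (s + - (t - 1 / 2))) by lra.
      rewrite !Rpower_plus. right. ring.
  - apply hb_tp_coef; auto. intros xi Hxi.
    assert (D : dft (4 * K) f xi = (fourier f xi + dft (4 * K) (fun x => f x - tp K (fourier f) x) xi)%C).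
    { rewrite <- (dft_tp (4 * K) K (fourier f) xi) at 1 by (auto; lia).
      rewrite <- dft_plus by lia. rewrite !dft_csum by lia. f_equal. apply csum_ext. intros; ring. }
    rewrite D.
    replace (fourier f xi - (fourier f xi + dft (4 * K) (fun x => f x - tp K (fourier f) x) xi))%C with
      (- dft (4 * K) (fun x => f x - tp K (fourier f) x) xi)%C by ring.
    rewrite Cmod_opp. apply dft_bound; [lia|]. apply HE; auto.
Qed.

(** * The scheme in Fourier variables *)

Lemma half_double K : (Z.of_nat (2 * K) / 2 = Z.of_nat K)%Z.
Proof. rewrite Nat2Z.inj_mul, Z.mul_comm. apply Z.div_mul. lia. Qed.

(** Membership in Y_(2K), with the coefficients made canonical. *)
Definition isY (K : nat) (f : R -> C) : Prop := forall x, f x = tp K (fourier f) x.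

Lemma isY_of_tp K c f : (forall x, f x = tp K c x) -> isY K f.
Proof.
  intros H x. rewrite H. apply tp_ext. intros xi Hxi.
  rewrite (fourier_ext f (tp K c)) by auto. rewrite fourier_tp_in; auto.
Qed.

Lemma isY_in_Y K f : in_Y (2 * K) f <-> isY K f.
Proof.
  unfold in_Y. rewrite half_double. split.
  - intros [c H]. apply (isY_of_tp K c). intros x. rewrite H. apply trig_sum_tp.
  - intros H. exists (fourier f). intros x. rewrite trig_sum_tp. apply H.
Qed.

Lemma isY_pc K f : isY K f -> pc f.
Proof. intros H. apply pc_ext with (tp K (fourier f)); [intros; symmetry; apply H|apply pc_tp]. Qed.

Lemma isY_tp K c : isY K (tp K c).
Proof. apply (isY_of_tp K c). auto. Qed.

Lemma isY_out K f xi : isY K f -> ~ In xi (zr K) -> fourier f xi = RtoC 0.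
Proof. intros H Hn. rewrite (fourier_ext f (tp K (fourier f))) by auto. apply fourier_tp_out; auto. Qed.

Lemma isY_plus_scal K a f b g : isY K f -> isY K g -> isY K (fun x => a * f x + b * g x)%C.
Proof.
  intros Hf Hg. apply (isY_of_tp K (fun xi => a * fourier f xi + b * fourier g xi)%C).
  intros x. rewrite tp_plus, !tp_scal, <- Hf, <- Hg. reflexivity.
Qed.

Lemma isY_half_sum K f g : isY K f -> isY K g -> isY K (half_sum f g).
Proof.
  intros Hf Hg x. rewrite half_sum_eq.
  pose proof (isY_plus_scal K (RtoC (/ 2)) f (RtoC (/ 2)) g Hf Hg x) as E. cbv beta in E.
  rewrite Cmult_plus_distr_l, E. apply tp_ext. intros xi _. apply fourier_ext. intros y.
  rewrite half_sum_eq. ring.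
Qed.

Lemma isY_minus K f g : isY K f -> isY K g -> isY K (fun x => f x - g x)%C.
Proof.
  intros Hf Hg x. pose proof (isY_plus_scal K (RtoC 1) f (- RtoC 1)%C g Hf Hg x) as E. cbv beta in E.
  replace (f x - g x)%C with (RtoC 1 * f x + - RtoC 1 * g x)%C by ring.
  rewrite E. apply tp_ext. intros xi _. apply fourier_ext. intros y. ring.
Qed.

Lemma proj_tp K f x : proj (2 * K) f x = tp K (fourier f) x.
Proof. unfold proj. rewrite half_double. apply trig_sum_tp. Qed.

Lemma fourier_trig_sum a b c xi :
  (a <= xi <= b)%Z -> fourier (trig_sum a b c) xi = c xi.
Proof.
  intros H. set (l := map (fun j => (a + Z.of_nat j)%Z) (seq 0 (Z.to_nat (b - a) + 1))).
  rewrite (fourier_ext _ (fun x => csum (fun z => c z * mode z x)%C l)).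
  - rewrite (fourier_csum (fun z x => c z * mode z x)%C).
    + rewrite (csum_single _ _ xi).
      * rewrite fourier_term. destruct (Z.eq_dec xi xi); tauto.
      * apply Injective_map_NoDup; [intros i j; lia|apply seq_NoDup].
      * apply in_map_iff. exists (Z.to_nat (xi - a)). split; [lia|]. apply in_seq. lia.
      * intros z _ Hz. rewrite fourier_term. destruct (Z.eq_dec xi z); congruence.
    + intros z _. apply pc_cts, pc_scal, pc_mode.
  - intros x. unfold trig_sum, l. rewrite sum_n_csum, csum_map. reflexivity.
Qed.

Lemma initial_tp K f x :
  (1 <= K)%nat -> proj (2 * K) (interp (2 * (2 * K)) f) x = tp K (dft (4 * K) f) x.
Proof.
  intros HK. rewrite proj_tp. apply tp_ext. intros xi Hxi. apply in_zr in Hxi.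
  unfold interp. replace (2 * (2 * K))%nat with (2 * (K + K))%nat by lia. rewrite half_double.
  rewrite fourier_trig_sum by lia. f_equal. lia.
Qed.

Lemma dC_isY K f : isY K f -> dC f (tp K (fun xi => dmul xi * fourier f xi)%C).
Proof.
  intros H. apply (dC_ext (tp K (fourier f)) _ (tp K (fun xi => dmul xi * fourier f xi)%C)); auto.
  apply dC_tp.
Qed.

Lemma fourier_Dx_pow K f k xi :
  isY K f -> (1 <= k)%nat ->
  fourier (Dx 1 (fun x => f x ^ k)%C) xi = (dmul xi * fourier (fun x => f x ^ k)%C xi)%C.
Proof.
  intros Hf Hk. destruct k as [|k]; [lia|]. pose proof (isY_pc K f Hf) as Pf.
  pose proof (dC_pow f _ k (dC_isY K f Hf)) as D.
  rewrite (fourier_ext _ _ xi (fun x => Dx_dC _ _ x D)).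
  apply fourier_deriv; auto; [apply pc_pow; auto|].
  apply cts_mult; [apply cts_const|]. apply cts_mult; [apply pc_cts, pc_pow; auto|apply cts_tp].
Qed.

Lemma Dx3_isY K f x : isY K f -> Dx 3 f x = tp K (fun xi => dmul xi ^ 3 * fourier f xi)%C x.
Proof. intros H. rewrite (Dx_ext 3 f (tp K (fourier f))) by auto. apply Dx_tp. Qed.

Lemma CN_step_tp k K eps tau w v x :
  (1 <= k)%nat -> 0 < tau -> isY K w -> isY K v ->
  ((v x - w x) / RtoC tau + RtoC (eps ^ 2) * Dx 3 (half_sum v w) x
     + RtoC (/ INR k) * proj (2 * K) (Dx 1 (fun y => (half_sum v w y ^ k)%C)) x)%C
  = tp K (fun xi => RtoC (/ tau) * defect k eps tau w v xi)%C x.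
Proof.
  intros Hk Htau Hw Hv. pose proof (isY_half_sum K v w Hv Hw) as Hh.
  rewrite (Dx3_isY K _ x Hh), proj_tp.
  assert (Ht : RtoC tau <> RtoC 0) by (intros E; apply RtoC_inj in E; lra).
  replace ((v x - w x) / RtoC tau)%C with (RtoC (/ tau) * v x + (- RtoC (/ tau)) * w x)%C
    by (unfold Cdiv; rewrite <- RtoC_inv by lra; ring).
  rewrite (Hv x), (Hw x) at 1. rewrite <- !tp_scal, <- !tp_plus.
  apply tp_ext. intros xi _. rewrite (fourier_Dx_pow K) by auto. unfold defect, Rdiv.
  rewrite !RtoC_mult.
  assert (Et : (RtoC (/ tau) * RtoC tau)%C = RtoC 1) by (rewrite <- RtoC_mult; f_equal; field; lra).
  match goal with |- _ = (?t * (?A - ?B + ?T * ?e * ?X + ?T * ?i * ?Y))%C =>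
    replace (t * (A - B + T * e * X + T * i * Y))%C with
     (t * A - t * B + (t * T) * (e * X) + (t * T) * (i * Y))%C by ring end.
  rewrite Et. ring.
Qed.

Lemma CN_step_defect k K eps tau w v :
  (1 <= k)%nat -> 0 < tau -> isY K w -> isY K v ->
  CN_step k (2 * K) eps tau w v <-> (forall xi, In xi (zr K) -> defect k eps tau w v xi = RtoC 0).
Proof.
  intros Hk Htau Hw Hv. unfold CN_step.
  assert (Ht : RtoC (/ tau) <> RtoC 0).
  { intros E; apply RtoC_inj in E. pose proof (Rinv_0_lt_compat _ Htau). lra. }
  split; intros H.
  - intros xi Hxi.
    assert (E : forall x, tp K (fun xi => RtoC (/ tau) * defect k eps tau w v xi)%C x = RtoC 0).
    { intros x. rewrite <- CN_step_tp by auto. apply H. }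
    pose proof (fourier_tp_in K (fun xi => RtoC (/ tau) * defect k eps tau w v xi)%C xi Hxi) as F.
    cbv beta in F. rewrite (fourier_ext _ _ xi E), fourier_zero in F. symmetry in F.
    destruct (Ceq_dec (defect k eps tau w v xi) (RtoC 0)) as [|Hn]; auto.
    exfalso. apply (Cmult_neq_0 _ _ Ht Hn). exact F.
  - intros x. rewrite CN_step_tp by auto. unfold tp. apply csum_zero. intros xi Hxi.
    rewrite H by auto. ring.
Qed.

(** Symbol of A_plus. Its real part is 1 and its conjugate is the symbol of
    A_minus, which is why A_plus is invertible with contractive inverse and
    A_plus^(-1) A_minus is an isometry. *)
Definition sym_plus (eps tau : R) (xi : Z) : C := (RtoC 1 + RtoC (/ 2 * eps ^ 2 * tau) * dmul xi ^ 3)%C.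
Definition sym_minus (eps tau : R) (xi : Z) : C := (RtoC 1 - RtoC (/ 2 * eps ^ 2 * tau) * dmul xi ^ 3)%C.

Lemma dmul_cube xi : (dmul xi ^ 3)%C = (0, - IZR xi ^ 3).
Proof.
  simpl. unfold dmul, Ci, RtoC, Cmult. cbn [fst snd]. f_equal; ring.
Qed.

Lemma sym_conj eps tau xi : Cconj (sym_plus eps tau xi) = sym_minus eps tau xi.
Proof.
  unfold sym_plus, sym_minus. rewrite dmul_cube. unfold RtoC.
  unfold Cconj, Cminus, Cplus, Copp, Cmult. cbn [fst snd]. f_equal; ring.
Qed.

Lemma sym_minus_neg eps tau xi : sym_minus eps tau (- xi) = sym_plus eps tau xi.
Proof.
  unfold sym_plus, sym_minus. rewrite !dmul_cube, opp_IZR. unfold RtoC.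
  unfold Cconj, Cminus, Cplus, Copp, Cmult. cbn [fst snd]. f_equal; ring.
Qed.

Lemma sym_plus_ge1 eps tau xi : 1 <= Cmod (sym_plus eps tau xi).
Proof.
  eapply Rle_trans; [|apply re_le_Cmod].
  replace (Re (sym_plus eps tau xi)) with 1; [rewrite Rabs_R1; lra|].
  unfold sym_plus. rewrite dmul_cube. unfold RtoC, Re, Cplus, Cmult. cbn [fst snd]. ring.
Qed.

Lemma sym_plus_neq0 eps tau xi : sym_plus eps tau xi <> RtoC 0.
Proof. apply Cmod_gt_0. pose proof (sym_plus_ge1 eps tau xi). lra. Qed.

Definition psi_coef (k : nat) (eps tau : R) (w phi : R -> C) (xi : Z) : C :=
  ((sym_minus eps tau xi * fourier w xi
    - RtoC (tau / INR k) * (dmul xi * fourier (fun x => half_sum w phi x ^ k) xi)) / sym_plus eps tau xi)%C.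

Definition psiF (k K : nat) (eps tau : R) (w phi : R -> C) : R -> C := tp K (psi_coef k eps tau w phi).

Lemma A_plus_tp eps tau K c x : A_plus eps tau (tp K c) x = tp K (fun xi => sym_plus eps tau xi * c xi)%C x.
Proof.
  unfold A_plus. rewrite Dx_tp, <- tp_scal, <- tp_plus. apply tp_ext. intros. unfold sym_plus. ring.
Qed.

Lemma A_plus_ext eps tau f g x : (forall y, f y = g y) -> A_plus eps tau f x = A_plus eps tau g x.
Proof. intros H. unfold A_plus. rewrite (Dx_ext 3 f g x H), H. reflexivity. Qed.

Lemma A_minus_isY eps tau K f x :
  isY K f -> A_minus eps tau f x = tp K (fun xi => sym_minus eps tau xi * fourier f xi)%C x.
Proof.
  intros H. unfold A_minus. rewrite (Dx3_isY K f x H), (H x) at 1.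
  replace (tp K (fourier f) x - RtoC (/ 2 * eps ^ 2 * tau) * tp K (fun xi => dmul xi ^ 3 * fourier f xi)%C x)%C
    with (tp K (fourier f) x + (- RtoC (/ 2 * eps ^ 2 * tau)) * tp K (fun xi => dmul xi ^ 3 * fourier f xi)%C x)%C
    by ring.
  rewrite <- tp_scal, <- tp_plus. apply tp_ext. intros. unfold sym_minus. ring.
Qed.

Lemma A_plus_inv_coef K eps tau f g c :
  is_A_plus_inv (2 * K) eps tau f g -> (forall x, f x = tp K c x) ->
  forall x, g x = tp K (fun xi => c xi / sym_plus eps tau xi)%C x.
Proof.
  intros [HY HA] Hf x. apply isY_in_Y in HY. rewrite (HY x). apply tp_ext. intros xi Hxi.
  assert (E : forall y, tp K (fun xi => sym_plus eps tau xi * fourier g xi)%C y = tp K c y).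
  { intros y. rewrite <- A_plus_tp, <- Hf, <- HA. symmetry. apply A_plus_ext. auto. }
  pose proof (fourier_ext _ _ xi E) as F. rewrite !fourier_tp_in in F by auto. rewrite <- F.
  field. apply sym_plus_neq0.
Qed.

Lemma A_plus_inv_exists K eps tau c :
  is_A_plus_inv (2 * K) eps tau (tp K c) (tp K (fun xi => c xi / sym_plus eps tau xi)%C).
Proof.
  split; [apply isY_in_Y, isY_tp|]. intros x. rewrite A_plus_tp. apply tp_ext. intros xi _.
  field. apply sym_plus_neq0.
Qed.

Lemma Dx_proj_pow k K w phi x :
  (1 <= k)%nat -> isY K w -> isY K phi ->
  Dx 1 (proj (2 * K) (fun x => (half_sum w phi x ^ k)%C)) x =
  tp K (fun xi => dmul xi * fourier (fun x => half_sum w phi x ^ k)%C xi)%C x.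
Proof.
  intros Hk Hw Hp. rewrite (Dx_ext 1 _ _ x (proj_tp K _)), Dx_tp. apply tp_ext.
  intros; simpl; ring.
Qed.

Lemma is_psi_psiF k K eps tau w phi :
  (1 <= k)%nat -> isY K w -> isY K phi ->
  is_psi k (2 * K) eps tau w phi (psiF k K eps tau w phi).
Proof.
  intros Hk Hw Hp.
  exists (tp K (fun xi => (sym_minus eps tau xi * fourier w xi) / sym_plus eps tau xi)%C).
  exists (tp K (fun xi => (dmul xi * fourier (fun x => half_sum w phi x ^ k) xi) / sym_plus eps tau xi)%C).
  split; [|split].
  - destruct (A_plus_inv_exists K eps tau (fun xi => sym_minus eps tau xi * fourier w xi)%C) as [A B].
    split; auto. intros x. rewrite B, (A_minus_isY eps tau K); auto.
  - destruct (A_plus_inv_exists K eps tau (fun xi => dmul xi * fourier (fun x => half_sum w phi x ^ k) xi)%C) as [A B].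
    split; auto. intros x. rewrite B, Dx_proj_pow; auto.
  - intros x. unfold psiF.
    match goal with |- _ = (?a - ?t * ?b)%C => replace (a - t * b)%C with (a + (- t) * b)%C by ring end.
    rewrite <- tp_scal, <- tp_plus. apply tp_ext. intros xi _. unfold psi_coef. field. apply sym_plus_neq0.
Qed.

Lemma is_psi_unique k K eps tau w phi g :
  (1 <= k)%nat -> isY K w -> isY K phi -> is_psi k (2 * K) eps tau w phi g ->
  forall x, g x = psiF k K eps tau w phi x.
Proof.
  intros Hk Hw Hp [a [b [Ha [Hb Hg]]]] x. rewrite Hg.
  rewrite (A_plus_inv_coef K eps tau _ a _ Ha (fun x => A_minus_isY eps tau K w x Hw) x).
  rewrite (A_plus_inv_coef K eps tau _ b _ Hb (fun x => Dx_proj_pow k K w phi x Hk Hw Hp) x).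
  match goal with |- (?a - ?t * ?b)%C = _ => replace (a - t * b)%C with (a + (- t) * b)%C by ring end.
  unfold psiF. rewrite <- tp_scal, <- tp_plus. apply tp_ext. intros xi _. unfold psi_coef. field.
  apply sym_plus_neq0.
Qed.

Definition real_valued (f : R -> C) : Prop := forall x, Cconj (f x) = f x.

(** The conjugate function has the same coefficients, so uniqueness applies. *)
Lemma real_of_coef f :
  pc f -> (forall xi, fourier f (- xi) = Cconj (fourier f xi)) -> real_valued f.
Proof.
  intros Hf H. assert (Hc : pc (fun x => Cconj (f x))).
  { destruct Hf as [P Q]. split; [intros x; rewrite P; auto|].
    apply cts_pair; simpl; [apply (cts_Re f Q)|].
    intros x. apply (continuous_opp (V := R_NormedModule)). apply (cts_Im f Q). }
  unfold real_valued. apply (fourier_unique _ _ Hc Hf). intros xi.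
  rewrite fourier_conj, H, Cconj_conj by (apply pc_cts; auto). reflexivity.
Qed.

Lemma real_tp K c : (forall xi, c (- xi)%Z = Cconj (c xi)) -> real_valued (tp K c).
Proof.
  intros H. apply real_of_coef; [apply pc_tp|]. intros xi.
  destruct (in_dec Z.eq_dec xi (zr K)) as [Hi|Hn].
  - rewrite !fourier_tp_in; auto. rewrite in_zr in *. lia.
  - rewrite !fourier_tp_out; auto; [|rewrite in_zr in *; lia].
    unfold Cconj, RtoC. simpl. f_equal. ring.
Qed.

Lemma Cconj_RtoC r : Cconj (RtoC r) = RtoC r.
Proof. unfold Cconj, RtoC. simpl. f_equal. ring. Qed.

Lemma real_half_sum v w : real_valued v -> real_valued w -> real_valued (half_sum v w).
Proof.
  intros Hv Hw x. rewrite half_sum_eq, Cmult_conj, Cplus_conj, Cconj_RtoC, Hv, Hw. reflexivity.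
Qed.

Lemma dmul_neg xi : dmul (- xi) = Cconj (dmul xi).
Proof. unfold dmul, Ci, RtoC, Cmult, Cconj. cbn [fst snd]. rewrite opp_IZR. f_equal; ring. Qed.

Lemma real_psiF k K eps tau w phi :
  isY K w -> isY K phi -> real_valued w -> real_valued phi -> real_valued (psiF k K eps tau w phi).
Proof.
  intros Yw Yp Hw Hp. apply real_tp. intros xi. unfold psi_coef.
  rewrite sym_minus_neg. rewrite <- (sym_minus_neg eps tau (- xi)), Z.opp_involutive.
  assert (Ch : cts (fun x => half_sum w phi x ^ k)%C).
  { apply pc_cts, pc_pow, pc_half_sum; eapply isY_pc; eauto. }
  rewrite (fourier_real w) by (auto; apply pc_cts, (isY_pc K); auto).
  rewrite (fourier_real (fun x => half_sum w phi x ^ k)%C); auto.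
  2:{ intros x. rewrite Cpow_conj, real_half_sum; auto. }
  rewrite dmul_neg, Cdiv_conj, Cminus_conj, !Cmult_conj, Cconj_RtoC by apply sym_plus_neq0.
  rewrite <- (sym_conj eps tau xi), Cconj_conj. reflexivity.
Qed.

(** * Solvability of the implicit step *)

Lemma hb_tp_cut s K a c A M :
  0 <= M -> (forall xi, In xi (zr K) -> Cmod (c xi) <= M * Cmod (a xi)) -> hb s a A ->
  hb s (fourier (tp K c)) (M * A).
Proof.
  intros HM H Ha. apply hb_dom with s a; auto. intros xi. pose proof (wt_pos s xi).
  pose proof (Cmod_ge_0 (a xi)).
  destruct (in_dec Z.eq_dec xi (zr K)) as [Hi|Hn].
  - rewrite fourier_tp_in by auto. specialize (H xi Hi).
    replace (M * (wt s xi * Cmod (a xi))) with (wt s xi * (M * Cmod (a xi))) by ring.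
    apply Rmult_le_compat_l; lra.
  - rewrite fourier_tp_out, Cmod_0, Rmult_0_r by auto. apply Rmult_le_pos; nra.
Qed.

Lemma Cmod_dmul_zr K xi : In xi (zr K) -> Cmod (dmul xi) <= INR K.
Proof.
  intros H. apply in_zr in H. rewrite Cmod_dmul, <- abs_IZR, INR_IZR_INZ. apply IZR_le. lia.
Qed.

Lemma Cmod_sym eps tau xi : Cmod (sym_minus eps tau xi) = Cmod (sym_plus eps tau xi).
Proof. rewrite <- sym_conj. apply Cmod_conj. Qed.

(** The solution operator of the linear part is bounded by 1, so that the
    derivative in the nonlinear part costs exactly one factor [K], which the
    step-size restriction absorbs. *)
Lemma flux_coef_bound (k K : nat) eps tau F xi :
  (1 <= k)%nat -> 0 < tau -> In xi (zr K) ->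
  Cmod (RtoC (tau / INR k) * (dmul xi * F) / sym_plus eps tau xi)%C <= tau * INR K * Cmod F.
Proof.
  intros Hk Ht Hxi. assert (K1 : 1 <= INR k) by (apply (le_INR 1); auto).
  rewrite Cmod_div by apply sym_plus_neq0. rewrite !Cmod_mult, Cmod_R.
  assert (K2 : 0 <= tau / INR k <= tau).
  { unfold Rdiv. assert (0 < / INR k) by (apply Rinv_0_lt_compat; lra).
    assert (/ INR k <= 1) by (rewrite <- Rinv_1; apply Rinv_le_contravar; lra). nra. }
  rewrite Rabs_pos_eq by lra. pose proof (Cmod_dmul_zr K xi Hxi). pose proof (Cmod_ge_0 (dmul xi)).
  pose proof (Cmod_ge_0 F). pose proof (sym_plus_ge1 eps tau xi) as S1.
  assert (0 <= tau / INR k * (Cmod (dmul xi) * Cmod F))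
    by (apply Rmult_le_pos; [lra|apply Rmult_le_pos; auto]).
  apply Rle_trans with (tau / INR k * (Cmod (dmul xi) * Cmod F)).
  - unfold Rdiv at 1. rewrite <- (Rmult_1_r (tau / INR k * (Cmod (dmul xi) * Cmod F))) at 2.
    apply Rmult_le_compat_l; auto. rewrite <- Rinv_1. apply Rinv_le_contravar; lra.
  - rewrite <- Rmult_assoc. apply Rmult_le_compat_r; auto. apply Rmult_le_compat; lra.
Qed.

(** The isometric linear part keeps the norm of [w] and the flux adds at most 1. *)
Lemma psiF_bound s k R :
  1 / 2 < s -> (1 <= k)%nat -> 0 <= R ->
  exists P, 0 <= P /\ forall K eps tau w phi,
    0 < tau -> tau * INR K * P <= 1 -> Hs s w R -> Hs s phi (R + 1) ->
    Hs s (psiF k K eps tau w phi) (R + 1).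
Proof.
  intros Hs' Hk HR. destruct (Hs_pow_bound s Hs') as [C0 [H0 HP]].
  exists ((C0 * (R + 1)) ^ k). split. { apply pow_le; nra. }
  intros K eps tau w phi Ht Hsm Hw Hp.
  assert (Hh : Hs s (half_sum w phi) (R + 1)).
  { apply Hs_le with (/ 2 * (R + (R + 1))); [lra|]. apply Hs_half_sum; auto. }
  pose proof (HP k _ _ Hh) as Hhk. cbv beta in Hhk.
  set (F := fourier (fun x => half_sum w phi x ^ k)%C) in *.
  apply Hs_ext with (fun x => tp K (fun xi => sym_minus eps tau xi * fourier w xi / sym_plus eps tau xi)%C x
     + tp K (fun xi => (- RtoC 1) * (RtoC (tau / INR k) * (dmul xi * F xi) / sym_plus eps tau xi))%C x)%C.
  { intros x. rewrite <- tp_plus. apply tp_ext. intros xi _. unfold psi_coef. fold F. field.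
    apply sym_plus_neq0. }
  apply Hs_plus; split; try apply pc_tp.
  - rewrite <- (Rmult_1_l R). apply hb_tp_cut with (fourier w); [lra| |apply Hw].
    intros xi _. rewrite Cmod_div, Cmod_mult, Cmod_sym by apply sym_plus_neq0.
    right. field. pose proof (sym_plus_ge1 eps tau xi). lra.
  - apply hb_le with (tau * INR K * (C0 * (R + 1)) ^ k); auto.
    apply hb_tp_cut with F; [|intros xi Hxi; rewrite Cmod_mult, Cmod_opp, Cmod_1, Rmult_1_l; apply flux_coef_bound; auto|apply Hhk].
    apply Rmult_le_pos; [lra|apply pos_INR].
Qed.

(** The second conclusion, on the flux itself, serves to pass to the limit in the
    identity between consecutive iterates. *)
Lemma psiF_contraction s k A :
  1 / 2 < s -> (1 <= k)%nat -> 0 <= A ->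
  exists P, 0 <= P /\ forall K eps tau w phi phi' d,
    0 < tau -> tau * INR K * P <= 1 -> Hs s w A -> Hs s phi A -> Hs s phi' A ->
    Hs s (fun x => phi x - phi' x)%C d ->
    Hs s (fun x => psiF k K eps tau w phi x - psiF k K eps tau w phi' x)%C (/ 2 * d) /\
    forall xi, Cmod (fourier (fun x => half_sum w phi x ^ k)%C xi - fourier (fun x => half_sum w phi' x ^ k)%C xi)%C
      <= P * d.
Proof.
  intros Hs' Hk HA. destruct (Hs_pow_diff s k A Hs' HA) as [D [HD HP]].
  exists D. split; auto. intros K eps tau w phi phi' d Ht Hsm Hw Hp Hp' Hd.
  pose proof (Hs_pos _ _ _ Hd) as Hd0.
  assert (Hh : Hs s (half_sum w phi) A).
  { apply Hs_le with (/ 2 * (A + A)); [lra|]. apply Hs_half_sum; auto. }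
  assert (Hh' : Hs s (half_sum w phi') A).
  { apply Hs_le with (/ 2 * (A + A)); [lra|]. apply Hs_half_sum; auto. }
  assert (Hhh : Hs s (fun x => half_sum w phi x - half_sum w phi' x)%C (/ 2 * d)).
  { apply Hs_ext with (fun x => RtoC (/ 2) * (phi x - phi' x))%C; [|apply Hs_half; auto].
    intros x. rewrite !half_sum_eq. ring. }
  pose proof (HP _ _ _ Hh Hh' Hhh) as Hk'. cbv beta in Hk'.
  set (F := fourier (fun x => half_sum w phi x ^ k)%C).
  set (F' := fourier (fun x => half_sum w phi' x ^ k)%C).
  assert (HF : hb s (fun xi => F xi - F' xi)%C (D * (/ 2 * d))).
  { apply hb_ext with (fourier (fun x => half_sum w phi x ^ k - half_sum w phi' x ^ k)%C); [|apply Hk'].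
    intros xi. apply fourier_minus; apply pc_cts, pc_pow; [apply Hh|apply Hh']. }
  split.
  - apply Hs_ext with (tp K (fun xi => (- RtoC 1) * (RtoC (tau / INR k) * (dmul xi * (F xi - F' xi)) / sym_plus eps tau xi))%C).
    { intros x. unfold psiF.
      match goal with |- _ = (?a - ?b)%C => replace (a - b)%C with (a + (- RtoC 1) * b)%C by ring end.
      rewrite <- tp_scal, <- tp_plus. apply tp_ext. intros xi _. unfold psi_coef. fold (F xi) (F' xi).
      field. apply sym_plus_neq0. }
    split; [apply pc_tp|]. apply hb_le with (tau * INR K * (D * (/ 2 * d))).
    { replace (tau * INR K * (D * (/ 2 * d))) with ((tau * INR K * D) * (/ 2 * d)) by ring. nra. }
    apply hb_tp_cut with (fun xi => F xi - F' xi)%C; auto.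
    { apply Rmult_le_pos; [lra|apply pos_INR]. }
    intros xi Hxi. rewrite Cmod_mult, Cmod_opp, Cmod_1, Rmult_1_l. apply flux_coef_bound; auto.
  - intros xi. eapply Rle_trans; [apply (hb_coef0 s (fun xi => F xi - F' xi)%C _ xi ltac:(lra) HF)|].
    assert (0 <= D * d) by nra. lra.
Qed.

Lemma isY_Hs K f s : 0 <= s -> isY K f -> exists B, Hs s f B.
Proof.
  intros Hs' HY. set (E := rsum (fun xi => Cmod (fourier f xi)) (zr K)).
  exists (sqrt (2 * INR K + 1) * Rpower (1 + INR K) s * E).
  apply Hs_ext with (tp K (fourier f)); [intros; symmetry; apply HY|].
  split; [apply pc_tp|]. apply hb_tp_coef; auto.
  - apply rsum_ge0. intros; apply Cmod_ge_0.
  - intros xi Hxi. apply Rle_trans with (rsum (fun xi => Cmod (fourier f xi)) [xi]).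
    + simpl. lra.
    + apply rsum_incl; [constructor; [intros []|constructor]| |intros; apply Cmod_ge_0].
      intros z [<-|[]]; auto.
Qed.

Lemma iterates_bound s k R :
  1 / 2 < s -> (1 <= k)%nat -> 0 <= R ->
  exists P, 0 <= P /\ forall K eps tau w phi,
    0 < tau -> tau * INR K * P <= 1 -> isY K w -> Hs s w R -> real_valued w ->
    (forall x, phi 0%nat x = w x) ->
    (forall i, is_psi k (2 * K) eps tau w (phi i) (phi (S i))) ->
    forall i, isY K (phi i) /\ Hs s (phi i) (R + 1) /\ real_valued (phi i).
Proof.
  intros Hs' Hk HR. destruct (psiF_bound s k R Hs' Hk HR) as [P [HP HB]].
  exists P. split; auto. intros K eps tau w phi Ht Hsm Yw Hw Rw H0 Hi.
  induction i as [|i [Y [H Rl]]].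
  - split; [|split].
    + apply (isY_of_tp K (fourier w)). intros x. rewrite H0. apply Yw.
    + apply Hs_ext with w; [intros; symmetry; auto|]. apply Hs_le with R; auto. lra.
    + intros x. rewrite H0. apply Rw.
  - pose proof (is_psi_unique k K eps tau w (phi i) (phi (S i)) Hk Yw Y (Hi i)) as E.
    split; [|split].
    + apply (isY_of_tp K _ _ E).
    + apply Hs_ext with (psiF k K eps tau w (phi i)); [intros; symmetry; auto|]. apply HB; auto.
    + intros x. rewrite E. apply real_psiF; auto.
Qed.

(** All iterates are real and lie in the ball of radius R + 1. Convergence of the
    coefficients carries both properties over to the limit, whatever the norm in
    which the iteration converges. *)
Lemma fixed_point_limit_bound s k R :
  1 / 2 < s -> (1 <= k)%nat -> 0 <= R ->
  exists P, 0 <= P /\ forall K r eps tau w v,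
    0 <= r -> 0 < tau -> tau * INR K * P <= 1 -> isY K w -> Hs s w R -> real_valued w -> isY K v ->
    is_fixed_point_limit k (2 * K) r eps tau w v ->
    Hs s v (R + 1) /\ real_valued v.
Proof.
  intros Hs' Hk HR. destruct (iterates_bound s k R Hs' Hk HR) as [P [HP HB]].
  exists P. split; auto. intros K r eps tau w v Hr Ht Hsm Yw Hw Rw Yv [phi [H0 [Hi Hlim]]].
  pose proof (HB K eps tau w phi Ht Hsm Yw Hw Rw H0 Hi) as It.
  assert (Pv : pc v) by (apply (isY_pc K); auto).
  assert (Close : forall e, 0 < e -> exists i, forall xi, Cmod (fourier (phi i) xi - fourier v xi)%C <= e).
  { intros e He. destruct (proj1 (is_lim_seq_Reals _ _) Hlim e He) as [n Hn].
    exists n. intros xi. specialize (Hn n (le_n n)). unfold Rdist in Hn. rewrite Rminus_0_r in Hn.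
    destruct (It n) as [Y _].
    destruct (isY_Hs K (fun x => phi n x - v x)%C r Hr (isY_minus K _ _ Y Yv)) as [B HBn].
    destruct (in_H_of_hb r _ B HBn) as [IH _].
    pose proof (hb_of_in_H r _ (Hnorm r (fun x => phi n x - v x)%C) (conj IH (Rle_refl _))) as [_ Hh].
    rewrite <- fourier_minus by (apply pc_cts; auto; apply (isY_pc K); auto).
    eapply Rle_trans; [apply (hb_coef0 r _ _ xi Hr Hh)|].
    pose proof (Rle_abs (Hnorm r (fun x => phi n x - v x)%C)). lra. }
  split.
  - split; auto. apply hb_approx with (fun _ => 1); [lra|]. intros e He.
    destruct (Close e He) as [i Hc]. exists (fourier (phi i)). split; [apply It|].
    intros xi. rewrite Rmult_1_r, <- Cmod_opp.
    replace (- (fourier v xi - fourier (phi i) xi))%C with (fourier (phi i) xi - fourier v xi)%C by ring. auto.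
  - apply real_of_coef; auto. intros xi.
    assert (E : Cmod (fourier v (- xi) - Cconj (fourier v xi))%C <= 0).
    { apply le_of_eps with 2; [lra|]. intros e He. destruct (Close e He) as [i Hc].
      destruct (It i) as [Yi [_ Ri]].
      pose proof (fourier_real (phi i) xi (pc_cts _ (isY_pc K _ Yi)) Ri) as Fi.
      replace (fourier v (- xi) - Cconj (fourier v xi))%C with
        (- (fourier (phi i) (- xi) - fourier v (- xi)) + Cconj (fourier (phi i) xi - fourier v xi))%C.
      - eapply Rle_trans; [apply Cmod_triangle|]. rewrite Cmod_opp, Cmod_conj.
        pose proof (Hc xi). pose proof (Hc (- xi)%Z). lra.
      - rewrite Cminus_conj, <- Fi. ring. }
    assert (E' : (fourier v (- xi) - Cconj (fourier v xi))%C = RtoC 0).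
    { apply Cmod_eq_0. pose proof (Cmod_ge_0 (fourier v (- xi) - Cconj (fourier v xi))%C). lra. }
    replace (fourier v (- xi)) with (fourier v (- xi) - Cconj (fourier v xi) + Cconj (fourier v xi))%C by ring.
    rewrite E'. ring.
Qed.

Lemma le_0_of_geom x M : (forall i : nat, x <= M * (1 / 2) ^ i) -> x <= 0.
Proof.
  intros H. apply le_of_eps with (Rabs M); [apply Rabs_pos|]. intros e He.
  destruct (pow_lt_1_zero (1 / 2) ltac:(rewrite Rabs_pos_eq; lra) e He) as [n Hn].
  specialize (Hn n (le_n n)). specialize (H n).
  assert (P : 0 <= (1 / 2) ^ n) by (apply pow_le; lra). rewrite Rabs_pos_eq in Hn by auto.
  pose proof (Rle_abs M). pose proof (Rabs_pos M). nra.
Qed.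

Lemma geom_limit_R (a : nat -> R) Q :
  (forall i, Rabs (a (S i) - a i) <= Q * (1 / 2) ^ i) ->
  forall i, Rabs (a i - real (Lim_seq a)) <= 2 * Q * (1 / 2) ^ i.
Proof.
  intros H.
  assert (Q0 : 0 <= Q) by (specialize (H 0%nat); simpl in H; pose proof (Rabs_pos (a 1%nat - a 0%nat)); lra).
  assert (P : forall i, 0 <= (1 / 2) ^ i) by (intros; apply pow_le; lra).
  assert (K : forall m i, Rabs (a i - a (i + m)%nat) <= 2 * Q * (1 / 2) ^ i).
  { intros m i.
    assert (K' : Rabs (a i - a (i + m)%nat) <= 2 * Q * (1 / 2) ^ i - 2 * Q * (1 / 2) ^ (i + m)).
    { induction m as [|m IH]; [rewrite Nat.add_0_r, Rminus_eq_0, Rminus_eq_0, Rabs_R0; lra|].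
      replace (i + S m)%nat with (S (i + m)) by lia.
      replace (a i - a (S (i + m))) with ((a i - a (i + m)%nat) - (a (S (i + m)) - a (i + m)%nat)) by ring.
      eapply Rle_trans; [apply Rabs_triang|]. rewrite Rabs_Ropp. specialize (H (i + m)%nat).
      simpl pow. lra. }
    pose proof (P (i + m)%nat). nra. }
  assert (Ex : ex_finite_lim_seq a).
  { apply ex_lim_seq_cauchy_corr. intros [e He]. simpl.
    destruct (pow_lt_1_zero (1 / 2) ltac:(rewrite Rabs_pos_eq; lra) (e / (4 * Q + 1))
      ltac:(apply Rdiv_lt_0_compat; lra)) as [n Hn].
    specialize (Hn n (le_n n)). rewrite Rabs_pos_eq in Hn by auto.
    exists n. intros p q Hp Hq.
    pose proof (K (p - n)%nat n) as K1. pose proof (K (q - n)%nat n) as K2.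
    replace (n + (p - n))%nat with p in K1 by lia. replace (n + (q - n))%nat with q in K2 by lia.
    replace (a p - a q) with (- (a n - a p) + (a n - a q)) by ring.
    eapply Rle_lt_trans; [apply Rabs_triang|]. rewrite Rabs_Ropp.
    apply (Rmult_lt_compat_l (4 * Q + 1)) in Hn; [|lra].
    replace ((4 * Q + 1) * (e / (4 * Q + 1))) with e in Hn by (field; lra).
    pose proof (P n). nra. }
  apply Lim_seq_correct' in Ex. intros i.
  assert (L : is_lim_seq (fun m => Rabs (a i - a (i + m)%nat)) (Rabs (a i - real (Lim_seq a)))).
  { apply (is_lim_seq_abs _ (a i - real (Lim_seq a))). apply is_lim_seq_minus'; [apply is_lim_seq_const|].
    apply (is_lim_seq_ext (fun m => a (m + i)%nat)); [intros; f_equal; lia|].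
    apply -> is_lim_seq_incr_n. exact Ex. }
  apply (is_lim_seq_le _ _ _ _ (fun m => K m i) L (is_lim_seq_const _)).
Qed.

(** A total choice of limit, so that a whole family of coefficients can be passed
    to the limit at once. *)
Definition clim (a : nat -> C) : C :=
  (real (Lim_seq (fun i => Re (a i))), real (Lim_seq (fun i => Im (a i)))).

Lemma geom_limit_C (a : nat -> C) Q :
  (forall i, Cmod (a (S i) - a i)%C <= Q * (1 / 2) ^ i) ->
  forall i, Cmod (a i - clim a)%C <= 4 * Q * (1 / 2) ^ i.
Proof.
  intros H i.
  assert (HI : forall z : C, Rabs (Im z) <= Cmod z).
  { intros z. eapply Rle_trans; [|apply Rmax_Cmod]. apply (Rmax_r (Rabs (fst z))). }
  pose proof (geom_limit_R (fun i => Re (a i)) Q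
    (fun i => Rle_trans _ _ _ (re_le_Cmod (a (S i) - a i)%C) (H i)) i) as L1.
  pose proof (geom_limit_R (fun i => Im (a i)) Q
    (fun i => Rle_trans _ _ _ (HI (a (S i) - a i)%C) (H i)) i) as L2.
  eapply Rle_trans; [apply Cmod_2Rmax|].
  assert (S2 : sqrt 2 <= 2).
  { replace 2 with (sqrt (2 * 2)) at 2 by (apply sqrt_square; lra). apply sqrt_le_1_alt; lra. }
  replace (4 * Q * (1 / 2) ^ i) with (2 * (2 * Q * (1 / 2) ^ i)) by ring.
  apply Rmult_le_compat; auto; [apply sqrt_pos| |].
  - eapply Rle_trans; [apply Rabs_pos|apply Rmax_l].
  - apply Rmax_lub; [exact L1|exact L2].
Qed.

Lemma defect_sym k eps tau w v xi :
  cts w -> cts v ->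
  defect k eps tau w v xi = (sym_plus eps tau xi * fourier v xi - sym_minus eps tau xi * fourier w xi
    + RtoC (tau / INR k) * (dmul xi * fourier (fun x => half_sum w v x ^ k) xi))%C.
Proof.
  intros Cw Cv. unfold defect, sym_plus, sym_minus. rewrite fourier_half_sum by auto.
  rewrite (fourier_ext (fun x => half_sum v w x ^ k)%C (fun x => half_sum w v x ^ k)%C).
  - rewrite !RtoC_mult. ring.
  - intros x. rewrite !half_sum_eq, (Cplus_comm (v x)). reflexivity.
Qed.

(** The iteration contracts by a factor 1/2 in H^s inside the ball of radius
    R + 1. On a space of fixed finite dimension the convergence then takes place in
    every H^r as well. *)
Lemma step_exists s k R :
  1 / 2 < s -> (1 <= k)%nat -> 0 <= R ->
  exists P, 0 <= P /\ forall K r eps tau w,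
    0 <= r -> 0 < tau -> tau * INR K * P <= 1 -> isY K w -> Hs s w R -> real_valued w ->
    exists v, isY K v /\ CN_step k (2 * K) eps tau w v /\
      is_fixed_point_limit k (2 * K) r eps tau w v.
Proof.
  intros Hs' Hk HR. destruct (iterates_bound s k R Hs' Hk HR) as [P1 [HP1 HB]].
  destruct (psiF_contraction s k (R + 1) Hs' Hk ltac:(lra)) as [P2 [HP2 HC]].
  exists (P1 + P2). split; [lra|]. intros K r eps tau w Hr Ht Hsm Yw Hw Rw.
  assert (HtK : 0 <= tau * INR K) by (apply Rmult_le_pos; [lra|apply pos_INR]).
  assert (Sm1 : tau * INR K * P1 <= 1) by nra. assert (Sm2 : tau * INR K * P2 <= 1) by nra.
  set (phi := fix phi (i : nat) := match i with O => w | S j => psiF k K eps tau w (phi j) end).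
  assert (YI : forall i, isY K (phi i)).
  { intros [|i]; [exact Yw|]. apply isY_tp. }
  assert (Psi : forall i, is_psi k (2 * K) eps tau w (phi i) (phi (S i))).
  { intros i. apply is_psi_psiF; auto. }
  pose proof (HB K eps tau w phi Ht Sm1 Yw Hw Rw (fun x => eq_refl) Psi) as It.
  set (Q := 2 * (R + 1)).
  assert (Hw' : Hs s w (R + 1)) by (apply Hs_le with R; auto; lra).
  assert (Dif : forall i, Hs s (fun x => phi (S i) x - phi i x)%C (Q * (1 / 2) ^ i)).
  { induction i as [|i IH].
    - simpl pow. rewrite Rmult_1_r. unfold Q.
      replace (2 * (R + 1)) with ((R + 1) + (R + 1)) by ring. apply Hs_minus; apply It.
    - replace (Q * (1 / 2) ^ S i) with (/ 2 * (Q * (1 / 2) ^ i)) by (simpl pow; field).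
      apply (HC K eps tau w (phi (S i)) (phi i)); auto; apply It. }
  assert (Pp : forall i, pc (phi i)) by (intros; apply (isY_pc K); auto).
  set (c := fun xi => clim (fun i => fourier (phi i) xi)).
  assert (Hc : forall i xi, Cmod (fourier (phi i) xi - c xi)%C <= 4 * Q * (1 / 2) ^ i).
  { intros i xi. apply (geom_limit_C (fun i => fourier (phi i) xi)). intros j.
    rewrite <- fourier_minus by (apply pc_cts; auto).
    apply (hb_coef0 s _ _ xi ltac:(lra) (proj2 (Dif j))). }
  set (v := tp K c).
  assert (Yv : isY K v) by apply isY_tp. assert (Pv : pc v) by apply pc_tp.
  assert (Hq : forall i, 0 <= 4 * Q * (1 / 2) ^ i).
  { intros i. assert (0 <= (1 / 2) ^ i) by (apply pow_le; lra). unfold Q. nra. }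
  assert (Err : forall t, 0 <= t -> forall i, Hs t (fun x => phi i x - v x)%C
     (sqrt (2 * INR K + 1) * Rpower (1 + INR K) t * (4 * Q * (1 / 2) ^ i))).
  { intros t Ht' i. apply Hs_ext with (tp K (fun xi => fourier (phi i) xi - c xi)%C).
    - intros x. unfold v. rewrite (YI i x).
      match goal with |- _ = (?a - ?b)%C => replace (a - b)%C with (a + (- RtoC 1) * b)%C by ring end.
      rewrite <- tp_scal, <- tp_plus. apply tp_ext. intros; ring.
    - split; [apply pc_tp|]. apply hb_tp_coef; auto. }
  assert (Lim : is_fixed_point_limit k (2 * K) r eps tau w v).
  { exists phi. split; [reflexivity|]. split; [exact Psi|].
    apply (is_lim_seq_le_le (fun _ => 0) _ (fun i => sqrt (2 * INR K + 1) * Rpower (1 + INR K) r * (4 * Q) * (1 / 2) ^ i)).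
    - intros i. split; [apply sqrt_pos|].
      replace (sqrt (2 * INR K + 1) * Rpower (1 + INR K) r * (4 * Q) * (1 / 2) ^ i) with
        (sqrt (2 * INR K + 1) * Rpower (1 + INR K) r * (4 * Q * (1 / 2) ^ i)) by ring.
      apply in_H_of_hb. apply Err; auto.
    - apply is_lim_seq_const.
    - replace (Rbar.Finite 0) with (Rbar_mult (sqrt (2 * INR K + 1) * Rpower (1 + INR K) r * (4 * Q)) 0).
      + apply is_lim_seq_scal_l. apply is_lim_seq_geom. rewrite Rabs_pos_eq; lra.
      + simpl. f_equal. ring. }
  exists v. split; auto. split; auto.
  apply CN_step_defect; auto. intros xi Hxi.
  rewrite defect_sym by (apply pc_cts; auto; apply Hw).
  (* the ball of radius R + 1 is closed under coefficientwise convergence *)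
  assert (Hv : Hs s v (R + 1)).
  { split; auto. apply hb_approx with (fun _ => 4 * Q); [lra|]. intros e He.
    destruct (pow_lt_1_zero (1 / 2) ltac:(rewrite Rabs_pos_eq; lra) e He) as [n Hn].
    specialize (Hn n (le_n n)). assert (Pn : 0 <= (1 / 2) ^ n) by (apply pow_le; lra).
    rewrite Rabs_pos_eq in Hn by auto.
    exists (fourier (phi n)). split; [apply It|]. intros z.
    rewrite <- Cmod_opp. replace (- (fourier v z - fourier (phi n) z))%C with (fourier (phi n) z - fourier v z)%C by ring.
    apply Rle_trans with (4 * Q * (1 / 2) ^ n); [|unfold Q; nra].
    destruct (in_dec Z.eq_dec z (zr K)).
    - unfold v. rewrite fourier_tp_in by auto. apply Hc.
    - rewrite !(isY_out K) by auto. replace (RtoC 0 - RtoC 0)%C with (RtoC 0) by ring. rewrite Cmod_0. auto. }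
  apply Cmod_eq_0. apply Rle_antisym; [|apply Cmod_ge_0].
  set (M := sqrt (2 * INR K + 1) * Rpower (1 + INR K) s * (4 * Q)).
  apply le_0_of_geom with (Cmod (sym_plus eps tau xi) * (4 * Q) + Cmod (RtoC (tau / INR k)) * (Cmod (dmul xi) * (P2 * M))).
  intros i.
  assert (Ei : (sym_plus eps tau xi * fourier (phi (S i)) xi - sym_minus eps tau xi * fourier w xi
    + RtoC (tau / INR k) * (dmul xi * fourier (fun x => half_sum w (phi i) x ^ k) xi))%C = RtoC 0).
  { change (phi (S i)) with (tp K (psi_coef k eps tau w (phi i))). rewrite fourier_tp_in by auto.
    unfold psi_coef. field. apply sym_plus_neq0. }
  destruct (HC K eps tau w (phi i) v _ Ht Sm2 Hw' (proj1 (proj2 (It i))) Hv (Err s ltac:(lra) i)) as [_ HF].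
  specialize (HF xi).
  set (F := fourier (fun x => half_sum w (phi i) x ^ k)%C xi) in *.
  set (F' := fourier (fun x => half_sum w v x ^ k)%C xi) in *.
  replace (sym_plus eps tau xi * fourier v xi - sym_minus eps tau xi * fourier w xi +
     RtoC (tau / INR k) * (dmul xi * F'))%C with
   ((- sym_plus eps tau xi) * (fourier (phi (S i)) xi - fourier v xi)
     + (- RtoC (tau / INR k)) * (dmul xi * (F - F')))%C.
  2:{ match goal with |- ?a = ?b => replace b with (b - (sym_plus eps tau xi * fourier (phi (S i)) xi - sym_minus eps tau xi * fourier w xi
    + RtoC (tau / INR k) * (dmul xi * F)))%C by (rewrite Ei; ring) end. ring. }
  eapply Rle_trans; [apply Cmod_triangle|]. rewrite !Cmod_mult, !Cmod_opp, Rmult_plus_distr_r.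
  apply Rplus_le_compat.
  - rewrite Rmult_assoc. apply Rmult_le_compat_l; [apply Cmod_ge_0|].
    assert (E : fourier v xi = c xi) by (apply fourier_tp_in; auto). rewrite E.
    eapply Rle_trans; [apply Hc|]. specialize (Hq i). simpl pow. lra.
  - rewrite !Rmult_assoc. apply Rmult_le_compat_l; [apply Cmod_ge_0|].
    apply Rmult_le_compat_l; [apply Cmod_ge_0|].
    eapply Rle_trans; [exact HF|]. right. unfold M. ring.
Qed.

(** * Error propagation *)

Definition nrm (s : R) (K : nat) (a : Z -> C) : R :=
  sqrt (rsum (fun xi => (wt s xi * Cmod (a xi)) ^ 2) (zr K)).

Lemma nrm_sq s K a : nrm s K a ^ 2 = rsum (fun xi => (wt s xi * Cmod (a xi)) ^ 2) (zr K).
Proof. apply pow2_sqrt. apply rsum_ge0. intros; apply pow2_ge_0. Qed.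

Lemma nrm_pos s K a : 0 <= nrm s K a.
Proof. apply sqrt_pos. Qed.

Lemma hb_tp_nrm s K a : hb s (fourier (tp K a)) (nrm s K a).
Proof.
  split; [apply nrm_pos|]. intros l Hl. rewrite nrm_sq.
  eapply Rle_trans; [apply (rsum_support _ K); auto|].
  - intros; apply pow2_ge_0.
  - intros xi Hn. rewrite fourier_tp_out, Cmod_0 by auto. ring.
  - right. apply rsum_ext. intros xi Hxi. rewrite fourier_tp_in; auto.
Qed.

Lemma nrm_le s K a b A : (forall xi, In xi (zr K) -> a xi = b xi) -> hb s b A -> nrm s K a <= A.
Proof.
  intros E [HA H]. unfold nrm. rewrite <- (sqrt_pow2 A HA). apply sqrt_le_1_alt.
  rewrite (rsum_ext _ (fun xi => (wt s xi * Cmod (b xi)) ^ 2)); [apply H, NoDup_zr|].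
  intros xi Hxi. rewrite E; auto.
Qed.

Lemma re_mult_half (a b : C) :
  Re ((b - a) * Cconj (RtoC (/ 2) * (b + a)))%C = / 2 * (Cmod b ^ 2 - Cmod a ^ 2).
Proof.
  rewrite !Cmod2_alt. destruct a as [a1 a2], b as [b1 b2].
  unfold Cminus, Cplus, Copp, Cmult, Cconj, RtoC, Re, Im. cbn [fst snd]. ring.
Qed.

(** Test the error equation with the mean of the two errors: the dispersive
    part is skew-adjoint and disappears. *)
Lemma energy_step (k : nat) gamma m T B s R :
  (2 <= k)%nat -> 3 / 2 < s -> s <= gamma -> 1 <= m -> 0 < T -> 0 <= B -> 0 <= R ->
  exists C0, 0 <= C0 /\ forall u0 tc u eps, T < tc -> 0 < eps <= 1 ->
    classical_solution k eps tc u0 u -> regularity_bound gamma m T B u ->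
    forall K t tau w v, (1 <= K)%nat -> 0 <= t -> 0 < tau -> t + tau <= T ->
    isY K w -> isY K v -> real_valued w -> real_valued v -> Hs s w R -> Hs s v R ->
    CN_step k (2 * K) eps tau w v ->
    let x := nrm s K (fun xi => fourier (cpx (u t)) xi - fourier w xi)%C in
    let y := nrm s K (fun xi => fourier (cpx (u (t + tau)%R)) xi - fourier v xi)%C in
    y - x <= tau * (C0 * ((x + y) / 2) + C0 * (tau ^ 2 + Rpower (INR K) (- (gamma + m - s - 1)))).
Proof.
  intros Hk Hs' Hsg Hm HT HB HR.
  destruct (consistency k gamma m T B s Hk Hs' Hsg Hm HT HB) as [C1 [HC1 Hcons]].
  destruct (flux_stability s k R B Hs' ltac:(lia) HR HB) as [C2 [HC2 Hflux]].
  destruct (Hs_pow_diff (s + 1) k B ltac:(lra) HB) as [D [HD Hpd]].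
  assert (HDB : 0 <= D * B) by nra.
  exists (C1 + C2 + D * B). split; [lra|].
  intros u0 tc u eps HTc Heps Hsol Hreg K t tau w v HK Ht Htau Htt Yw Yv Rw Rv Hw Hv HCN x y.
  set (f := cpx (u t)) in *. set (g := cpx (u (t + tau))) in *.
  set (sg := gamma + m). set (rho := Rpower (INR K) (- (gamma + m - s - 1))).
  assert (Hrho : 0 < rho) by apply Rpower_pos.
  assert (Hf : Hs sg f B) by (apply (reg_Hs gamma m T B u); auto; unfold sg; lra).
  assert (Hg : Hs sg g B) by (apply (reg_Hs gamma m T B u); auto; unfold sg; lra).
  set (a := half_sum g f). set (h := half_sum v w).
  assert (Ha : Hs sg a B).
  { replace B with (/ 2 * (B + B)) by field. apply Hs_half_sum; auto. }
  assert (Hh : Hs s h R).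
  { replace R with (/ 2 * (R + R)) by field. apply Hs_half_sum; auto. }
  assert (Yh : isY K h) by (apply isY_half_sum; auto).
  assert (Rh : real_valued h) by (apply real_half_sum; auto).
  set (eta := fun xi => (fourier f xi - fourier w xi)%C) in *.
  set (eta' := fun xi => (fourier g xi - fourier v xi)%C) in *.
  set (e := fun xi => (RtoC (/ 2) * (eta' xi + eta xi))%C).
  assert (Cf : cts f) by apply Hf. assert (Cg : cts g) by apply Hg.
  assert (Cw : cts w) by apply Hw. assert (Cv : cts v) by apply Hv.
  assert (Ee : forall xi, e xi = (fourier a xi - fourier h xi)%C).
  { intros xi. unfold e, eta, eta', a, h. rewrite !fourier_half_sum by auto. ring. }
  set (E := (x + y) / 2).
  assert (Hx : 0 <= x) by apply nrm_pos. assert (Hy : 0 <= y) by apply nrm_pos.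
  assert (HE0 : 0 <= E) by (unfold E; lra).
  assert (HE : hb s (fourier (tp K e)) E).
  { replace E with (/ 2 * (y + x)) by (unfold E; field).
    apply (proj2 (Hs_ext s (fun z => RtoC (/ 2) * (tp K eta' z + tp K eta z))%C (tp K e) _
      ltac:(intros z; unfold e; rewrite tp_scal, tp_plus; reflexivity)
      (Hs_half s _ _ (Hs_plus s _ _ _ _ (conj (pc_tp K eta') (hb_tp_nrm s K eta'))
         (conj (pc_tp K eta) (hb_tp_nrm s K eta)))))). }
  set (va := tp K (fourier a)). set (ht := tp K (fourier h)).
  assert (Eht : forall z, ht z = h z) by (intros; symmetry; apply Yh).
  assert (Hva : Hs sg va B) by (apply Hs_tp_fourier; auto).
  set (G1 := defect k eps tau f g).
  set (G2 := fun xi => (dmul xi * (fourier (fun z => a z ^ k)%C xi - fourier (fun z => va z ^ k)%C xi))%C).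
  set (G3 := fun xi => (dmul xi * (fourier (fun z => va z ^ k)%C xi - fourier (fun z => ht z ^ k)%C xi))%C).
  assert (Key : forall xi, In xi (zr K) ->
    (eta' xi - eta xi)%C = (G1 xi + (- RtoC (tau * eps ^ 2)) * (dmul xi ^ 3 * e xi)
       + (- RtoC (tau / INR k)) * G2 xi + (- RtoC (tau / INR k)) * G3 xi)%C).
  { intros xi Hxi.
    pose proof (proj1 (CN_step_defect k K eps tau w v ltac:(lia) Htau Yw Yv) HCN xi Hxi) as Z.
    rewrite Ee. unfold G1, G2, G3, eta, eta'.
    rewrite (fourier_ext (fun z => ht z ^ k)%C (fun z => h z ^ k)%C) by (intros; rewrite Eht; auto).
    match goal with |- ?l = ?r => replace r with (r - RtoC 0)%C by ring end.
    rewrite <- Z. unfold defect. fold a h. ring. }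
  pose proof (NoDup_zr K) as ND.
  assert (On : forall G : Z -> C, rsum (fun xi => wt s xi ^ 2 * Re (G xi * Cconj (e xi))%C) (zr K)
     = rsum (fun xi => wt s xi ^ 2 * Re (G xi * Cconj (fourier (tp K e) xi))%C) (zr K)).
  { intros G. apply rsum_ext. intros xi Hxi. rewrite fourier_tp_in; auto. }
  assert (B1 : Rabs (rsum (fun xi => wt s xi ^ 2 * Re (G1 xi * Cconj (e xi))%C) (zr K)) <= C1 * tau ^ 3 * E).
  { rewrite On. apply weighted_pair; auto. apply (Hcons u0 tc u eps); auto. }
  assert (HG2 : hb s G2 (D * (rho * B))).
  { apply hb_dmul.
    apply hb_ext with (fourier (fun z => a z ^ k - va z ^ k)%C).
    - intros xi. apply fourier_minus; apply pc_cts, pc_pow; [apply Ha|apply pc_tp].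
    - apply Hpd.
      + apply Hs_mono with sg; auto. unfold sg; lra.
      + apply Hs_mono with sg; auto. unfold sg; lra.
      + unfold rho. replace (gamma + m - s - 1) with (sg - (s + 1)) by (unfold sg; ring).
        apply Hs_proj_error; auto. unfold sg; lra. }
  assert (B2 : Rabs (rsum (fun xi => wt s xi ^ 2 * Re (G2 xi * Cconj (e xi))%C) (zr K)) <= D * (rho * B) * E).
  { rewrite On. apply weighted_pair; auto. }
  assert (Eva : forall z, (va z - ht z)%C = tp K e z).
  { intros z. unfold va, ht.
    match goal with |- (?p - ?q)%C = _ => replace (p - q)%C with (p + (- RtoC 1) * q)%C by ring end.
    rewrite <- tp_scal, <- tp_plus. apply tp_ext. intros xi _. rewrite Ee. ring. }
  assert (B3 : Rabs (rsum (fun xi => wt s xi ^ 2 * Re (G3 xi * Cconj (e xi))%C) (zr K)) <= C2 * E ^ 2).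
  { rewrite On.
    rewrite (rsum_ext _ (fun xi => wt s xi ^ 2 * Re (dmul xi *
       (fourier (fun z => tp K (fourier a) z ^ k)%C xi - fourier (fun z => tp K (fourier h) z ^ k)%C xi) *
       Cconj (fourier (fun z => tp K (fourier a) z - tp K (fourier h) z)%C xi))%C)).
    - apply Hflux.
      + apply Hs_ext with h; auto.
      + apply Hs_mono with sg; auto. unfold sg; lra.
      + intros z. fold ht. rewrite Eht. apply Rh.
      + apply Hs_ext with (tp K e); [intros; symmetry; apply Eva|]. split; [apply pc_tp|exact HE].
    - intros xi _. rewrite (fourier_ext (fun z => tp K (fourier a) z - tp K (fourier h) z)%C (tp K e) xi Eva).
      reflexivity. }
  assert (K1 : 1 <= INR k) by (apply (le_INR 1); lia).
  assert (K2 : 0 <= tau / INR k <= tau).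
  { unfold Rdiv. assert (0 < / INR k) by (apply Rinv_0_lt_compat; lra).
    assert (/ INR k <= 1) by (rewrite <- Rinv_1; apply Rinv_le_contravar; lra). nra. }
  set (S1 := rsum (fun xi => wt s xi ^ 2 * Re (G1 xi * Cconj (e xi))%C) (zr K)) in *.
  set (S2 := rsum (fun xi => wt s xi ^ 2 * Re (G2 xi * Cconj (e xi))%C) (zr K)) in *.
  set (S3 := rsum (fun xi => wt s xi ^ 2 * Re (G3 xi * Cconj (e xi))%C) (zr K)) in *.
  assert (Id : / 2 * (y ^ 2 - x ^ 2) = S1 - tau / INR k * S2 - tau / INR k * S3).
  { unfold x, y. rewrite !nrm_sq.
    replace (S1 - tau / INR k * S2 - tau / INR k * S3) with
      (S1 + (- (tau / INR k)) * S2 + (- (tau / INR k)) * S3) by ring.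
    unfold S1, S2, S3. rewrite <- !rsum_scal, <- !rsum_plus.
    replace (rsum (fun xi => (wt s xi * Cmod (eta' xi)) ^ 2) (zr K) -
       rsum (fun xi => (wt s xi * Cmod (eta xi)) ^ 2) (zr K)) with
      (rsum (fun xi => (wt s xi * Cmod (eta' xi)) ^ 2) (zr K) +
       (-1) * rsum (fun xi => (wt s xi * Cmod (eta xi)) ^ 2) (zr K)) by ring.
    rewrite <- rsum_scal, <- rsum_plus, <- rsum_scal. apply rsum_ext. intros xi Hxi.
    transitivity (wt s xi ^ 2 * Re ((eta' xi - eta xi) * Cconj (e xi))%C).
    - unfold e. rewrite re_mult_half. ring.
    - rewrite Key, dmul_cube by auto.
      destruct (G1 xi), (G2 xi), (G3 xi), (e xi).
      unfold Cminus, Cplus, Copp, Cmult, Cconj, RtoC, Re. cbn [fst snd]. ring. }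
  assert (Fin : (y - x) * E <= tau * E * ((C1 + C2 + D * B) * E + (C1 + C2 + D * B) * (tau ^ 2 + rho))).
  { replace ((y - x) * E) with (/ 2 * (y ^ 2 - x ^ 2)) by (unfold E; field). rewrite Id.
    pose proof (Rle_abs S1). pose proof (Rle_abs (- S2)). pose proof (Rle_abs (- S3)).
    rewrite Rabs_Ropp in *.
    assert (P2 : 0 <= D * (rho * B) * E) by (assert (0 <= rho * B) by nra; assert (0 <= D * (rho * B)) by nra; nra).
    assert (P3 : 0 <= C2 * E ^ 2) by (apply Rmult_le_pos; auto; apply pow2_ge_0).
    assert (Q2 : tau / INR k * - S2 <= tau * (D * (rho * B) * E)).
    { apply Rle_trans with (tau / INR k * (D * (rho * B) * E)).
      - apply Rmult_le_compat_l; lra.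
      - apply Rmult_le_compat_r; lra. }
    assert (Q3 : tau / INR k * - S3 <= tau * (C2 * E ^ 2)).
    { apply Rle_trans with (tau / INR k * (C2 * E ^ 2)).
      - apply Rmult_le_compat_l; lra.
      - apply Rmult_le_compat_r; lra. }
    apply Rle_trans with (tau * E * (C2 * E + C1 * tau ^ 2 + D * B * rho)); [lra|].
    apply Rmult_le_compat_l; [nra|].
    assert (T2 : 0 <= tau ^ 2) by apply pow2_ge_0.
    assert (0 <= (C1 + D * B) * E) by nra. assert (0 <= C1 * rho) by nra.
    assert (0 <= C2 * (tau ^ 2 + rho)) by nra. assert (0 <= D * B * tau ^ 2) by nra. nra. }
  set (W := (C1 + C2 + D * B) * E + (C1 + C2 + D * B) * (tau ^ 2 + rho)) in *.
  assert (T2 : 0 <= tau ^ 2) by apply pow2_ge_0.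
  assert (HW : 0 <= W) by (unfold W; nra).
  change (y - x <= tau * W). clearbody W.
  destruct (Req_dec E 0) as [E0|En].
  - assert (x = 0) by (unfold E in E0; lra). assert (y = 0) by (unfold E in E0; lra).
    assert (0 <= tau * W) by nra. lra.
  - apply Rmult_le_reg_r with E; [lra|]. lra.
Qed.

(** Since tau C <= 1, the implicit term can be absorbed at the price of a factor 2. *)
Lemma discrete_Gronwall (x : nat -> R) n tau C d :
  0 <= C -> 0 <= d -> 0 < tau -> tau * C <= 1 -> (forall j, 0 <= x j) ->
  (forall j, (j < n)%nat -> x (S j) - x j <= tau * (C * ((x j + x (S j)) / 2) + d)) ->
  forall j, (j <= n)%nat -> x j <= exp (2 * C * (INR j * tau)) * (x 0%nat + 2 * d * (INR j * tau)).
Proof.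
  intros HC Hd Ht Hs' Hx H. induction j as [|j IH]; intros Hj.
  - simpl. rewrite Rmult_0_l, Rmult_0_r, Rmult_0_r, exp_0. lra.
  - specialize (IH ltac:(lia)). specialize (H j ltac:(lia)).
    set (p := tau * C) in *. assert (Hp : 0 <= p) by (unfold p; nra).
    assert (S1 : x (S j) <= (1 + 2 * p) * x j + 2 * tau * d).
    { pose proof (Hx j). pose proof (Hx (S j)).
      assert (E : x (S j) * (1 - p / 2) <= x j * (1 + p / 2) + tau * d) by (unfold p in *; lra).
      assert (F : (x j * (1 + p / 2) + tau * d) <= ((1 + 2 * p) * x j + 2 * tau * d) * (1 - p / 2)).
      { assert (0 <= tau * d) by nra. assert (0 <= x j * (p * (1 - p))) by (apply Rmult_le_pos; nra).
        assert (0 <= tau * d * (1 - p)) by nra. nra. }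
      apply Rmult_le_reg_r with (1 - p / 2); lra. }
    rewrite S_INR. set (q := INR j * tau) in *.
    assert (Hq : 0 <= q) by (unfold q; apply Rmult_le_pos; [apply pos_INR|lra]).
    replace ((INR j + 1) * tau) with (q + tau) by (unfold q; ring).
    replace (2 * C * (q + tau)) with (2 * C * q + 2 * p) by (unfold p; ring). rewrite exp_plus.
    pose proof (exp_ineq1_le (2 * p)) as Ee. set (a := exp (2 * C * q)) in *.
    assert (Ha : 1 <= a).
    { unfold a. pose proof (exp_ineq1_le (2 * C * q)). assert (0 <= C * q) by nra. lra. }
    set (b := exp (2 * p)) in *. pose proof (Hx 0%nat) as X0.
    assert (Z : 0 <= x 0%nat + 2 * d * q) by nra.
    assert (A1 : (1 + 2 * p) * x j <= b * (a * (x 0%nat + 2 * d * q))) by (apply Rmult_le_compat; auto; lra).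
    assert (A2 : 2 * tau * d <= a * b * (2 * d * tau)).
    { assert (0 <= d * tau) by nra. assert (1 <= a * b) by nra. nra. }
    lra.
Qed.

Lemma solution_minus_isY s K f B w :
  Hs s f B -> isY K w ->
  forall z, w z = (tp K (fourier f) z - tp K (fun xi => fourier f xi - fourier w xi)%C z)%C.
Proof.
  intros Hf Yw z. rewrite (Yw z).
  match goal with |- _ = (?p - ?q)%C => replace (p - q)%C with (p + (- RtoC 1) * q)%C by ring end.
  rewrite <- tp_scal, <- tp_plus. apply tp_ext. intros; ring.
Qed.

(** The hypothesis on the norms of [U n] involves only the steps actually taken, so
    that for [n0 = 0] the lemma is the bound on the initial error. *)
Lemma error_bound (k : nat) gamma m T B s R :
  (2 <= k)%nat -> 3 / 2 < s -> s <= gamma -> 1 <= m -> 0 < T -> 0 <= B -> 0 <= R ->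
  exists C0 tau1, 0 <= C0 /\ 0 < tau1 /\ forall u0 tc u eps, T < tc -> 0 < eps <= 1 ->
    classical_solution k eps tc u0 u -> regularity_bound gamma m T B u ->
    forall K tau U n0, (1 <= K)%nat -> 0 < tau <= tau1 -> INR n0 * tau <= T ->
    (forall z, U 0%nat z = proj (2 * K) (interp (2 * (2 * K)) (cpx u0)) z) ->
    (forall n, (n <= n0)%nat -> isY K (U n) /\ real_valued (U n)) ->
    (forall n, (n < n0)%nat -> Hs s (U n) R /\ Hs s (U (S n)) R) ->
    (forall n, (n < n0)%nat -> CN_step k (2 * K) eps tau (U n) (U (S n))) ->
    forall n, (n <= n0)%nat ->
      nrm s K (fun xi => fourier (cpx (u (INR n * tau)%R)) xi - fourier (U n) xi)%C
      <= C0 * (tau ^ 2 + Rpower (INR K) (- (gamma + m - s - 1))).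
Proof.
  intros Hk Hs' Hsg Hm HT HB HR.
  destruct (energy_step k gamma m T B s R Hk Hs' Hsg Hm HT HB HR) as [C1 [HC1 Hen]].
  destruct (interpolation_error s (gamma + m) ltac:(lra) ltac:(lra)) as [C2 [HC2 Hint]].
  assert (X1 : 0 < exp (2 * C1 * T)) by apply exp_pos.
  exists (exp (2 * C1 * T) * (C2 * B + 2 * C1 * T)), (/ (C1 + 1)).
  assert (HCB : 0 <= C2 * B) by nra. assert (HCT : 0 <= C1 * T) by nra.
  split; [apply Rmult_le_pos; lra|]. split; [apply Rinv_0_lt_compat; lra|].
  intros u0 tc u eps HTc Heps Hsol Hreg K tau U n0 HK Htau Hn0 HU0 HU HR' HCN n Hn.
  set (rho := Rpower (INR K) (- (gamma + m - s - 1))). assert (Hrho : 0 < rho) by apply Rpower_pos.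
  set (x := fun j => nrm s K (fun xi => fourier (cpx (u (INR j * tau)%R)) xi - fourier (U j) xi)%C).
  assert (T2 : 0 <= tau ^ 2) by apply pow2_ge_0.
  assert (Hsm : tau * C1 <= 1).
  { apply Rle_trans with (/ (C1 + 1) * C1); [apply Rmult_le_compat_r; lra|].
    apply Rmult_le_reg_l with (C1 + 1); [lra|]. field_simplify; lra. }
  assert (Hd : 0 <= C1 * (tau ^ 2 + rho)) by (apply Rmult_le_pos; lra).
  assert (Time : forall j, (j <= n0)%nat -> 0 <= INR j * tau <= T).
  { intros j Hj. split; [apply Rmult_le_pos; [apply pos_INR|lra]|].
    eapply Rle_trans; [|exact Hn0]. apply Rmult_le_compat_r; [lra|]. apply le_INR; auto. }
  assert (Step : forall j, (j < n0)%nat ->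
    x (S j) - x j <= tau * (C1 * ((x j + x (S j)) / 2) + C1 * (tau ^ 2 + rho))).
  { intros j Hj. destruct (HU j ltac:(lia)) as [Y1 R1]. destruct (HU (S j) ltac:(lia)) as [Y2 R2].
    destruct (HR' j Hj) as [H1 H2].
    destruct (Time (S j) ltac:(lia)) as [_ TS]. destruct (Time j ltac:(lia)) as [T0 _].
    unfold x. rewrite S_INR. rewrite S_INR in TS.
    replace ((INR j + 1) * tau) with (INR j * tau + tau) in * by ring.
    apply (Hen u0 tc u eps HTc Heps Hsol Hreg K (INR j * tau) tau (U j) (U (S j))); auto; lra. }
  assert (X0 : x 0%nat <= C2 * rho * B).
  { assert (Hu0 : Hs (gamma + m) (cpx u0) B).
    { apply Hs_ext with (cpx (u 0)); [intros z; unfold cpx; rewrite (sol_init _ _ _ _ _ Hsol); auto|].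
      apply (reg_Hs gamma m T B u); auto; lra. }
    apply nrm_le with (fourier (tp K (fun xi => fourier (cpx u0) xi - dft (4 * K) (cpx u0) xi)%C)).
    - intros xi Hxi. rewrite fourier_tp_in by auto. f_equal.
      + apply fourier_ext. intros z. unfold cpx. simpl. rewrite Rmult_0_l, (sol_init _ _ _ _ _ Hsol). auto.
      + f_equal. rewrite (fourier_ext _ (tp K (dft (4 * K) (cpx u0)))).
        * apply fourier_tp_in; auto.
        * intros z. rewrite HU0. apply initial_tp; auto.
    - unfold rho. apply Hint; auto. }
  pose proof (discrete_Gronwall x n0 tau C1 (C1 * (tau ^ 2 + rho)) HC1 Hd ltac:(lra) Hsm
    (fun j => nrm_pos _ _ _) Step n Hn) as G.
  fold (x n). eapply Rle_trans; [exact G|].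
  destruct (Time n Hn) as [Tn0 Tn].
  rewrite (Rmult_assoc (exp _)). apply Rmult_le_compat.
  - left; apply exp_pos.
  - pose proof (nrm_pos s K (fun xi => fourier (cpx (u (INR 0 * tau)%R)) xi - fourier (U 0%nat) xi)%C) as P.
    fold (x 0%nat) in P. assert (0 <= C1 * (tau ^ 2 + rho) * (INR n * tau)) by (apply Rmult_le_pos; auto). lra.
  - assert (C1 * (INR n * tau) <= C1 * T) by (apply Rmult_le_compat_l; auto).
    destruct (Req_dec (2 * C1 * (INR n * tau)) (2 * C1 * T)) as [->|]; [lra|].
    left. apply exp_increasing. lra.
  - assert (A1 : C1 * (tau ^ 2 + rho) * (INR n * tau) <= C1 * (tau ^ 2 + rho) * T)
      by (apply Rmult_le_compat_l; auto).
    assert (A2 : 0 <= C2 * B * tau ^ 2) by (apply Rmult_le_pos; auto). lra.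
Qed.

(** * Convergence *)

Lemma Rpower_small a e :
  0 < a -> 0 < e -> exists n0 : nat, forall n, (1 <= n)%nat -> (n0 <= n)%nat -> Rpower (INR n) (- a) <= e.
Proof.
  intros Ha He. destruct (INR_unbounded (Rpower e (- / a))) as [n0 Hn0]. exists n0.
  intros n Hn1 Hn. apply le_INR in Hn. assert (H1 : 1 <= INR n) by (apply (le_INR 1); auto).
  pose proof (Rpower_pos e (- / a)) as Hp.
  assert (E : Rpower (Rpower e (- / a)) a = / e).
  { rewrite Rpower_mult. replace (- / a * a) with (- (1)) by (field; lra).
    rewrite Rpower_Ropp, Rpower_1; auto. }
  rewrite Rpower_Ropp. rewrite <- (Rinv_inv e). apply Rinv_le_contravar; [apply Rinv_0_lt_compat; auto|].
  rewrite <- E. apply Rle_Rpower_l; lra.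
Qed.

(** Inverse inequality: frequencies are at most [K]. *)
Lemma nrm_inverse s d K a : 0 <= d -> nrm (s + d) K a <= Rpower (1 + INR K) d * nrm s K a.
Proof.
  intros Hd. apply nrm_le with (fourier (tp K a)).
  - intros xi Hxi. rewrite fourier_tp_in; auto.
  - pose proof (hb_tp_nrm s K a) as [H0 H].
    assert (P : 0 <= Rpower (1 + INR K) d) by (left; apply Rpower_pos).
    apply hb_dom with s (fourier (tp K a)); auto; [|split; auto].
    intros xi. destruct (in_dec Z.eq_dec xi (zr K)) as [Hi|Hn].
    + rewrite wt_plus, (Rmult_comm (wt s xi)), Rmult_assoc. apply Rmult_le_compat_r.
      * apply Rmult_le_pos; [left; apply wt_pos|apply Cmod_ge_0].
      * apply wt_upper; auto. apply in_zr in Hi. rewrite <- abs_IZR, INR_IZR_INZ. apply IZR_le. lia.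
    + rewrite fourier_tp_out, Cmod_0 by auto. rewrite !Rmult_0_r. lra.
Qed.

(** Solvability of a step is only known once the error at its starting point has
    been bounded, so existence and error bound are established together, one time
    level after the other. *)
Record partial_solution (k K : nat) (r eps tau : R) (u0 : R -> R) (U : nat -> R -> C) (n0 : nat) : Prop := {
  part_init : forall z, U 0%nat z = proj (2 * K) (interp (2 * (2 * K)) (cpx u0)) z;
  part_Y : forall n, (n <= n0)%nat -> isY K (U n);
  part_CN : forall n, (n < n0)%nat -> CN_step k (2 * K) eps tau (U n) (U (S n));
  part_lim : forall n, (n < n0)%nat -> is_fixed_point_limit k (2 * K) r eps tau (U n) (U (S n))
}.

Lemma partial_solution_le k K r eps tau u0 U n0 n1 :
  (n1 <= n0)%nat -> partial_solution k K r eps tau u0 U n0 -> partial_solution k K r eps tau u0 U n1.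
Proof.
  intros H [H1 H2 H3 H4]. split; auto; intros n Hn.
  - apply H2; lia.
  - apply H3; lia.
  - apply H4; lia.
Qed.

Lemma isY_initial K (u0 : R -> R) f :
  (1 <= K)%nat -> (forall z, f z = proj (2 * K) (interp (2 * (2 * K)) (cpx u0)) z) ->
  isY K f /\ real_valued f.
Proof.
  intros HK H.
  assert (E : forall z, f z = tp K (dft (4 * K) (cpx u0)) z) by (intros z; rewrite H; apply initial_tp; auto).
  split; [apply (isY_of_tp K _ _ E)|]. intros z. rewrite E. apply real_tp.
  intros xi. apply dft_conj. lia.
Qed.

(** In a Sobolev norm weaker than the one in which the data are controlled the
    error is small, so that the numerical solution cannot leave the ball in
    which the implicit step is solvable. *)
Lemma a_priori_bound (k : nat) gamma m T B s :
  (2 <= k)%nat -> 3 / 2 < s -> s <= gamma -> 1 <= m -> 0 < T -> 0 <= B ->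
  exists C0 tau1 P, 0 <= C0 /\ 0 < tau1 /\ 0 <= P /\ forall u0 tc u eps, T < tc -> 0 < eps <= 1 ->
    classical_solution k eps tc u0 u -> regularity_bound gamma m T B u ->
    forall K r tau U n0, (1 <= K)%nat -> 0 <= r -> 0 < tau <= tau1 -> tau * INR K * P <= 1 ->
    C0 * (tau ^ 2 + Rpower (INR K) (- (gamma + m - s - 1))) <= 1 ->
    INR n0 * tau <= T -> partial_solution k K r eps tau u0 U n0 ->
    forall n, (n <= n0)%nat -> real_valued (U n) /\ Hs s (U n) (B + 1) /\
      nrm s K (fun xi => fourier (cpx (u (INR n * tau)%R)) xi - fourier (U n) xi)%C
      <= C0 * (tau ^ 2 + Rpower (INR K) (- (gamma + m - s - 1))).
Proof.
  intros Hk Hs' Hsg Hm HT HB.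
  destruct (error_bound k gamma m T B s (B + 2) Hk Hs' Hsg Hm HT HB ltac:(lra)) as [C0 [tau1 [HC0 [Htau1 Herr]]]].
  destruct (fixed_point_limit_bound s k (B + 1) ltac:(lra) ltac:(lia) ltac:(lra)) as [P [HP Hfix]].
  exists C0, tau1, P. split; auto. split; auto. split; auto.
  intros u0 tc u eps HTc Heps Hsol Hreg K r tau U n0 HK Hr Htau HtP Hsmall.
  (* U n is the projection of u, of norm at most B, minus an error of norm at most 1 *)
  assert (Ball : forall n, 0 <= INR n * tau <= T -> isY K (U n) ->
    nrm s K (fun xi => fourier (cpx (u (INR n * tau)%R)) xi - fourier (U n) xi)%C <= 1 -> Hs s (U n) (B + 1)).
  { intros n Hn Yn H1.
    assert (Hf : Hs s (cpx (u (INR n * tau))) B) by (apply (reg_Hs gamma m T B u); auto; lra).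
    apply Hs_ext with (fun z => tp K (fourier (cpx (u (INR n * tau)%R))) z -
       tp K (fun xi => fourier (cpx (u (INR n * tau)%R)) xi - fourier (U n) xi)%C z)%C.
    - intros z. symmetry. apply (solution_minus_isY s K _ B); auto.
    - apply Hs_minus; [apply Hs_tp_fourier; auto|].
      split; [apply pc_tp|]. eapply hb_le; [exact H1|apply hb_tp_nrm]. }
  induction n0 as [|n0 IH]; intros Hn0 Hpart.
  - destruct (isY_initial K u0 (U 0%nat) HK (part_init _ _ _ _ _ _ _ _ Hpart)) as [Y0 R0].
    pose proof (Herr u0 tc u eps HTc Heps Hsol Hreg K tau U 0%nat HK Htau Hn0
      (part_init _ _ _ _ _ _ _ _ Hpart)) as Hb.
    intros n Hn. replace n with 0%nat by lia.
    assert (H0 : nrm s K (fun xi => fourier (cpx (u (INR 0 * tau)%R)) xi - fourier (U 0%nat) xi)%C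
      <= C0 * (tau ^ 2 + Rpower (INR K) (- (gamma + m - s - 1)))).
    { apply Hb; try (intros; lia). intros j Hj. replace j with 0%nat by lia. auto. }
    split; auto. split; auto. apply Ball; auto; [|lra].
    change (INR 0) with 0. rewrite Rmult_0_l. lra.
  - rewrite S_INR in Hn0.
    assert (Hn0' : INR n0 * tau <= T) by lra.
    specialize (IH Hn0' (partial_solution_le _ _ _ _ _ _ _ _ n0 (Nat.le_succ_diag_r n0) Hpart)).
    destruct (IH n0 (le_n n0)) as [Rn [Hn _]].
    pose proof (part_Y _ _ _ _ _ _ _ _ Hpart) as HY.
    destruct (Hfix K r eps tau (U n0) (U (S n0)) Hr ltac:(lra) HtP (HY n0 ltac:(lia)) Hn Rn (HY (S n0) ltac:(lia))
      (part_lim _ _ _ _ _ _ _ _ Hpart n0 ltac:(lia))) as [HS RS].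
    assert (All : forall n, (n <= S n0)%nat -> real_valued (U n) /\ Hs s (U n) (B + 2)).
    { intros n Hle. destruct (Nat.eq_dec n (S n0)) as [->|].
      - split; auto. replace (B + 2) with (B + 1 + 1) by ring. auto.
      - destruct (IH n ltac:(lia)) as [? [? _]]. split; auto. apply Hs_le with (B + 1); auto; lra. }
    assert (Hn1 : INR (S n0) * tau <= T) by (rewrite S_INR; lra).
    pose proof (Herr u0 tc u eps HTc Heps Hsol Hreg K tau U (S n0) HK Htau Hn1
      (part_init _ _ _ _ _ _ _ _ Hpart) (fun n Hle => conj (HY n Hle) (proj1 (All n Hle)))
      (fun n Hlt => conj (proj2 (All n ltac:(lia))) (proj2 (All (S n) ltac:(lia))))
      (part_CN _ _ _ _ _ _ _ _ Hpart)) as Hb.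
    intros n Hle. destruct (All n Hle) as [Rn' _]. split; auto. split; [|apply Hb; auto].
    apply Ball; auto.
    + split; [apply Rmult_le_pos; [apply pos_INR|lra]|].
      eapply Rle_trans; [|exact Hn1]. apply Rmult_le_compat_r; [lra|]. apply le_INR; auto.
    + eapply Rle_trans; [apply Hb; auto|auto].
Qed.

(** The a priori bound puts the current value in the ball where the next implicit
    step can be solved. *)
Lemma partial_solution_exists (k : nat) gamma m T B s :
  (2 <= k)%nat -> 3 / 2 < s -> s <= gamma -> 1 <= m -> 0 < T -> 0 <= B ->
  exists C0 tau1 P, 0 <= C0 /\ 0 < tau1 /\ 0 <= P /\ forall u0 tc u eps, T < tc -> 0 < eps <= 1 ->
    classical_solution k eps tc u0 u -> regularity_bound gamma m T B u ->
    forall K r tau, (1 <= K)%nat -> 0 <= r -> 0 < tau <= tau1 -> tau * INR K * P <= 1 ->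
    C0 * (tau ^ 2 + Rpower (INR K) (- (gamma + m - s - 1))) <= 1 ->
    (forall n0, INR n0 * tau <= T -> exists U, partial_solution k K r eps tau u0 U n0) /\
    (forall U n0, INR n0 * tau <= T -> partial_solution k K r eps tau u0 U n0 ->
      forall n, (n <= n0)%nat -> real_valued (U n) /\ Hs s (U n) (B + 1) /\
      nrm s K (fun xi => fourier (cpx (u (INR n * tau)%R)) xi - fourier (U n) xi)%C
      <= C0 * (tau ^ 2 + Rpower (INR K) (- (gamma + m - s - 1)))).
Proof.
  intros Hk Hs' Hsg Hm HT HB.
  destruct (a_priori_bound k gamma m T B s Hk Hs' Hsg Hm HT HB) as [C0 [tau1 [P1 [HC0 [Ht1 [HP1 Hap]]]]]].
  destruct (step_exists s k (B + 1) ltac:(lra) ltac:(lia) ltac:(lra)) as [P2 [HP2 Hex]].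
  exists C0, tau1, (P1 + P2). split; auto. split; auto. split; [lra|].
  intros u0 tc u eps HTc Heps Hsol Hreg K r tau HK Hr Htau HtP Hsmall.
  assert (HtK : 0 <= tau * INR K) by (apply Rmult_le_pos; [lra|apply pos_INR]).
  assert (Sm1 : tau * INR K * P1 <= 1) by nra. assert (Sm2 : tau * INR K * P2 <= 1) by nra.
  pose proof (fun U n0 => Hap u0 tc u eps HTc Heps Hsol Hreg K r tau U n0 HK Hr Htau Sm1 Hsmall) as Bd.
  split; [|exact Bd].
  induction n0 as [|n0 IH]; intros Hn0.
  - exists (fun _ => proj (2 * K) (interp (2 * (2 * K)) (cpx u0))). split; try (intros; lia); auto.
    intros n _. destruct (isY_initial K u0 _ HK (fun z => eq_refl)) as [Y _]. exact Y.
  - rewrite S_INR in Hn0. assert (Hn0' : INR n0 * tau <= T) by lra.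
    destruct (IH Hn0') as [U HU]. destruct (Bd U n0 Hn0' HU n0 (le_n n0)) as [Rn [Hn _]].
    destruct (Hex K r eps tau (U n0) Hr ltac:(lra) Sm2 (part_Y _ _ _ _ _ _ _ _ HU n0 (le_n n0)) Hn Rn)
      as [v [Yv [CNv Lv]]].
    exists (fun n => if le_dec n n0 then U n else v). split.
    + intros z. destruct (le_dec 0 n0); [|lia]. apply (part_init _ _ _ _ _ _ _ _ HU).
    + intros n _. destruct (le_dec n n0); auto. apply (part_Y _ _ _ _ _ _ _ _ HU); auto.
    + intros n Hlt. destruct (le_dec n n0); [|lia]. destruct (le_dec (S n) n0).
      * apply (part_CN _ _ _ _ _ _ _ _ HU). lia.
      * replace n with n0 by lia. auto.
    + intros n Hlt. destruct (le_dec n n0); [|lia]. destruct (le_dec (S n) n0).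
      * apply (part_lim _ _ _ _ _ _ _ _ HU). lia.
      * replace n with n0 by lia. auto.
Qed.

(** Bound in the strong norm: an inverse inequality applied to the weak-norm
    error gives boundedness, which is all that the energy estimate in H^gamma
    asks for. *)
Lemma strong_norm_error (k : nat) gamma m T B c0 d :
  (2 <= k)%nat -> 1 <= m -> 0 < T -> 0 <= B -> 0 < c0 -> 0 < d <= 1 -> 3 / 2 < gamma - d ->
  exists C0 tau1 P e, 0 <= C0 /\ 0 < tau1 /\ 0 <= P /\ 0 < e /\
    forall u0 tc u eps, T < tc -> 0 < eps <= 1 ->
    classical_solution k eps tc u0 u -> regularity_bound gamma m T B u ->
    forall K r tau, (1 <= K)%nat -> 0 <= r -> 0 < tau <= tau1 -> tau * INR K * P <= 1 ->
    tau * (2 * INR K) <= c0 -> Rpower (INR K) (- d) <= e ->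
    (forall n0, INR n0 * tau <= T -> exists U, partial_solution k K r eps tau u0 U n0) /\
    (forall U n0, INR n0 * tau <= T -> partial_solution k K r eps tau u0 U n0 ->
      forall n, (n <= n0)%nat ->
      Hs gamma (fun z => cpx (u (INR n * tau)%R) z - U n z)%C (C0 * (tau ^ 2 + Rpower (INR K) (- (m - 1))))).
Proof.
  intros Hk Hm HT HB Hc0 Hd Hgd.
  destruct (partial_solution_exists k gamma m T B (gamma - d) Hk Hgd ltac:(lra) Hm HT HB)
    as [C1 [ta [P [HC1 [Hta [HP Hweak]]]]]].
  set (R := B + C1 * (c0 + 2)). assert (HR : 0 <= R) by (unfold R; nra).
  destruct (error_bound k gamma m T B gamma R Hk ltac:(lra) ltac:(lra) Hm HT HB HR)
    as [C2 [tb [HC2 [Htb Herr]]]].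
  set (tc1 := / (2 * (C1 + 1))). assert (Htc : 0 < tc1) by (apply Rinv_0_lt_compat; lra).
  assert (Hhalf : C1 * tc1 <= / 2).
  { unfold tc1. apply Rmult_le_reg_l with (2 * (C1 + 1)); [lra|]. field_simplify; lra. }
  exists (B + C2), (Rmin (Rmin ta tb) (Rmin 1 tc1)), P, tc1.
  split; [lra|]. split; [repeat apply Rmin_glb_lt; lra|]. split; auto. split; auto.
  intros u0 tc u eps HTc Heps Hsol Hreg K r tau HK Hr Htau HtP HtK HKd.
  assert (t1 : tau <= ta) by (eapply Rle_trans; [apply Htau|eapply Rle_trans; [apply Rmin_l|apply Rmin_l]]).
  assert (t2 : tau <= tb) by (eapply Rle_trans; [apply Htau|eapply Rle_trans; [apply Rmin_l|apply Rmin_r]]).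
  assert (t3 : tau <= 1) by (eapply Rle_trans; [apply Htau|eapply Rle_trans; [apply Rmin_r|apply Rmin_l]]).
  assert (t4 : tau <= tc1) by (eapply Rle_trans; [apply Htau|eapply Rle_trans; [apply Rmin_r|apply Rmin_r]]).
  assert (HK1 : 1 <= INR K) by (apply (le_INR 1); auto).
  set (q := Rpower (INR K) (- (m - 1))). assert (Hq : 0 < q) by apply Rpower_pos.
  assert (Hq1 : q <= 1).
  { apply Rpower_le1; lra. }
  assert (Erho : Rpower (INR K) (- (gamma + m - (gamma - d) - 1)) = q * Rpower (INR K) (- d)).
  { unfold q. rewrite <- Rpower_plus. f_equal. ring. }
  assert (Hpd : 0 < Rpower (INR K) (- d)) by apply Rpower_pos.
  assert (Hsmall : C1 * (tau ^ 2 + Rpower (INR K) (- (gamma + m - (gamma - d) - 1))) <= 1).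
  { rewrite Erho. assert (tau ^ 2 <= tc1) by nra.
    assert (q * Rpower (INR K) (- d) <= tc1) by nra.
    assert (C1 * (tau ^ 2) <= C1 * tc1) by (apply Rmult_le_compat_l; auto).
    assert (C1 * (q * Rpower (INR K) (- d)) <= C1 * tc1) by (apply Rmult_le_compat_l; auto). lra. }
  destruct (Hweak u0 tc u eps HTc Heps Hsol Hreg K r tau HK Hr ltac:(lra) HtP Hsmall) as [Hex Hbd].
  split; [exact Hex|]. intros U n0 Hn0 Hpart.
  pose proof (Hbd U n0 Hn0 Hpart) as HU.
  set (eta := fun n xi => (fourier (cpx (u (INR n * tau)%R)) xi - fourier (U n) xi)%C).
  assert (Time : forall j, (j <= n0)%nat -> 0 <= INR j * tau <= T).
  { intros j Hj. split; [apply Rmult_le_pos; [apply pos_INR|lra]|].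
    eapply Rle_trans; [|exact Hn0]. apply Rmult_le_compat_r; [lra|]. apply le_INR; auto. }
  pose proof (part_Y _ _ _ _ _ _ _ _ Hpart) as HY.
  assert (Hf : forall n s', (n <= n0)%nat -> s' <= gamma + m -> Hs s' (cpx (u (INR n * tau))) B)
    by (intros; apply (reg_Hs gamma m T B u); auto).
  assert (HR' : forall n, (n <= n0)%nat -> Hs gamma (U n) R).
  { intros n Hn. destruct (HU n Hn) as [_ [_ Hw]]. fold (eta n) in Hw.
    apply Hs_ext with (fun z => tp K (fourier (cpx (u (INR n * tau)%R))) z - tp K (eta n) z)%C.
    - intros z. symmetry. apply (solution_minus_isY gamma K _ B); auto. apply Hf; auto; lra.
    - apply Hs_minus; [apply Hs_tp_fourier, Hf; auto; lra|].
      split; [apply pc_tp|]. apply hb_le with (nrm gamma K (eta n)); [|apply hb_tp_nrm].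
      pose proof (nrm_inverse (gamma - d) d K (eta n) ltac:(lra)) as Hi.
      replace (gamma - d + d) with gamma in Hi by ring.
      eapply Rle_trans; [exact Hi|].
      assert (W1 : Rpower (1 + INR K) d <= Rpower (2 * INR K) d) by (apply Rle_Rpower_l; lra).
      assert (W2 : Rpower (2 * INR K) d <= 2 * INR K).
      { rewrite <- (Rpower_1 (2 * INR K)) at 2 by lra. apply Rle_Rpower; lra. }
      assert (W3 : Rpower (2 * INR K) d * Rpower (INR K) (- d) <= 2).
      { rewrite <- Rpower_mult_distr by lra. rewrite Rmult_assoc, <- Rpower_plus, Rplus_opp_r, Rpower_O by lra.
        rewrite Rmult_1_r. rewrite <- (Rpower_1 2) at 2 by lra. apply Rle_Rpower; lra. }
      pose proof (Rpower_pos (1 + INR K) d) as W0. pose proof (Rpower_pos (2 * INR K) d) as W0'.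
      apply Rle_trans with (Rpower (2 * INR K) d * (C1 * (tau ^ 2 + q * Rpower (INR K) (- d)))).
      + rewrite <- Erho. apply Rmult_le_compat; auto; [lra|apply nrm_pos].
      + assert (Z1 : Rpower (2 * INR K) d * tau ^ 2 <= c0).
        { apply Rle_trans with (2 * INR K * tau ^ 2); [apply Rmult_le_compat_r; auto; apply pow2_ge_0|].
          replace (2 * INR K * tau ^ 2) with (tau * (2 * INR K) * tau) by ring.
          assert (0 <= tau * (2 * INR K)) by nra. nra. }
        assert (Z2 : Rpower (2 * INR K) d * (q * Rpower (INR K) (- d)) <= 2).
        { replace (Rpower (2 * INR K) d * (q * Rpower (INR K) (- d))) with
            (q * (Rpower (2 * INR K) d * Rpower (INR K) (- d))) by ring.
          assert (0 < Rpower (2 * INR K) d * Rpower (INR K) (- d)) by (apply Rmult_lt_0_compat; auto). nra. }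
        replace (Rpower (2 * INR K) d * (C1 * (tau ^ 2 + q * Rpower (INR K) (- d)))) with
          (C1 * (Rpower (2 * INR K) d * tau ^ 2 + Rpower (2 * INR K) d * (q * Rpower (INR K) (- d)))) by ring.
        apply Rmult_le_compat_l; lra. }
  intros n Hn.
  pose proof (Herr u0 tc u eps HTc Heps Hsol Hreg K tau U n0 HK ltac:(lra) Hn0
    (part_init _ _ _ _ _ _ _ _ Hpart) (fun j Hj => conj (HY j Hj) (proj1 (HU j Hj)))
    (fun j Hj => conj (HR' j (Nat.lt_le_incl _ _ Hj)) (HR' (S j) Hj))
    (part_CN _ _ _ _ _ _ _ _ Hpart) n Hn) as He.
  fold (eta n) in He. replace (gamma + m - gamma - 1) with (m - 1) in He by ring. fold q in He.
  apply Hs_ext with (fun z => (cpx (u (INR n * tau)%R) z - tp K (fourier (cpx (u (INR n * tau)%R))) z) + tp K (eta n) z)%C.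
  - intros z. rewrite (solution_minus_isY gamma K _ B (U n) (Hf n gamma Hn ltac:(lra)) (HY n Hn) z).
    unfold eta. ring.
  - apply Hs_le with (Rpower (INR K) (- (gamma + m - gamma)) * B + C2 * (tau ^ 2 + q)).
    + assert (E1 : Rpower (INR K) (- (gamma + m - gamma)) <= q) by (apply Rle_Rpower; lra).
      assert (T2 : 0 <= tau ^ 2) by apply pow2_ge_0. nra.
    + apply Hs_plus.
      * apply Hs_proj_error; auto; [lra|apply Hf; auto; lra].
      * split; [apply pc_tp|]. eapply hb_le; [exact He|apply hb_tp_nrm].
Qed.

Theorem theorem3p6 :
  forall (k : nat) (gamma m sigma0 c0 T M : R),
    (2 <= k)%nat -> 3 / 2 < gamma -> 1 <= m -> 0 < sigma0 -> 0 < c0 ->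
    0 < T -> 1 < M ->
    exists (N1 : nat) (tau1 K : R),
      (0 < N1)%nat /\ 0 < tau1 /\ 0 < K /\
      forall (u0 : R -> R) (tc : R) (u : R -> R -> R -> R),
        periodic u0 ->
        T < tc ->
        (forall eps, 0 < eps <= 1 ->
           classical_solution k eps tc u0 (u eps) /\
           regularity_bound gamma m T (M - 1) (u eps)) ->
        forall (eps tau : R) (N : nat),
          0 < eps <= 1 ->
          (0 < N)%nat -> Nat.Even N -> (N1 <= N)%nat ->
          0 < tau <= tau1 ->
          tau <= c0 * Rmin (Rpower eps (1 + sigma0))
                           (Rpower (INR N) (- (1 + sigma0))) ->
          (exists U : nat -> R -> C,
             numerical_solution k N gamma T eps tau u0 U) /\
          (forall U : nat -> R -> C,
             numerical_solution k N gamma T eps tau u0 U ->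
             forall n : nat, INR n <= T / tau ->
               Hnorm_le gamma (fun x => (RtoC (u eps (INR n * tau)%R x) - U n x)%C)
                 (K * (tau ^ 2 + Rpower (INR N) (- m + 1)))).
Proof.
  intros k gamma m sigma0 c0 T M Hk Hg Hm Hs0 Hc0 HT HM.
  (* the loss of regularity used to close the argument, at most 1 for the inverse inequality *)
  set (d := Rmin 1 ((gamma - 3 / 2) / 2)).
  assert (d1 : d <= 1) by apply Rmin_l. assert (d2 : d <= (gamma - 3 / 2) / 2) by apply Rmin_r.
  assert (d0 : 0 < d) by (apply Rmin_glb_lt; lra).
  destruct (strong_norm_error k gamma m T (M - 1) c0 d Hk Hm HT ltac:(lra) Hc0 ltac:(lra) ltac:(lra))
    as [C0 [tau1 [P [e [HC0 [Ht1 [HP [He Hmain]]]]]]]].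
  assert (Hcp : 0 < c0 * P + 1) by nra.
  destruct (Rpower_small sigma0 (/ (c0 * P + 1)) Hs0 ltac:(apply Rinv_0_lt_compat; auto)) as [n1 Hn1].
  destruct (Rpower_small d e d0 He) as [n2 Hn2].
  pose proof (Rpower_pos 2 (m - 1)) as P2.
  exists (n1 + 2 * n2 + 2)%nat, tau1, ((C0 + 1) * Rpower 2 (m - 1)).
  split; [lia|]. split; auto. split; [nra|].
  intros u0 tc u Hper HTc Hu eps tau N Heps HN0 [K ->] HN Htau Hstep.
  destruct (Hu eps Heps) as [Hsol Hreg].
  assert (HK : (1 <= K)%nat) by lia.
  assert (HK1 : 1 <= INR K) by (apply (le_INR 1); auto).
  assert (EN : INR (2 * K) = 2 * INR K) by (rewrite mult_INR; simpl; ring).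
  rewrite EN in *.
  assert (HtN : tau * (2 * INR K) <= c0 * Rpower (2 * INR K) (- sigma0)).
  { apply Rle_trans with (c0 * Rpower (2 * INR K) (- (1 + sigma0)) * (2 * INR K)).
    - apply Rmult_le_compat_r; [lra|]. eapply Rle_trans; [exact Hstep|].
      apply Rmult_le_compat_l; [lra|apply Rmin_r].
    - rewrite Rmult_assoc. apply Rmult_le_compat_l; [lra|].
      rewrite <- (Rpower_1 (2 * INR K)) at 2 by lra. rewrite <- Rpower_plus. right. f_equal. ring. }
  assert (HNs : Rpower (2 * INR K) (- sigma0) <= / (c0 * P + 1)).
  { rewrite <- EN. apply Hn1; lia. }
  assert (Hns0 : 0 < Rpower (2 * INR K) (- sigma0)) by apply Rpower_pos.
  assert (Hns1 : Rpower (2 * INR K) (- sigma0) <= 1).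
  { apply Rpower_le1; lra. }
  assert (HtK : tau * (2 * INR K) <= c0) by nra.
  assert (HtP : tau * INR K * P <= 1).
  { apply Rle_trans with (c0 * / (c0 * P + 1) * P).
    - apply Rmult_le_compat_r; auto. apply Rle_trans with (tau * (2 * INR K)); [nra|].
      eapply Rle_trans; [exact HtN|]. apply Rmult_le_compat_l; lra.
    - apply Rmult_le_reg_l with (c0 * P + 1); auto. field_simplify; lra. }
  destruct (Hmain u0 tc (u eps) eps HTc Heps Hsol Hreg K gamma tau HK ltac:(lra) Htau HtP HtK
    ltac:(apply Hn2; lia)) as [Hex Herr].
  assert (Hdiv : forall n, INR n <= T / tau <-> INR n * tau <= T).
  { intros n. split; intros H.
    - apply (Rmult_le_compat_r tau) in H; [|lra]. replace (T / tau * tau) with T in H by (field; lra). auto.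
    - apply Rmult_le_reg_r with tau; [lra|]. replace (T / tau * tau) with T by (field; lra). auto. }
  split.
  - (* the scheme runs up to time T, that is up to the integer part of T / tau *)
    destruct (nfloor_ex (T / tau)) as [n0 [Hn0 Hn0']]; [apply Rlt_le, Rdiv_lt_0_compat; lra|].
    assert (Hle : forall n, INR n <= T / tau -> (n <= n0)%nat).
    { intros n Hn. assert (H : INR n < INR (n0 + 1)) by (rewrite plus_INR; simpl; lra).
      apply INR_lt in H. lia. }
    destruct (Hex n0 (proj1 (Hdiv n0) Hn0)) as [U HU]. exists U. split.
    + apply (part_init _ _ _ _ _ _ _ _ HU).
    + intros n Hn. apply isY_in_Y, (part_Y _ _ _ _ _ _ _ _ HU). auto.
    + intros n Hn. apply (part_CN _ _ _ _ _ _ _ _ HU). apply (Hle _ Hn).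
    + intros n Hn. apply (part_lim _ _ _ _ _ _ _ _ HU). apply (Hle _ Hn).
  - intros U HU n Hn.
    assert (Hpart : partial_solution k K gamma eps tau u0 U n).
    { assert (Hj : forall j, (j <= n)%nat -> INR j <= T / tau).
      { intros j Hjn. eapply Rle_trans; [apply le_INR; exact Hjn|auto]. }
      split.
      - apply (num_init _ _ _ _ _ _ _ _ HU).
      - intros j Hjn. apply isY_in_Y, (num_space _ _ _ _ _ _ _ _ HU). auto.
      - intros j Hjn. apply (num_scheme _ _ _ _ _ _ _ _ HU). apply Hj. lia.
      - intros j Hjn. apply (num_limit _ _ _ _ _ _ _ _ HU). apply Hj. lia. }
    apply in_H_of_hb. apply Hs_le with (C0 * (tau ^ 2 + Rpower (INR K) (- (m - 1)))).
    + assert (EK : Rpower (INR K) (- (m - 1)) = Rpower 2 (m - 1) * Rpower (2 * INR K) (- m + 1)).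
      { replace (- m + 1) with (- (m - 1)) by ring. rewrite <- Rpower_mult_distr by lra.
        rewrite <- Rmult_assoc, <- Rpower_plus, Rplus_opp_r, Rpower_O by lra. ring. }
      rewrite EK. pose proof (Rpower_pos (2 * INR K) (- m + 1)) as Pm.
      pose proof (Rpower_ge1 2 (m - 1) ltac:(lra) ltac:(lra)) as G2.
      assert (T2 : 0 <= tau ^ 2) by apply pow2_ge_0.
      set (p2 := Rpower 2 (m - 1)) in *. set (pm := Rpower (2 * INR K) (- m + 1)) in *.
      apply Rle_trans with (C0 * (p2 * (tau ^ 2 + pm))).
      * apply Rmult_le_compat_l; auto. nra.
      * assert (0 <= p2 * (tau ^ 2 + pm)) by (apply Rmult_le_pos; lra). nra.
    + apply (Herr U n (proj1 (Hdiv n) Hn) Hpart n (le_n n)).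
Qed.
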